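(* Let $X$ be a discrete metric space of bounded geometry, and let $\mathcal{R}$ be a rank distribution on $X$ with $U:=U_{\mathcal{R}}$. Consider the following conditions: (1) $X$ has partial property A towards $\beta X\setminus U$; (2) for any $T\in\tilde I(\mathcal{R})$, $\varepsilon>0$ and $Y\subseteq X$ with $\overline{Y}^{\beta X}\subseteq U$, there exists $\phi_0\in\Gamma_{\mathcal{R}}$ such that $\|\Lambda_\phi\chi_YT-\chi_{\mathrm{supp}(\phi)\cap Y}T\|<\varepsilon$ whenever $\phi\ge\phi_0$ in $\Gamma_{\mathcal{R}}$; (3) $I(\mathcal{R})=\tilde I(\mathcal{R})$. Then (1) and (2) together imply (3), and (3) implies (2).
   Context: Bounded geometry: for every $r>0$, $\sup_{x\in X}\sharp B(x,r)<\infty$. A subset $E\subseteq X\times X$ is an entourage if $\sup_{(x,y)\in E}d(x,y)<\infty$. Put $E_r=\{(x,y): d(x,y)\le r\}$. Roe algebra: Fix a separable infinite-dimensional Hilbert space $\mathcal{H}$. Write $T\in\mathfrak{B}(\ell^2(X)\otimes\mathcal{H})$ as a matrix $[T(x,y)]_{x,y\in X}$ with $T(x,y)\in\mathfrak{B}(\mathcal{H})$. $T$ has finite propagation if $\{(x,y):T(x,y)\ne0\}$ is an entourage, and is locally compact if every $T(x,y)$ is compact. $\mathbb{C}[X]$ is the $*$-algebra of locally compact finite propagation operators and $C^*(X)$ is its norm closure. Rank distributions: A rank function is a function $\alpha:X\times X\to\mathbb{Z}_{\ge0}$ whose support $\mathrm{supp}(\alpha)=\{(x,y):\alpha(x,y)\neq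 0\}$ is an entourage. For an entourage $E$, $(E\cdot\alpha)(x,y)=\sum_{z}\chi_E(x,z)\alpha(z,y)$ and $(\alpha\cdot E)(x,y)=\sum_z\alpha(x,z)\chi_E(z,y)$; $\alpha^t(x,y)=\alpha(y,x)$; sums and the order $\le$ are pointwise. A rank distribution on $X$ is a collection $\mathcal{R}$ of rank functions such that: (i) if $\alpha,\beta\in\mathcal{R}$ and $E$ is an entourage then $\alpha+\beta,\alpha^t,E\cdot\alpha,\alpha\cdot E\in\mathcal{R}$; (ii) every rank function with finite support is in $\mathcal{R}$; (iii) if $\alpha$ is a rank function with $\alpha\le\beta$ for some $\beta\in\mathcal{R}$ then $\alpha\in\mathcal{R}$. Truncations: a compact operator $S$ on $\mathcal{H}$ has a singular value decomposition $S=\sum_i\lambda_i(S)\,u_i\otimes v_i$, with $(u\otimes v)x=\langle x,v\rangle u$, and for $\varepsilon>0$ its $\varepsilon$-truncation is $S_\varepsilon=\sum_{i:\lambda_i(S)\ge\varepsilon}\lambda_i(S)u_i\otimes v_i$. For $T\in C^*(X)$, $T_\varepsilon$ is the operator with entries $T_\varepsilon(x,y)=T(x,y)_\varepsilon$. If all entries of $T$ have finite rank, $\mathrm{RANK}(T)(x,y)=\mathrm{rank}(T(x,y))$. Ideals associated to $\mathcal{R}$: $I(\mathcal{R})$ is the norm closure of $C_{\mathcal{R}}=\{T\in\mathbb{C}[X]: T(x,y)\text{ has finite rank for all }x,y,\ \mathrm{RANK}(T)\in\mathcal{R}\}$; $\tilde I(\mathcal{R})=\{T\in C^*(X):\mathrm{RANK}(T_\varepsilon)\in\mathcal{R}\text{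 for all }\varepsilon>0\}$. The set $\Gamma_{\mathcal{R}}$: for $\alpha\in\mathcal{R}$ put $\varphi_\alpha(x)=\max_{y\in X}\alpha(x,y)$, and $\mathcal{L}(\mathcal{R})=\{\varphi_\alpha:\alpha\in\mathcal{R}\}$. Let $\mathfrak{F}_{\mathrm{proj}}(\mathcal{H})$ be the set of finite rank orthogonal projections on $\mathcal{H}$ (including $0$). $\Gamma_{\mathcal{R}}=\{\phi:X\to\mathfrak{F}_{\mathrm{proj}}(\mathcal{H}):\mathrm{rank}\circ\phi\in\mathcal{L}(\mathcal{R})\}$, directed by $\phi_1\le\phi_2$ iff the range of $\phi_1(x)$ is contained in the range of $\phi_2(x)$ for every $x\in X$. For $\phi\in\Gamma_{\mathcal{R}}$, $\mathrm{supp}(\phi)=\{x:\phi(x)\ne0\}$ and $\Lambda_\phi$ is the diagonal operator on $\ell^2(X)\otimes\mathcal{H}$ with $\Lambda_\phi(x,x)=\phi(x)$. For $Y\subseteq X$, $\chi_Y$ also denotes the operator $\chi_Y\otimes\mathrm{Id}_{\mathcal{H}}$ of multiplication by the characteristic function of $Y$. Coarse groupoid: $\beta X$ is the Stone–Čech compactification of the discrete set $X$. $G(X)=\bigcup_{r\ge0}\overline{E_r}^{\beta(X\times X)}\subseteq\beta(X\times X)$; the maps $r(x,y)=x$, $s(x,y)=y$ extend continuously to $r,s:G(X)\to\beta X$; $(r,s):G(X)\to\beta X\times\beta X$ is injective and $G(X)$ carries the groupoid structure induced from the pair groupoid, making it a locally compact Hausdorff étale groupoid with unit space $\beta X$. $U\subseteq\beta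 X$ is invariant if every $\gamma\in G(X)$ with $s(\gamma)\in U$ has $r(\gamma)\in U$. $U_{\mathcal{R}}:=\bigcup_{\alpha\in\mathcal{R}}\overline{r(\mathrm{supp}(\alpha))}$ (closures in $\beta X$) is a non-empty invariant open subset of $\beta X$. Amenability and partial property A: a locally compact Hausdorff étale groupoid $G$ is amenable if for every $\varepsilon>0$ and compact $K\subseteq G$ there is $f\in C_c(G)$ with values in $[0,\infty)$ such that for all $\gamma\in K$, $|\sum_{\alpha\in G_{r(\gamma)}}f(\alpha)-1|<\varepsilon$ and $\sum_{\alpha\in G_{r(\gamma)}}|f(\alpha)-f(\alpha\gamma)|<\varepsilon$, where $G_x=s^{-1}(x)$. For an invariant open $U\subseteq\beta X$, $X$ has partial property A towards $\beta X\setminus U$ if the groupoid $G(X)_{\beta X\setminus U}=s^{-1}(\beta X\setminus U)$ is amenable. *)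

(* Defs.v *)
From HB Require Import structures.
From mathcomp Require Import all_boot all_order all_algebra.
From mathcomp Require Import complex.
From mathcomp Require Import all_classical all_reals all_analysis.
From mathcomp Require Import ring.

Set Implicit Arguments.
Unset Strict Implicit.
Unset Printing Implicit Defensive.

Import Order.TTheory GRing.Theory Num.Theory.
Import numFieldNormedType.Exports.

Local Open Scope classical_set_scope.
Local Open Scope ring_scope.
Local Open Scope complex_scope.

(* The inner product is linear in its first argument. *)
HB.mixin Record isHilbert (R : realType) H & CompleteNormedModule R[i] H := {
  inner : {dot H for (@Num.conj R[i])};
  inner_norm : forall v : H, inner v v = `|v| ^+ 2
}.

#[short(type="hilbertType")]
HB.structure Definition Hilbert (R : realType) :=
  { H of isHilbert R H & CompleteNormedModule R[i] H }.

Section real_norm.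
Context {R : realType} {V : normedModType R[i]}.
Implicit Types v w : V.

(* The norm of a normed R[i]-module takes its values in R[i]. *)
Definition rnorm v : R := complex.Re `|v|.

Lemma rnormE v : (rnorm v)%:C = `|v|.
Proof. by rewrite /rnorm RRe_real// ger0_real. Qed.

Lemma rnorm_ge0 v : 0 <= rnorm v.
Proof. by rewrite -lecR rnormE; exact: normr_ge0. Qed.

Lemma rnorm0 : rnorm 0 = 0.
Proof. by apply: complexI; rewrite rnormE normr0. Qed.

Lemma rnorm0_eq0 v : rnorm v = 0 -> v = 0.
Proof. by move=> v0; apply/eqP; rewrite -normr_eq0 -rnormE v0. Qed.

Lemma ler_rnormD v w : rnorm (v + w) <= rnorm v + rnorm w.
Proof. by rewrite -lecR rmorphD/= !rnormE ler_normD. Qed.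

Lemma rnormZ (c : R[i]) v : rnorm (c *: v) = complex.Re `|c| * rnorm v.
Proof.
apply: complexI; rewrite rnormE normrZ -(rnormE v).
by rewrite -[in LHS](RRe_real (ger0_real (normr_ge0 c))) -rmorphM.
Qed.

Definition lin_indep n (e : 'I_n -> V) :=
  forall c : 'I_n -> R[i], \sum_i c i *: e i = 0 -> forall i, c i = 0.

Definition infinite_dimensional := forall n, exists e : 'I_n -> V, lin_indep e.

Definition separable := exists2 A : set V, countable A & dense A.

(* [S] has rank [n]: its range has a basis with [n] elements. *)
Definition has_rank (S : V -> V) (n : nat) := exists2 e : 'I_n -> V,
  lin_indep e & range S = range (fun c : 'I_n -> R[i] => \sum_i c i *: e i).

Definition finite_rank (S : V -> V) := exists n, has_rank S n.

(* The junk value 0 is taken when [S] is not of finite rank. *)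
Definition rank (S : V -> V) : nat := xget 0%N (has_rank S).

Definition compact_operator (S : V -> V) :=
  precompact (S @` [set v | `|v| <= 1]).

Definition opnorm (S : V -> V) : R :=
  sup [set rnorm (S v) | v in [set v | `|v| <= 1]].

(* The closure of [A] in the space of bounded operators on [V]; for a linear
   map on a normed module, being bounded is the same as being continuous. *)
Definition norm_closure (A : set {linear V -> V}) : set {linear V -> V} :=
  [set T : {linear V -> V} | continuous T /\
    forall eps : R, 0 < eps ->
      exists2 S : {linear V -> V}, A S & opnorm (fun v => T v - S v) < eps].

End real_norm.
Arguments infinite_dimensional {R} V.
Arguments separable {R} V.

Section svd.
Context {R : realType} {H : hilbertType R}.

Definition rank_one (u v : H) : H -> H := fun x => inner x v *: u.

Definition orthonormal_seq (u : nat -> H) :=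
  forall i j, inner (u i) (u j) = (i == j)%:R.

(* In infinite dimension the singular vectors of a compact operator, those of
   the singular value 0 included, can be indexed by [nat]. *)
Record is_svd (S : H -> H) (lam : nat -> R) (u v : nat -> H) : Prop := IsSvd {
  svd_ge0 : forall i, 0 <= lam i;
  svd_nonincreasing : forall i j, (i <= j)%N -> lam j <= lam i;
  svd_cvg0 : lam i @[i --> \oo] --> 0;
  svd_orthonormal_l : orthonormal_seq u;
  svd_orthonormal_r : orthonormal_seq v;
  svd_sum : forall x : H,
    (\sum_(i < n) (lam i)%:C *: rank_one (u i) (v i) x) @[n --> \oo] --> S x
}.

Definition is_truncation (eps : R) (S S' : H -> H) :=
  exists lam u v, is_svd S lam u v /\
    S' = fun x => \sum_(i \in [set i | eps <= lam i])
                    (lam i)%:C *: rank_one (u i) (v i) x.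

(* A truncation does not depend on the singular value decomposition. *)
Definition truncation (eps : R) (S : H -> H) : H -> H :=
  xget (fun=> 0) (is_truncation eps S).

End svd.

Record fproj (R : realType) (H : hilbertType R) := FProj {
  fproj_val :> {linear H -> H};
  fproj_idem : forall v, fproj_val (fproj_val v) = fproj_val v;
  fproj_adj : forall v w, inner (fproj_val v) w = inner v (fproj_val w);
  fproj_finite : finite_rank fproj_val
}.

Lemma fproj_contraction (R : realType) (H : hilbertType R) (P : fproj H)
  (v : H) : `|P v| <= `|v|.
Proof.
rewrite -(@ler_pXn2r _ 2) ?nnegrE// -!inner_norm -subr_ge0.
suff -> : inner v v - inner (P v) (P v) = inner (v - P v) (v - P v).
  by rewrite inner_norm exprn_ge0.
have e : inner (P v) (P v) = inner v (P v) by rewrite fproj_adj fproj_idem.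
by rewrite linearBl/= !linearBr/= e fproj_adj subrr subr0.
Qed.

Section l2.
Context {R : realType} {X : choiceType} {H : normedModType R[i]}.
Implicit Types f g : X -> H.

Definition sqsum f : \bar R := (\esum_(x in setT) (rnorm (f x) ^+ 2)%:E)%E.

Definition sqsummable : {pred X -> H} := mem [set f | (sqsum f < +oo)%E].

Lemma sqsum_ge0 f : (0 <= sqsum f)%E.
Proof. by apply: esum_ge0 => x _; rewrite lee_fin sqr_ge0. Qed.

Lemma esum_mull (a : X -> R) (c : R) : 0 <= c ->
  (\esum_(x in setT) (c * a x ^+ 2)%:E <=
   c%:E * \esum_(x in setT) (a x ^+ 2)%:E)%E.
Proof.
move=> c0; apply: ge_ereal_sup => _ [A [finA _] <-].
apply: (@le_trans _ _ (c%:E * \sum_(x \in A) (a x ^+ 2)%:E)%E).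
  by rewrite ge0_mule_fsumr// => x; rewrite lee_fin sqr_ge0.
rewrite lee_pmul//; first by apply: fsume_ge0 => x _; rewrite lee_fin sqr_ge0.
by apply: esum_ge; exists A.
Qed.

Lemma sqsum_le f g (c : R) : 0 <= c ->
  (forall x, rnorm (f x) ^+ 2 <= c * rnorm (g x) ^+ 2) ->
  (sqsum f <= c%:E * sqsum g)%E.
Proof.
move=> c0 fg; apply: le_trans (esum_mull _ c0).
by apply: le_esum => x _; rewrite lee_fin.
Qed.

Lemma sqsum0 : sqsum 0 = 0%E.
Proof. by apply: esum1 => x _; rewrite rnorm0 expr0n. Qed.

Lemma sqsumZ (c : R[i]) f :
  (sqsum (c *: f) <= (complex.Re `|c| ^+ 2)%:E * sqsum f)%E.
Proof.
by apply: sqsum_le => [|x]; rewrite ?sqr_ge0// -exprMn -rnormZ.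
Qed.

Lemma sqsumD f g (t : R) : 0 < t ->
  (sqsum (f + g)%R <= (1 + t)%:E * sqsum f + (1 + t^-1)%:E * sqsum g)%E.
Proof.
move=> t0; have t'0 : 0 < t^-1 by rewrite invr_gt0.
apply: (@le_trans _ _ (\esum_(x in setT) (((1 + t) * rnorm (f x) ^+ 2)%:E +
    ((1 + t^-1) * rnorm (g x) ^+ 2)%:E))%E).
  apply: le_esum => x _; rewrite lee_fin /=.
  apply: (@le_trans _ _ ((rnorm (f x) + rnorm (g x)) ^+ 2)).
    by rewrite ler_pXn2r ?nnegrE ?addr_ge0 ?rnorm_ge0 ?ler_rnormD.
  set a := rnorm _; set b := rnorm _; rewrite -subr_ge0.
  have -> : (1 + t) * a ^+ 2 + (1 + t^-1) * b ^+ 2 - (a + b) ^+ 2 =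
    t^-1 * (t * a - b) ^+ 2 by field; rewrite gt_eqF.
  by rewrite mulr_ge0 ?sqr_ge0 ?ltW.
rewrite esumD; first last.
- by move=> x _; rewrite lee_fin mulr_ge0 ?sqr_ge0// addr_ge0// ltW.
- by move=> x _; rewrite lee_fin mulr_ge0 ?sqr_ge0// addr_ge0// ltW.
by apply: leeD; apply: esum_mull; rewrite addr_ge0// ltW.
Qed.

Lemma sqsummable_submod : submod_closed sqsummable.
Proof.
split; first by rewrite inE/= sqsum0 ltry.
move=> c f g; rewrite !inE/= => f_fin g_fin.
apply: (@le_lt_trans _ _ _ _ _ (sqsumD _ _ (@ltr01 R))).
by rewrite lte_add_pinfty// lte_mul_pinfty ?lee_fin// ?addr_ge0// ?invr_ge0//
  (le_lt_trans (sqsumZ _ _))// lte_mul_pinfty ?lee_fin ?sqr_ge0.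
Qed.

HB.instance Definition _ :=
  GRing.isSubmodClosed.Build R[i] (X -> H) sqsummable sqsummable_submod.

(* The Hilbert space l^2(X) (x) H, as the space of the square summable functions
   from [X] to [H]. *)
Record l2 := L2 { l2_fun :> X -> H; l2P : l2_fun \in sqsummable }.

HB.instance Definition _ := [isSub for l2_fun].
HB.instance Definition _ := [Choice of l2 by <:].
HB.instance Definition _ := [SubChoice_isSubLmodule of l2 by <:].

Definition l2norm (f : l2) : R[i] := (Num.sqrt (fine (sqsum f)))%:C.

Lemma sqsum_fin (f : l2) : sqsum f \is a fin_num.
Proof. by rewrite ge0_fin_numE ?sqsum_ge0//; have := l2P f; rewrite inE. Qed.

Lemma sqsum_ge (f : X -> H) x : ((rnorm (f x) ^+ 2)%:E <= sqsum f)%E.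
Proof.
apply: esum_ge; exists [set x]; first by split=> //; exact: finite_set1.
by rewrite fsbig_set1.
Qed.

Lemma l2norm0_eq0 (f : l2) : l2norm f = 0 -> f = 0.
Proof.
move=> /complexI/eqP; rewrite sqrtr_eq0 => f0.
apply/val_inj/funext => x /=; apply: rnorm0_eq0; apply/eqP.
rewrite -sqrf_eq0 eq_le sqr_ge0 andbT -lee_fin.
by apply: le_trans (sqsum_ge f x) _; rewrite -(fineK (sqsum_fin f)) lee_fin.
Qed.

Let N (f : l2) : R := Num.sqrt (fine (sqsum f)).

Let sqsumE (f : l2) : sqsum f = (N f ^+ 2)%:E.
Proof. by rewrite sqr_sqrtr ?fine_ge0 ?sqsum_ge0// fineK ?sqsum_fin. Qed.

Lemma ler_l2normD (f g : l2) : l2norm (f + g) <= l2norm f + l2norm g.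
Proof.
have [/l2norm0_eq0->|f0] := eqVneq (l2norm f) 0.
  by rewrite add0r lerDr lecR sqrtr_ge0.
have [/l2norm0_eq0->|g0] := eqVneq (l2norm g) 0.
  by rewrite addr0 lerDl lecR sqrtr_ge0.
have Nf : 0 < N f.
  by rewrite lt_neqAle sqrtr_ge0 andbT eq_sym; apply: contra f0 => /eqP Nf0;
    rewrite /l2norm -/(N f) Nf0.
have Ng : 0 < N g.
  by rewrite lt_neqAle sqrtr_ge0 andbT eq_sym; apply: contra g0 => /eqP Ng0;
    rewrite /l2norm -/(N g) Ng0.
rewrite /l2norm -rmorphD lecR -!/(N _).
rewrite -(@ler_pXn2r _ 2) ?nnegrE ?addr_ge0 ?sqrtr_ge0//.
have : (sqsum (f + g : l2)%R <= (1 + N g / N f)%:E * sqsum f +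
    (1 + (N g / N f)^-1)%:E * sqsum g)%E by exact/sqsumD/divr_gt0.
rewrite !sqsumE.
rewrite -!EFinM -EFinD lee_fin => /le_trans; apply.
rewrite le_eqVlt; apply/orP; left; apply/eqP.
by field; rewrite !gt_eqF.
Qed.

Lemma l2normZ (c : R[i]) (f : l2) : l2norm (c *: f) = `|c| * l2norm f.
Proof.
have le (d : R[i]) (h : l2) : N (d *: h) <= complex.Re `|d| * N h.
  have d0 : 0 <= complex.Re `|d|.
    by rewrite -lecR (RRe_real (ger0_real _)); exact: normr_ge0.
  rewrite -(@ler_pXn2r _ 2) ?nnegrE ?mulr_ge0 ?sqrtr_ge0//.
  have : (sqsum (d *: h : l2)%R <= (complex.Re `|d| ^+ 2)%:E * sqsum h)%E.
    exact: sqsumZ.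
  by rewrite !sqsumE -EFinM lee_fin exprMn.
have leC (d : R[i]) (h : l2) : l2norm (d *: h) <= `|d| * l2norm h.
  rewrite -[`|d|](RRe_real (ger0_real (normr_ge0 d))) /l2norm -rmorphM lecR.
  exact: le.
apply/eqP; rewrite eq_le leC/=.
have [->|c0] := eqVneq c 0; first by rewrite normr0 mul0r lecR sqrtr_ge0.
rewrite -ler_pdivlMl ?normr_gt0// -normfV.
by rewrite -{1}[f](scalerK c0).
Qed.

HB.instance Definition _ := Lmodule_isNormed.Build R[i] l2
  ler_l2normD l2normZ l2norm0_eq0.

Definition l2_delta_fun (y : X) (v : H) : X -> H :=
  fun x => if x == y then v else 0.

Lemma l2_delta_subproof (y : X) (v : H) : l2_delta_fun y v \in sqsummable.
Proof.
rewrite inE/= /sqsum (esumID [set y]); last first.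
  by move=> x _; rewrite lee_fin sqr_ge0.
rewrite !setTI.
rewrite esum_set1 ?lee_fin ?sqr_ge0// esum1 ?adde0 ?ltry// => x.
rewrite /= /l2_delta_fun => /eqP/negbTE ->.
by rewrite rnorm0 expr0n.
Qed.

Definition l2_delta (y : X) (v : H) : l2 := L2 (l2_delta_subproof y v).

Definition l2_diag_fun (D : X -> H -> H) (f : l2) : X -> H :=
  fun x => D x (f x).

Lemma l2_diag_subproof (D : X -> H -> H) :
  (forall x v, `|D x v| <= `|v|) ->
  forall f : l2, l2_diag_fun D f \in sqsummable.
Proof.
move=> D1 f; have := l2P f; rewrite !inE/= => f_fin.
apply: le_lt_trans f_fin; rewrite -[leRHS]mul1e; apply: sqsum_le => // x.
rewrite mul1r ler_pXn2r ?nnegrE ?rnorm_ge0//.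
by rewrite -lecR !rnormE D1.
Qed.

Definition l2_diag (D : X -> H -> H) (D1 : forall x v, `|D x v| <= `|v|) :
  l2 -> l2 := fun f : l2 => L2 (l2_diag_subproof D1 f).

(* The matrix coefficient T(x, y). *)
Definition entry (T : {linear l2 -> l2}) (x y : X) : H -> H :=
  fun v => T (l2_delta y v) x.

End l2.
Arguments l2 {R} X H.

(* The Stone-Cech compactification of the discrete set [T], realized as the
   space of ultrafilters on [T]. *)
Record stone_cech (T : Type) := StoneCech {
  ultra_sets : set_system T;
  stone_cechP : UltraFilter ultra_sets
}.

HB.instance Definition _ (T : Type) := gen_eqMixin (stone_cech T).
HB.instance Definition _ (T : Type) := gen_choiceMixin (stone_cech T).

Section beta_topology.
Context {T : Type}.

Definition beta_base (A : set T) : set (stone_cech T) :=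
  [set p : stone_cech T | ultra_sets p A].

Lemma beta_cover : \bigcup_(A in [set: set T]) beta_base A = setT.
Proof.
apply/seteqP; split=> // p _; exists setT => //.
by case: p => F [FF mF]; exact: (@filterT _ F).
Qed.

Lemma beta_join (A B : set T) (p : stone_cech T) : setT A -> setT B ->
  beta_base A p -> beta_base B p -> exists C, [/\ setT C, beta_base C p &
    beta_base C `<=` beta_base A `&` beta_base B].
Proof.
move=> _ _ pA pB; exists (A `&` B); split=> //.
  by case: p pA pB => F [FF mF]; exact: (@filterI _ F).
move=> [F [FF mF]] /= FAB.
by split; apply: filterS FAB => t [].
Qed.

HB.instance Definition _ :=
  isBaseTopological.Build (stone_cech T) beta_cover beta_join.

Definition beta_in (t : T) : stone_cech T :=
  StoneCech (principal_filter_ultra t).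

Definition beta_closure (A : set T) : set (stone_cech T) :=
  closure (beta_in @` A).

End beta_topology.

Lemma fmap_ultra (T U : Type) (f : T -> U) (p : stone_cech T) :
  UltraFilter (fmap f (ultra_sets p)).
Proof.
case: p => F FU /=; split; first exact: fmap_proper_filter.
move=> G GF sFG; rewrite predeqE => A; split; last exact: sFG.
move=> GA; have [//|FnA] := in_ultra_setVsetC (f @^-1` A) FU.
have GnA : G (~` A) by apply: sFG.
by have /filter_ex [? []] : G (A `&` ~` A) by exact: filterI.
Qed.

(* The continuous extension of [f]. *)
Definition beta_map (T U : Type) (f : T -> U) (p : stone_cech T) :
    stone_cech U :=
  StoneCech (fmap_ultra f p).

(* Amenability of the etale groupoid with space of arrows [G], unit space [G0],
   range [r], source [s] and product [mul]; the value of [mul a b] is only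
   relevant when [s a = r b]. As [f] has compact support, the sums over fibers,
   written as sums of nonnegative extended reals, have finitely many nonzero
   terms. *)
Definition amenable (R : realType) (G : topologicalType) (G0 : Type)
    (r s : G -> G0) (mul : G -> G -> G) :=
  forall (eps : R) (K : set G), 0 < eps -> compact K ->
  exists f : G -> R, [/\ continuous f, compact (closure [set a | f a != 0]),
    forall a, 0 <= f a &
    forall g, K g ->
      (`| \esum_(a in [set a | s a = r g]) (f a)%:E - 1 | < eps%:E)%E /\
      (\esum_(a in [set a | s a = r g]) `| f a - f (mul a g) |%:E < eps%:E)%E].

Section coarse.
Context {R : realType} {X : metricType R}.
Implicit Types (E : set (X * X)) (alpha : X -> X -> nat).

Definition bounded_geometry := forall r : R, 0 < r ->
  exists N : nat, forall x : X, ([set y | mdist x y <= r] #<= `I_N)%card.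

Definition coarse_entourage E :=
  exists r : R, forall x y, E (x, y) -> mdist x y <= r.

Definition E_ (r : R) : set (X * X) := [set xy | mdist xy.1 xy.2 <= r].

Definition coarse_groupoid : set (stone_cech (X * X)) :=
  \bigcup_(r in [set r : R | 0 <= r]) beta_closure (E_ r).

Definition gr (g : stone_cech (X * X)) : stone_cech X := beta_map fst g.
Definition gs (g : stone_cech (X * X)) : stone_cech X := beta_map snd g.

(* The reduction of the coarse groupoid to [F]; as a type, it carries the
   subspace topology. *)
Definition reduction (F : set (stone_cech X)) : set (stone_cech (X * X)) :=
  coarse_groupoid `&` gs @^-1` F.

Section reduction.
Variable F : set (stone_cech X).

Definition red_r (g : reduction F) : stone_cech X := gr (val g).
Definition red_s (g : reduction F) : stone_cech X := gs (val g).

(* The structure induced by the pair groupoid: the product of [a] and [b] is the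
   arrow with range [r a] and source [s b], which is unique since [(r, s)] is
   injective. *)
Definition red_mul (a b : reduction F) : reduction F :=
  xget a [set c | red_r c = red_r a /\ red_s c = red_s b].

End reduction.

Definition partial_property_A_towards (F : set (stone_cech X)) :=
  amenable R (@red_r F) (@red_s F) (@red_mul F).

Definition rank_supp alpha : set (X * X) := [set xy | alpha xy.1 xy.2 != 0%N].

Definition rank_function alpha := coarse_entourage (rank_supp alpha).

(* These two sums are finite when [X] has bounded geometry. *)
Definition ent_mull E alpha : X -> X -> nat :=
  fun x y => \sum_(z \in [set z | E (x, z)]) alpha z y.

Definition ent_mulr alpha E : X -> X -> nat :=
  fun x y => \sum_(z \in [set z | E (z, y)]) alpha x z.

Record rank_distribution (D : set (X -> X -> nat)) : Prop := RankDistribution {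
  rd_rank_function : forall alpha, D alpha -> rank_function alpha;
  rd_add : forall alpha alpha', D alpha -> D alpha' ->
    D (fun x y => (alpha x y + alpha' x y)%N);
  rd_transpose : forall alpha, D alpha -> D (fun x y => alpha y x);
  rd_mull : forall E alpha, coarse_entourage E -> D alpha ->
    D (ent_mull E alpha);
  rd_mulr : forall E alpha, coarse_entourage E -> D alpha ->
    D (ent_mulr alpha E);
  rd_finite : forall alpha, rank_function alpha ->
    finite_set (rank_supp alpha) -> D alpha;
  rd_le : forall alpha alpha', rank_function alpha -> D alpha' ->
    (forall x y, (alpha x y <= alpha' x y)%N) -> D alpha
}.

Definition U_of (D : set (X -> X -> nat)) : set (stone_cech X) :=
  \bigcup_(alpha in D) beta_closure (fst @` rank_supp alpha).

(* The maximum is over a finite set of nonzero values when [alpha] is a rank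
   function and [X] has bounded geometry. *)
Definition row_max alpha : X -> nat :=
  fun x => \big[maxn/0%N]_(y \in [set: X]) alpha x y.

Definition row_maxima (D : set (X -> X -> nat)) : set (X -> nat) :=
  row_max @` D.

End coarse.
Arguments bounded_geometry {R} X.

Section roe.
Context {R : realType} {X : metricType R} {H : hilbertType R}.
Implicit Types D : set (X -> X -> nat).

Local Notation operator := {linear l2 X H -> l2 X H}.

Definition finite_propagation (T : operator) :=
  coarse_entourage [set xy | entry T xy.1 xy.2 <> (fun=> 0)].

Definition locally_compact_op (T : operator) :=
  forall x y, compact_operator (entry T x y).

Definition algebraic_roe : set operator :=
  [set T : operator |
    [/\ continuous T, locally_compact_op T & finite_propagation T]].

Definition roe : set operator := norm_closure algebraic_roe.

Definition I_ideal D : set operator :=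
  norm_closure [set T : operator | [/\ algebraic_roe T,
    forall x y, finite_rank (entry T x y) &
    D (fun x y => rank (entry T x y))]].

Definition I_tilde D : set operator :=
  [set T : operator | roe T /\ forall eps : R, 0 < eps ->
    D (fun x y => rank (truncation eps (entry T x y)))].

Definition Gamma D : set (X -> fproj H) :=
  [set phi | row_maxima D (fun x => rank (phi x))].

Definition Gamma_le (phi1 phi2 : X -> fproj H) :=
  forall x, range (phi1 x) `<=` range (phi2 x).

Definition fproj_supp (phi : X -> fproj H) : set X :=
  [set x | phi x <> (fun=> 0) :> (H -> H)].

Definition Lambda (phi : X -> fproj H) : l2 X H -> l2 X H :=
  l2_diag (fun x => fproj_contraction (phi x)).

Lemma cut_contraction (Y : set X) (x : X) (v : H) :
  `|if x \in Y then v else 0| <= `|v|.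
Proof. by case: ifP; rewrite ?normr0. Qed.

Definition chi (Y : set X) : l2 X H -> l2 X H := l2_diag (cut_contraction Y).

Definition Lambda_approximation D :=
  forall (T : operator) (eps : R) (Y : set X),
  I_tilde D T -> 0 < eps -> beta_closure Y `<=` U_of D ->
  exists2 phi0, Gamma D phi0 &
    forall phi, Gamma D phi -> Gamma_le phi0 phi ->
      opnorm (fun xi => Lambda phi (chi Y (T xi)) -
                        chi (fproj_supp phi `&` Y) (T xi)) < eps.

End roe.
Arguments Lambda_approximation {R X} H D.
Arguments I_ideal {R X} H D.
Arguments I_tilde {R X} H D.

(* Main.v *)
(* If [I = I~] then an element of [I~] is close to an operator [S] of finite
   propagation with finite rank entries; the projections [phi0 x] onto the span
   of the ranges of the entries in the row [x] of [S] satisfy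
   [Lambda phi S = S] on the support of any [phi >= phi0].

   [I <= I~] because the [k]-th singular value of a matrix entry is its distance
   to the operators of rank less than [k].

   For [I~ <= I], let [T0] of propagation at most [r] be close to [T].
   Amenability of the reduction of the groupoid to the complement of [U] gives,
   as for property A, a kernel [a x y = <h x, h y>] of finite propagation, with
   [h x] of norm at most one, and a set [Z] such that the closure of [~` Z] lies
   in [U] and such that [a x y] is close to one when [x] and [y] are in [Z] at
   distance at most [r]. Let [Y] be the [r]-neighbourhood of [~` Z]; its closure
   still lies in [U]. On the rows in [Y], condition (2) makes
   [Lambda phi (chi Y T0)] close to [T]. On the other rows, Schur multiplication
   by [a] is contractive, moves [T0] little, and gives a band matrix, so that
     the
   entries can then be truncated uniformly. This argument needs no adjoint.

   Two arrows of the coarse groupoid with the same source and the same range are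
   equal: colour [X] so that distinct points at bounded distance have distinct
   colours; then the colour of the range cuts an entourage into graphs of
   partial injections. *)
Require Import Defs.
From HB Require Import structures.
From mathcomp Require Import all_boot all_order all_algebra.
From mathcomp Require Import complex.
From mathcomp Require Import all_classical all_reals all_analysis.
From mathcomp Require Import ring lra.
Set Implicit Arguments.
Unset Strict Implicit.
Unset Printing Implicit Defensive.
Import Order.TTheory GRing.Theory Num.Theory.
Import numFieldNormedType.Exports.
Local Open Scope classical_set_scope.
Local Open Scope ring_scope.

(** * Finite-dimensional spans and ranks *)

(** Three obstacles shape the argument. The matrix of [T0 - T] multiplied by the kernel is banded,
    but the width of the band depends on the accuracy already demanded of [T0], so a bound on its
    entries times their number in a row is useless: only the contractivity of Schur multiplication
    keeps it small. The two other corrections can be estimated entrywise, because their thresholds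
    are fixed after the number of entries in a row is known. The truncated entries are those of [T]
    and not of [T0], since only their ranks are known to lie in the rank distribution. Amenability
    yields a function [f] on ultrafilters, while the kernel must live on pairs of points. A discrete
    function replaces [f] up to [eta]; colours leave at most [N] arrows of the support of [f] in a
    fibre, so the errors add up to a multiple of [N * eta]. Condition (2) only controls rows in the
    support of [phi], hence [phi] is enlarged until its support contains [Y]. *)

Section linear_fun.
Context {F : pzRingType} {U V : lmodType F}.

(** Matrix entries are bare functions with a proof of linearity; packing such a function into a
    bundled map gives access to the library. *)
Lemma linear_funE (f : U -> V) : linear f -> exists L : {linear U -> V}, L =1 f.
Proof.
move=> flin; pose m := GRing.isLinear.Build F U V _ f flin.
by exists (HB.pack_for {linear U -> V} f m).
Qed.

Lemma linear_fun0 (f : U -> V) : linear f -> f 0 = 0.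
Proof. by move=> /linear_funE[L Lf]; rewrite -Lf linear0. Qed.

Lemma linear_sum_fun (f : U -> V) I (s : seq I) (P : pred I) (c : I -> U) :
  linear f -> f (\sum_(i <- s | P i) c i) = \sum_(i <- s | P i) f (c i).
Proof.
move=> /linear_funE[L Lf]; rewrite -Lf linear_sum.
by apply: eq_bigr => i _; rewrite Lf.
Qed.

Lemma linear_funZ (f : U -> V) c u : linear f -> f (c *: u) = c *: f u.
Proof. by move=> /linear_funE[L Lf]; rewrite -!Lf linearZ. Qed.

Lemma linear_funD (f : U -> V) u v : linear f -> f (u + v) = f u + f v.
Proof. by move=> /linear_funE[L Lf]; rewrite -!Lf linearD. Qed.

Lemma linear_funB (f : U -> V) u v : linear f -> f (u - v) = f u - f v.
Proof. by move=> /linear_funE[L Lf]; rewrite -!Lf linearB. Qed.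

End linear_fun.

Section finite_dimension.
Context {R : realType} {V : normedModType R[i]}.
Implicit Types (S : V -> V).

Definition lspan n (e : 'I_n -> V) : set V :=
  range (fun c : 'I_n -> R[i] => \sum_i c i *: e i).

Lemma lspan_in n (e : 'I_n -> V) i : lspan e (e i).
Proof.
exists (fun j => (j == i)%:R) => //.
rewrite (bigD1 i)//= eqxx scale1r big1 ?addr0// => j /negbTE ->.
by rewrite scale0r.
Qed.

(** The coordinates of [f] in [e] form an m by n matrix. A row vector killing it would be a
    vanishing combination of [f], so its rows are independent. *)
Lemma lin_indep_le m n (f : 'I_m -> V) (e : 'I_n -> V) :
  lin_indep f -> (forall i, lspan e (f i)) -> (m <= n)%N.
Proof.
move=> f_indep /(_ _)/cid2-/all_sig2[A _ fE].
pose M := \matrix_(i < m, j < n) A i j.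
suff /eqP <- : row_free M by exact: rank_leq_col.
apply: inj_row_free => v vM; apply/rowP => i; rewrite mxE.
apply: (f_indep (fun i => v 0 i)).
under eq_bigr => k _ do rewrite -fE scaler_sumr.
rewrite exchange_big big1//= => j _.
under eq_bigr => k _ do rewrite scalerA.
rewrite -scaler_suml (_ : \sum_k _ = 0) ?scale0r//.
have /rowP/(_ j) := vM; rewrite !mxE => {2}<-.
by apply: eq_bigr => k _; rewrite mxE.
Qed.

Lemma lin_indep_cons m (f : 'I_m -> V) (w : V) :
  lin_indep f -> ~ lspan f w ->
  lin_indep (fun i : 'I_m.+1 => oapp f w (unlift ord0 i)).
Proof.
move=> f_indep wf c; rewrite big_ord_recl unlift_none /=.
under eq_bigr => i _ do rewrite liftK /=.
move=> c0.
have c00 : c ord0 = 0.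
  apply: contra_notP wf => /eqP c00.
  exists (fun i => - (c ord0)^-1 * c (lift ord0 i)) => //.
  under eq_bigr => i _ do rewrite -scalerA.
  rewrite -scaler_sumr scaleNr -scalerN.
  move/eqP: c0; rewrite addrC addr_eq0 => /eqP ->.
  by rewrite opprK scalerA mulVf// scale1r.
move=> i; have [j ->|->//] := unliftP ord0 i.
apply: (f_indep (fun j => c (lift ord0 j))).
by rewrite -[RHS]c0 c00 scale0r add0r.
Qed.

(** An independent family in [W] of greatest length exists, lengths being bounded by [n]. It spans
    [W], since a vector outside its span could be added to it. *)
Lemma subspace_basis n (e : 'I_n -> V) (W : set V) :
  W 0 -> (forall (a : R[i]) u v, W u -> W v -> W (a *: u + v)) ->
  W `<=` lspan e ->
  exists m (f : 'I_m -> V), [/\ (m <= n)%N, lin_indep f & W = lspan f].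
Proof.
move=> W0 Wlin We.
pose P m := `[< exists2 f : 'I_m -> V, lin_indep f & forall i, W (f i) >].
have exP : exists m, P m.
  by exists 0%N; apply/asboolP; exists (fun=> 0) => [c _|] [].
have bndP m : P m -> (m <= n)%N.
  by move=> /asboolP[f fi fW]; apply: (lin_indep_le fi) => i; exact/We/fW.
case: (ex_maxnP exP bndP) => m /[dup] Pm /asboolP[f fi fW] maxm.
exists m, f; split=> //; first exact: bndP.
apply/seteqP; split=> [w Ww|_ [c _ <-]]; last first.
  elim/big_ind: _ => [//|u v Wu Wv|i _]; first by rewrite -[u]scale1r;
    exact: Wlin.
  by rewrite -[_ *: _]addr0; exact: Wlin.
apply: contrapT => wf.
suff /maxm : P m.+1 by rewrite ltnn.
apply/asboolP; exists (fun i => oapp f w (unlift ord0 i)).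
  exact: lin_indep_cons.
by move=> i; case: (unlift _ _) => /=.
Qed.

Lemma has_rank_unique S m n : has_rank S m -> has_rank S n -> m = n.
Proof.
have le p q : has_rank S p -> has_rank S q -> (p <= q)%N.
  move=> [e ei eS] [f _ fS]; apply: (lin_indep_le ei (e := f)) => i.
  by rewrite /lspan -fS eS; exact: lspan_in.
by move=> hm hn; apply/eqP; rewrite eqn_leq !le.
Qed.

Lemma rankP S : finite_rank S -> has_rank S (rank S).
Proof. by move=> [n hn]; rewrite /rank; case: xgetP => [m _ //|/(_ n)]. Qed.

Lemma has_rankE S n : has_rank S n -> rank S = n.
Proof.
by move=> hn; apply: (@has_rank_unique S) => //; apply: rankP; exists n.
Qed.

Lemma rank_le n (e : 'I_n -> V) S : linear S -> range S `<=` lspan e ->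
  finite_rank S /\ (rank S <= n)%N.
Proof.
move=> Slin Se; have [||m [f [mn fi Sf]]] := subspace_basis (W := range S) _ _
  Se.
- by exists 0 => //; exact: linear_fun0.
- by move=> a _ _ [u _ <-] [v _ <-]; exists (a *: u + v) => //; exact: Slin.
have hm : has_rank S m by exists f.
by split; [exists m|rewrite (has_rankE hm)].
Qed.

Lemma rank_leS S S' : linear S -> finite_rank S' -> range S `<=` range S' ->
  finite_rank S /\ (rank S <= rank S')%N.
Proof.
by move=> Slin /rankP[e _ eS'] SS'; apply: (rank_le (e := e)) => //;
  rewrite /lspan -eS'.
Qed.

Lemma rank_ge m (f : 'I_m -> V) S : lin_indep f -> finite_rank S ->
  (forall i, range S (f i)) -> (m <= rank S)%N.
Proof.
move=> fi /rankP[e _ eS] fS; apply: (lin_indep_le fi (e := e)) => i.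
by have := fS i; rewrite eS.
Qed.

Lemma has_rank0 : has_rank (fun=> 0 : V) 0.
Proof.
exists (fun=> 0) => [c _ []//|]; apply/seteqP; split=> [_ [v _ <-]|_ [c _ <-]].
  by exists (fun=> 0) => //; rewrite big_ord0.
by exists 0 => //; rewrite big_ord0.
Qed.

Lemma rank0 : rank (fun=> 0 : V) = 0%N.
Proof. exact/has_rankE/has_rank0. Qed.

End finite_dimension.

(** * Hilbert space geometry and projections *)

Section normed_module.
Local Open Scope complex_scope.
Context {R : realType} {V : normedModType R[i]}.
Implicit Types v w : V.

Lemma rnorm_distC v w : rnorm (v - w) = rnorm (w - v).
Proof. by rewrite /rnorm distrC. Qed.

Lemma rnormN v : rnorm (- v) = rnorm v.
Proof. by rewrite /rnorm normrN. Qed.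

End normed_module.

Section hilbert.
Local Open Scope complex_scope.
Context {R : realType} {H : hilbertType R}.
Implicit Types (c : R[i]) (u v w x : H).

Definition cabs c : R := complex.Re `|c|.

Lemma cabsE c : (cabs c)%:C = `|c|.
Proof. by rewrite /cabs RRe_real// ger0_real. Qed.

Lemma cabs_ge0 c : 0 <= cabs c.
Proof. by rewrite -lecR cabsE; exact: normr_ge0. Qed.

Lemma cabsX c : (cabs c ^+ 2)%:C = c * Num.conj c.
Proof. by rewrite -normCK -cabsE rmorphXn. Qed.

Lemma cabsM c c' : cabs (c * c') = cabs c * cabs c'.
Proof. by apply: complexI; rewrite rmorphM/= !cabsE normrM. Qed.

Lemma cabs0 : cabs 0 = 0.
Proof. by apply: complexI; rewrite cabsE normr0. Qed.

Lemma cabs0_eq0 c : cabs c = 0 -> c = 0.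
Proof. by move=> c0; apply/normr0_eq0; rewrite -cabsE c0. Qed.

Lemma cabsR (a : R) : cabs a%:C = `|a|.
Proof. by rewrite /cabs normc_def /= expr0n addr0 sqrtr_sqr. Qed.

Lemma conj_div c c' : Num.conj (c / c') = Num.conj c / Num.conj c'.
Proof. exact: fmorph_div. Qed.

Lemma inner_conj u v : inner u v = Num.conj (inner v u).
Proof. by rewrite hermC expr0 mul1r. Qed.

Lemma innerZl c u v : inner (c *: u) v = c * inner u v.
Proof. by rewrite linearZl_LR. Qed.

Lemma innerZr c u v : inner u (c *: v) = Num.conj c * inner u v.
Proof. by rewrite linearZr_LR. Qed.

Lemma innerDl u v w : inner (u + v) w = inner u w + inner v w.
Proof. by rewrite linearDl. Qed.

Lemma innerDr u v w : inner w (u + v) = inner w u + inner w v.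
Proof. by rewrite linearDr. Qed.

Lemma inner_suml I (r : seq I) (P : pred I) (F : I -> H) v :
  inner (\sum_(i <- r | P i) F i) v = \sum_(i <- r | P i) inner (F i) v.
Proof. exact: linear_sumlz. Qed.

Lemma inner_sumr I (r : seq I) (P : pred I) (F : I -> H) v :
  inner v (\sum_(i <- r | P i) F i) = \sum_(i <- r | P i) inner v (F i).
Proof. exact: linear_sumr. Qed.

Lemma inner0C u v : inner u v = 0 -> inner v u = 0.
Proof. by move=> uv0; rewrite inner_conj uv0 conjC0. Qed.

Lemma rnormX v : (rnorm v ^+ 2)%:C = inner v v.
Proof. by rewrite inner_norm -rnormE rmorphXn. Qed.

Lemma Re_conj c : complex.Re (Num.conj c) = complex.Re c.
Proof. by case: c. Qed.

Lemma rnormDX u v : rnorm (u + v) ^+ 2 =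
  rnorm u ^+ 2 + rnorm v ^+ 2 + 2 * complex.Re (inner u v).
Proof.
have sqE w : rnorm w ^+ 2 = complex.Re (inner w w) by rewrite -rnormX.
rewrite !sqE innerDl !innerDr (inner_conj v u) !raddfD/= Re_conj; ring.
Qed.

Lemma parallelogram u v :
  rnorm (u + v) ^+ 2 + rnorm (u - v) ^+ 2 = 2 * (rnorm u ^+ 2 + rnorm v ^+ 2).
Proof.
rewrite !rnormDX rnormN linearNr raddfN/=; ring.
Qed.

Lemma pythagoras u v : inner u v = 0 ->
  rnorm (u + v) ^+ 2 = rnorm u ^+ 2 + rnorm v ^+ 2.
Proof. by move=> uv0; rewrite rnormDX uv0 mulr0 addr0. Qed.

Lemma rnormZX c v : rnorm (c *: v) ^+ 2 = cabs c ^+ 2 * rnorm v ^+ 2.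
Proof. by rewrite rnormZ exprMn. Qed.

Lemma rnormZr (a : R) v : rnorm (a%:C *: v) = `|a| * rnorm v.
Proof. by rewrite rnormZ -/(cabs _) cabsR. Qed.

Lemma rnorm1_inner u : rnorm u = 1 -> inner u u = 1.
Proof. by move=> u1; rewrite -rnormX u1 expr1n. Qed.

Lemma normalize v : v != 0 -> exists c, rnorm (c *: v) = 1 /\ c != 0.
Proof.
move=> v0; have nv : rnorm v != 0 by apply: contra v0 => /eqP/rnorm0_eq0 ->.
exists ((rnorm v)^-1)%:C; rewrite rnormZr ger0_norm ?invr_ge0 ?rnorm_ge0//.
rewrite mulVf//; split=> //; apply/eqP => /(congr1 (@complex.Re R))/= /eqP.
by rewrite invr_eq0 (negbTE nv).
Qed.

Section orthonormal_family.
Variables (n : nat) (e : nat -> H).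
(** Orthonormality is asked below [n] only, so that these facts apply to prefixes of sequences still
    under construction. *)
Hypothesis e_on : forall i j, (i < n)%N -> (j < n)%N ->
  inner (e i) (e j) = (i == j)%:R.

Lemma inner_sum_orthonormal (c : nat -> R[i]) k : (k < n)%N ->
  inner (\sum_(i < n) c i *: e i) (e k) = c k.
Proof.
move=> kn; rewrite inner_suml (bigD1 (Ordinal kn))//= innerZl e_on// eqxx mulr1.
rewrite big1 ?addr0// => i /negP ik; rewrite innerZl e_on//.
case: eqP => [ik'|]; last by rewrite mulr0.
by case: ik; apply/eqP/val_inj.
Qed.

Lemma bessel_eq x : rnorm x ^+ 2 =
  rnorm (x - \sum_(i < n) inner x (e i) *: e i) ^+ 2 +
  rnorm (\sum_(i < n) inner x (e i) *: e i) ^+ 2.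
Proof.
rewrite -pythagoras ?subrK//; set s := \sum_(i < n) _.
rewrite {2}/s inner_sumr big1// => i _; rewrite innerZr linearBl/=.
by rewrite (inner_sum_orthonormal (fun i => inner x (e i)))// subrr mulr0.
Qed.

End orthonormal_family.

Lemma rnorm_sum_orthonormal n (e : nat -> H) (c : nat -> R[i]) :
  (forall i j, (i < n)%N -> (j < n)%N -> inner (e i) (e j) = (i == j)%:R) ->
  rnorm (\sum_(i < n) c i *: e i) ^+ 2 = \sum_(i < n) cabs (c i) ^+ 2.
Proof.
elim: n => [|n IH] e_on; first by rewrite !big_ord0 rnorm0 expr0n.
rewrite !big_ord_recr/= pythagoras; last first.
  rewrite inner_suml big1//= => i _; rewrite innerZl innerZr.
  have /e_on -> // : (i < n.+1)%N by rewrite ltnS ltnW.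
  by rewrite (ltn_eqF (ltn_ord i)) !mulr0.
rewrite IH; last by move=> i j im jn; apply: e_on; apply: ltnW.
rewrite rnormZX; congr (_ + _); suff -> : rnorm (e n) ^+ 2 = 1 by rewrite mulr1.
by apply: complexI; rewrite rnormX e_on// eqxx.
Qed.

Lemma bessel n (e : nat -> H) x :
  (forall i j, (i < n)%N -> (j < n)%N -> inner (e i) (e j) = (i == j)%:R) ->
  \sum_(i < n) cabs (inner x (e i)) ^+ 2 <= rnorm x ^+ 2.
Proof.
move=> e_on; rewrite (bessel_eq e_on x).
by rewrite (rnorm_sum_orthonormal (fun i => inner x (e i)))// lerDr sqr_ge0.
Qed.

(** Bessel's inequality for the single vector obtained by normalizing [v]. *)
Lemma cauchy_schwarz u v : cabs (inner u v) <= rnorm u * rnorm v.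
Proof.
have [->|v0] := eqVneq v 0.
  by rewrite linear0r cabs0 mulr_ge0 ?rnorm_ge0.
have [c [cv1 c0]] := normalize v0.
have := @bessel 1 (fun=> c *: v) u.
rewrite big_ord1 => /(_ _)/wrap[|].
  by move=> [|//] [|//] _ _; rewrite rnorm1_inner.
rewrite innerZr.
have ncj : cabs (Num.conj c) = cabs c.
  by apply: complexI; rewrite !cabsE norm_conjC.
rewrite ler_pXn2r ?nnegrE ?cabs_ge0 ?rnorm_ge0// cabsM ncj => le.
have cp : 0 < cabs c.
  by rewrite lt_neqAle cabs_ge0 andbT eq_sym; apply: contra c0 =>
    /eqP/cabs0_eq0 ->.
rewrite -(ler_pM2l cp) (le_trans le)// mulrCA -[cabs c * rnorm v]rnormZ cv1.
by rewrite mulr1.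
Qed.

End hilbert.

Section finite_projections.
Local Open Scope complex_scope.
Context {R : realType} {H : hilbertType R}.
Implicit Types (P : fproj H) (v : H).

Lemma range_fproj P v : range P v <-> P v = v.
Proof.
by split=> [[w _ <-]|Pv]; [exact: fproj_idem|exists v].
Qed.

Lemma fproj0_subproof : exists P : fproj H, forall v, P v = 0.
Proof.
pose Z : {linear H -> H} := \0.
have Z1 v w : inner (Z v) w = inner v (Z w) by rewrite /= linear0l linear0r.
have Z2 : finite_rank Z by exists 0%N; exact: has_rank0.
have Z3 v : Z (Z v) = Z v by [].
by exists (FProj Z3 Z1 Z2).
Qed.

(** One Gram-Schmidt step: with [w = v - P v], the new projection is [P] plus the projection onto
    the line of [w], or [P] itself when [w] vanishes. *)
Lemma fproj_add1 P v : exists Q : fproj H,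
  [/\ Q v = v, range P `<=` range Q & (rank Q <= (rank P).+1)%N].
Proof.
pose w := v - P v.
have Pw : P w = 0 by rewrite linearB/= fproj_idem subrr.
have vE : v = w + P v by rewrite subrK.
have [w0|w0] := eqVneq w 0.
  by exists P; split=> //; rewrite {2}vE w0 add0r.
clearbody w; have ww : inner w w != 0.
  by rewrite inner_norm expf_neq0// normr_eq0.
pose q x := P x + (inner x w / inner w w) *: w.
have qlin : linear q.
  move=> a x y; rewrite /q linearP/= linearPl/= mulrDl scalerDl -mulrA -scalerA.
  by rewrite scalerDr addrACA.
have [Q QE] := linear_funE qlin.
have Pxw x : inner (P x) w = 0 by rewrite fproj_adj Pw linear0r.
have Q_idem x : Q (Q x) = Q x.
  rewrite !QE /q linearD/= fproj_idem linearZ/= Pw scaler0 addr0.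
  by rewrite innerDl Pxw add0r innerZl divfK.
have ww_real : Num.conj (inner w w) = inner w w by rewrite -inner_conj.
have Q_adj x y : inner (Q x) y = inner x (Q y).
  rewrite !QE /q innerDl innerDr fproj_adj innerZl innerZr; congr (_ + _).
  rewrite conj_div ww_real -inner_conj.
  by rewrite mulrAC [RHS]mulrC mulrA.
have [e _ eP] := rankP (fproj_finite P).
have Q_rank : finite_rank Q /\ (rank Q <= (rank P).+1)%N.
  apply: (rank_le (e := fun i => oapp e w (unlift ord0 i))).
    by move=> a x y; rewrite linearP.
  move=> _ [x _ <-]; rewrite QE /q.
  have : range P (P x) by exists x.
  rewrite eP => -[c _ <-]; rewrite addrC.
  exists (fun i => oapp c (inner x w / inner w w) (unlift ord0 i)) => //.
  rewrite big_ord_recl !unlift_none/=; congr (_ + _).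
  by apply: eq_bigr => i _; rewrite !liftK.
exists (FProj Q_idem Q_adj Q_rank.1); split=> /=; last exact: Q_rank.2.
  have vw : inner v w = inner w w by rewrite {1}vE innerDl Pxw addr0.
  by rewrite QE /q vw divff// scale1r addrC -vE.
move=> _ [x _ <-]; exists (P x) => //.
by rewrite QE /q fproj_idem Pxw mul0r scale0r addr0.
Qed.

Lemma fproj_add P n (e : 'I_n -> H) : exists Q : fproj H,
  [/\ forall i, Q (e i) = e i, range P `<=` range Q & (rank Q <= rank P + n)%N].
Proof.
elim: n e => [e|n IH e]; first by exists P; split=> // [[]//|]; rewrite addn0.
have [Q [Qe PQ rQ]] := IH (fun i => e (lift ord0 i)).
have [Q' [Q'e QQ' rQ']] := fproj_add1 Q (e ord0).
exists Q'; split; first 2 last.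
- by rewrite (leq_trans rQ')// addnS ltnS.
- move=> i; have [j ->|->//] := unliftP ord0 i.
  by apply/range_fproj/QQ'/range_fproj/Qe.
- exact: subset_trans QQ'.
Qed.

End finite_projections.

(** * Compactness and bounded operators *)

(** Compactness as an induction principle. If [Q] failed on [K], the sets whose complement in [K]
    satisfies [Q] would form a proper filter; an ultrafilter above it converges in [K], near a point
    where [Q] holds locally. *)
Lemma compact_ind (T : topologicalType) (K : set T) (Q : set T -> Prop) :
  compact K -> Q set0 -> (forall A B, Q A -> Q B -> Q (A `|` B)) ->
  (forall A B, A `<=` B -> Q B -> Q A) ->
  (forall x, K x -> exists2 U, nbhs x U & Q U) -> Q K.
Proof.
move=> Kco Q0 QU QS locQ; apply: contrapT => nQK.
pose F := [set A | Q (K `\` A)].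
have FF : ProperFilter F.
  apply: Build_ProperFilter_ex => [A QA|].
    apply: contrapT => /forallNP A0; apply: nQK; apply: QS QA => x Kx.
    by split=> // /A0.
  split; rewrite /F /=.
  - by apply: QS Q0 => x [_ []].
  - move=> A B QA QB; apply: QS (QU _ _ QA QB) => x [Kx] /not_andP[].
      by left; split.
    by right; split.
  - by move=> A B AB; apply: QS => x [Kx nBx]; split=> // /AB.
have [G [GU FG]] := ultraFilterLemma FF.
have := Kco; rewrite compact_ultra => /(_ G GU)[|x [Kx Gx]].
  by apply: FG; rewrite /F /= setDv.
have [U Ux QU'] := locQ x Kx.
have GnU : G (~` U) by apply: FG; apply: QS QU' => y [_ /contrapT].
by have /filter_ex[y []] : G (U `&` ~` U) by apply: filterI => //; exact: Gx.
Qed.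

Section normed.
Local Open Scope complex_scope.
Context {R : realType}.

(** The order of [R[i]] only compares numbers with equal imaginary parts, so the radii of the
    library's metric statements are real. *)
Lemma RposE (e : R[i]) : 0 < e -> exists2 e' : R, 0 < e' & e = e'%:C.
Proof.
case: e => a b; rewrite ltcE /= => /andP[/eqP -> a0]; by exists a.
Qed.

Section one_space.
Context {V : normedModType R[i]}.
Implicit Types v w : V.

Lemma rnorm_lt v (e : R) : (rnorm v < e) = (`|v| < e%:C).
Proof. by rewrite -ltcR rnormE. Qed.

Lemma rnorm_le1 v : (rnorm v <= 1) = (`|v| <= 1).
Proof. by rewrite -lecR rnormE. Qed.

Lemma ler_rnorm_sum I (r : seq I) (P : pred I) (F : I -> V) :
  rnorm (\sum_(i <- r | P i) F i) <= \sum_(i <- r | P i) rnorm (F i).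
Proof.
elim/big_ind2: _ => [|v a w b va wb|//]; first by rewrite rnorm0.
by rewrite (le_trans (ler_rnormD _ _))// lerD.
Qed.

Lemma cvg_rnormP (T : Type) (F : set_system T) (f : T -> V) (l : V) :
  Filter F -> f x @[x --> F] --> l <->
  forall e : R, 0 < e -> \forall x \near F, rnorm (l - f x) < e.
Proof.
move=> FF; split=> [/cvgrPdist_lt fl e e0|fl].
  have := fl e%:C; rewrite ltcR => /(_ e0); apply: filterS => x.
  by rewrite rnorm_lt.
apply/cvgrPdist_lt => _ /RposE[e e0 ->]; move: (fl e e0); apply: filterS => x.
by rewrite rnorm_lt.
Qed.

Lemma nbhs_rnormP v (A : set V) :
  nbhs v A <-> exists2 e : R, 0 < e & forall w, rnorm (v - w) < e -> A w.
Proof.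
split=> [/nbhs_normP[_ /= /RposE[e e0 ->] eA]|[e e0 eA]].
  by exists e => // w; rewrite rnorm_lt => /eA.
apply/nbhs_normP; exists e%:C => /=; first by rewrite ltcR.
by move=> w /=; rewrite -rnorm_lt => /eA.
Qed.

Lemma closure_rnormP (A : set V) v : closure A v ->
  forall e : R, 0 < e -> exists2 w, A w & rnorm (v - w) < e.
Proof.
move=> Av e e0; have [|w [Aw vw]] := Av [set w | rnorm (v - w) < e].
  by apply/nbhs_rnormP; exists e.
by exists w.
Qed.

Definition totally_bounded (A : set V) := forall e : R, 0 < e ->
  exists s : seq V, forall v, A v -> exists2 c, c \in s & rnorm (v - c) < e.

Lemma totally_bounded_subset (A B : set V) :
  A `<=` B -> totally_bounded B -> totally_bounded A.
Proof. by move=> AB Btb e /Btb[s sB]; exists s => v /AB/sB. Qed.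

Lemma compact_totally_bounded (A : set V) : compact A -> totally_bounded A.
Proof.
move=> Aco e e0.
pose Q (B : set V) := exists s : seq V, forall v, B v ->
  exists2 c, c \in s & rnorm (v - c) < e.
apply: (compact_ind (Q := Q) Aco).
- by exists [::].
- move=> B C [s sB] [t tC]; exists (s ++ t) => v [/sB|/tC] [c cs vc];
    by exists c => //; rewrite mem_cat cs ?orbT.
- by move=> B C BC [s sC]; exists s => v /BC/sC.
- move=> x Ax; exists [set v | rnorm (x - v) < e].
    by apply/nbhs_rnormP; exists e.
  by exists [:: x] => v /= xv; exists x; rewrite ?mem_head// rnorm_distC.
Qed.

End one_space.

(** Pigeonhole for ultrafilters, applied to finite nets and to colours. *)
Lemma ultra_seq_ex (T : Type) (I : eqType) (F : set_system T) (s : seq I)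
    (P : I -> set T) : UltraFilter F ->
  F [set x | exists2 i, i \in s & P i x] -> exists2 i, i \in s & F (P i).
Proof.
move=> FU; elim: s => [|a s IH] Fs.
  by have /filter_ex[x [j]] := Fs; rewrite in_nil.
have [Fa|Fna] := in_ultra_setVsetC (P a) FU.
  by exists a => //; rewrite mem_head.
have [|i is_ Fi] := IH; last by exists i => //; rewrite in_cons is_ orbT.
apply: filterS (filterI Fs Fna) => x [[j]]; rewrite in_cons => /orP[/eqP->//|].
by move=> is_ Pix _; exists j.
Qed.

Lemma totally_bounded_cauchy (V : completeNormedModType R[i]) (A : set V)
  (F : set_system V) : totally_bounded A -> UltraFilter F -> F A -> cvg F.
Proof.
move=> Atb FU FA; apply/cauchy_cvgP/cauchy_exP => _ /RposE[e e0 ->].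
have [s sA] := Atb e e0.
have [c _ Fc] : exists2 c, c \in s & F [set v | rnorm (v - c) < e].
  by apply: ultra_seq_ex; apply: filterS FA => v /sA.
exists c; apply: filterS Fc => v /=; rewrite rnorm_distC rnorm_lt.
by rewrite -ball_normE.
Qed.

Lemma totally_bounded_precompact (V : completeNormedModType R[i]) (A : set V) :
  totally_bounded A -> precompact A.
Proof.
move=> Atb; rewrite precompactE compact_ultra => F FU FA.
have cAtb : totally_bounded (closure A).
  move=> e e0; have e20 : 0 < e / 2 by rewrite divr_gt0.
  have [s sA] := Atb _ e20; exists s => v /closure_rnormP/(_ _ e20)[w Aw vw].
  have [c cs wc] := sA w Aw; exists c => //.
  rewrite (_ : v - c = (v - w) + (w - c)); last by rewrite addrA subrK.
  by rewrite (le_lt_trans (ler_rnormD _ _))// (splitr e) ltrD.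
have /cvg_ex[l Fl] := totally_bounded_cauchy cAtb FU FA.
exists l; split=> //; apply: closed_closure => B /Fl FB.
have FB' : F B := FB.
have /filter_ex[x []] : F (closure A `&` B) by exact: filterI.
by exists x.
Qed.

Lemma compact_operatorP (V : completeNormedModType R[i]) (S : V -> V) :
  compact_operator S <-> totally_bounded (S @` [set v | rnorm v <= 1]).
Proof.
rewrite /compact_operator.
rewrite (_ : [set v | rnorm v <= 1] = [set v : V | `|v| <= 1]); last first.
  by apply/seteqP; split=> v /=; rewrite rnorm_le1.
split=> [|/totally_bounded_precompact//].
rewrite precompactE => /compact_totally_bounded.
exact/totally_bounded_subset/subset_closure.
Qed.

(** * Bounded maps and explicit bounds *)

Section bounded_linear.
Context {V W : normedModType R[i]}.
Implicit Types (F : V -> W) (c : R).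

(** Explicit bounds are easier to combine than [opnorm], a supremum over the unit ball that is
    meaningful only once some bound is known. *)
Definition bounded_by F c := forall v, rnorm (F v) <= c * rnorm v.

Lemma bounded_byW F c c' : c <= c' -> bounded_by F c -> bounded_by F c'.
Proof. by move=> cc' Fc v; rewrite (le_trans (Fc v))// ler_wpM2r// rnorm_ge0.
  Qed.

Lemma continuous_bounded_by (F : {linear V -> W}) :
  continuous F -> exists2 c, 0 <= c & bounded_by F c.
Proof.
move=> /linear_bounded_continuous/linear_boundedP/pinfty_ex_gt0[_ /RposE[c c0
  ->]].
move=> Fc; exists c; first exact: ltW.
by move=> v; rewrite -lecR rmorphM/= !rnormE.
Qed.

Lemma bounded_by_continuous (F : {linear V -> W}) c :
  bounded_by F c -> continuous F.
Proof.
move=> Fc x; apply/cvg_rnormP => e e0.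
pose c' := `|c| + 1; have c'0 : 0 < c' by rewrite ltr_wpDl.
apply/nbhs_rnormP; exists (e / c'); first by rewrite divr_gt0.
move=> w xw /=; rewrite -linearB.
rewrite (@le_lt_trans _ _ (c' * rnorm (x - w)))//.
  suff : bounded_by F c' by exact.
  by apply: bounded_byW Fc; rewrite (le_trans (ler_norm _))// lerDl.
by rewrite mulrC -ltr_pdivlMr.
Qed.

End bounded_linear.

Section opnorm.
Context {V : normedModType R[i]}.
Implicit Types (F : V -> V) (c : R).

Lemma opnorm_le F c : 0 <= c -> bounded_by F c -> opnorm F <= c.
Proof.
move=> c0 Fc; apply: ge_sup.
  by exists (rnorm (F 0)), 0 => //=; rewrite normr0.
move=> _ [v v1 <-]; rewrite (le_trans (Fc v))// ler_piMr//.
by rewrite rnorm_le1.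
Qed.

(** Homogeneity rescales a vector into the unit ball. The auxiliary bound [c] ensures that the
    supremum is taken over a bounded set. *)
Lemma opnorm_bounded_by F c : (forall (a : R[i]) v, F (a *: v) = a *: F v) ->
  bounded_by F c -> bounded_by F (opnorm F).
Proof.
move=> FZ Fc v.
have F0 : F 0 = 0 by rewrite -[in F _](scale0r (0 : V)) FZ scale0r.
have [->|v0] := eqVneq v 0; first by rewrite F0 rnorm0 mulr0.
have nv : 0 < rnorm v.
  rewrite lt_neqAle rnorm_ge0 andbT eq_sym.
  by apply: contra v0 => /eqP/rnorm0_eq0 ->.
rewrite -ler_pdivrMr// mulrC.
have rZ (a : R) w : 0 <= a -> rnorm (a%:C *: w) = a * rnorm w.
  by move=> a0; apply: complexI; rewrite rnormE normrZ rmorphM/= rnormE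
    ger0_norm// lecR.
rewrite -rZ ?invr_ge0 ?rnorm_ge0// -FZ.
apply: ub_le_sup; last first.
  exists ((rnorm v)^-1%:C *: v) => //=; rewrite -rnorm_le1 rZ ?invr_ge0
    ?rnorm_ge0//.
  by rewrite mulVf// gt_eqF.
exists (`|c|) => _ [w w1 <-]; rewrite (le_trans (Fc w))//.
rewrite (@le_trans _ _ (`|c| * rnorm w))// ?ler_wpM2r ?rnorm_ge0 ?ler_norm//.
by rewrite ler_piMr// rnorm_le1.
Qed.

Lemma norm_closure_approx (A : set {linear V -> V}) (T : {linear V -> V}) :
  (forall S, A S -> continuous S) -> norm_closure A T ->
  forall e : R, 0 < e ->
    exists2 S : {linear V -> V}, A S & bounded_by (fun v => T v - S v) e.
Proof.
move=> Ac [Tc AT] e e0; have [S AS TS] := AT e e0; exists S => //.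
apply: (bounded_byW (ltW TS)).
have [c c0 Tle] := continuous_bounded_by Tc.
have [d d0 Sle] := continuous_bounded_by (Ac S AS).
apply: (@opnorm_bounded_by _ (c + d)) => [a v|v].
  by rewrite (linearZ_LR T) (linearZ_LR S) -scalerBr.
rewrite (le_trans (ler_rnormD _ _))// rnormN mulrDl lerD//.
Qed.

Lemma norm_closureI (A : set {linear V -> V}) (T : {linear V -> V}) :
  continuous T ->
  (forall e : R, 0 < e ->
    exists2 S : {linear V -> V}, A S & bounded_by (fun v => T v - S v) e) ->
  norm_closure A T.
Proof.
move=> Tc AT; split=> // e e0.
have [S AS TS] := AT (e / 2) (divr_gt0 e0 (ltr0n _ 2)); exists S => //.
rewrite (@le_lt_trans _ _ (e / 2))//; last by rewrite ltr_pdivrMr// mulr2n; lra.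
by apply: opnorm_le TS; rewrite divr_ge0// ltW.
Qed.

End opnorm.
End normed.

(** * Singular value decomposition and truncation *)

(** Dependent choice for a condition that only looks at the earlier terms. [f n] is a table correct
    below [n], and the sequence is read off the diagonal. *)
Lemma prefix_choice (T : choiceType) (x0 : T) (P : (nat -> T) -> nat -> T ->
  Prop) :
  (forall s s' n x, (forall i, (i < n)%N -> s i = s' i) ->
    P s n x -> P s' n x) ->
  (forall s n, (forall i, (i < n)%N -> P s i (s i)) -> exists x, P s n x) ->
  exists s, forall n, P s n (s n).
Proof.
move=> Pext Pex.
pose f := fix f n := if n is m.+1
  then fun i => if i == m then xget x0 (P (f m) m) else f m i else fun=> x0.
have fE n k i : (i < n)%N -> f (n + k)%N i = f n i.
  elim: k => [|k IH] lin; first by rewrite addn0.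
  by rewrite addnS /= ltn_eqF ?IH// (leq_trans lin)// leq_addr.
pose s n := f n.+1 n; have sf n i : (i < n)%N -> s i = f n i.
  by move=> lin; rewrite /s -(subnKC lin) fE.
exists s => n; elim/ltn_ind: n => n IH.
have [|x Px] := Pex (f n) n.
  move=> i lin; rewrite -sf//; apply: Pext (IH i lin) => j lji.
  by apply: sf; exact: ltn_trans lin.
apply: (Pext (f n)); first by move=> i lin; rewrite (sf n).
by rewrite /s /= eqxx; apply: (@xgetPex _ x0 (P (f n) n)); exists x.
Qed.

Section svd.
Local Open Scope complex_scope.
Context {R : realType} {H : hilbertType R}.
Implicit Types (u v w x : H).

Lemma rnorm_gt0 x : x != 0 -> 0 < rnorm x.
Proof.
move=> x0; rewrite lt_neqAle rnorm_ge0 andbT eq_sym.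
by apply: contra x0 => /eqP/rnorm0_eq0 ->.
Qed.

Lemma rnorm1_neq0 x : rnorm x = 1 -> x != 0.
Proof. by move=> x1; apply/eqP => x0; move/eqP: x1;
  rewrite x0 rnorm0 eq_sym oner_eq0. Qed.

Lemma orthonormal_seqP (u : nat -> H) : (forall n, rnorm (u n) = 1) ->
  (forall n i, (i < n)%N -> inner (u n) (u i) = 0) -> orthonormal_seq u.
Proof.
move=> u1 u0 i j; have [ij|ij|->] := ltngtP i j.
- by apply: inner0C; exact: u0.
- exact: u0.
- by rewrite rnorm1_inner.
Qed.

Section max_vector.
Variables (S : H -> H) (c : R) (W : set H).
Hypotheses (Slin : linear S) (Sc : bounded_by S c).
Hypothesis Stb : totally_bounded (S @` [set v | rnorm v <= 1]).
Hypothesis Wlin : forall (a : R[i]) v w, W v -> W w -> W (a *: v + w).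
Hypothesis Wclosed : forall v,
  (forall e : R, 0 < e -> exists2 w, W w & rnorm (v - w) < e) -> W v.

Let W0 w : W w -> W 0.
Proof. by move=> Ww; have := Wlin (-1) Ww Ww; rewrite scaleN1r addNr. Qed.

(* A maximizing sequence is Cauchy: if [S v] and [S w] are close to each other
   and of almost maximal norm, so is [S (v + w) / 2], whence [v + w] has norm
   close to 2, and the parallelogram identity applies. *)
Lemma max_vector w0 : W w0 -> rnorm w0 = 1 ->
  exists v, [/\ W v, rnorm v = 1 &
    forall w, W w -> rnorm (S w) <= rnorm (S v) * rnorm w].
Proof.
move=> Ww0 w01.
pose A := [set rnorm (S w) | w in [set w | W w /\ rnorm w = 1]].
pose l := sup A.
have A_ub : has_ubound A.
  by exists c => _ [w [_ w1] <-]; rewrite (le_trans (Sc w))// w1 mulr1.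
have A_ne : A !=set0 by exists (rnorm (S w0)), w0.
have Al w : W w -> rnorm w = 1 -> rnorm (S w) <= l.
  by move=> Ww w1; apply: ub_le_sup => //; exists w.
have SlW w : W w -> rnorm (S w) <= l * rnorm w.
  move=> Ww; have [->|w_neq0] := eqVneq w 0.
    by rewrite linear_fun0// rnorm0 mulr0.
  have nw := rnorm_gt0 w_neq0.
  rewrite -ler_pdivrMr// mulrC.
  have := Al ((rnorm w)^-1%:C *: w); rewrite linear_funZ// !rnormZr.
  rewrite !ger0_norm ?invr_ge0 ?rnorm_ge0//; apply;
    last by rewrite mulVf// gt_eqF.
  by rewrite -[_ *: w]addr0; apply: Wlin => //; exact: W0 Ww.
have l0 : 0 <= l by rewrite (le_trans (rnorm_ge0 _) (Al w0 Ww0 w01)).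
have [l_eq0|l_neq0] := eqVneq l 0.
  exists w0; split=> // w Ww; rewrite (le_trans (SlW w Ww))//.
  by rewrite l_eq0 mul0r mulr_ge0 ?rnorm_ge0.
have lgt0 : 0 < l by rewrite lt_neqAle eq_sym l_neq0.
pose B d := [set w | [/\ W w, rnorm w = 1 & l - d < rnorm (S w)]].
pose F0 := [set C | exists2 d : R, 0 < d & B d `<=` C].
have F0P : ProperFilter F0.
  apply: Build_ProperFilter_ex => [C [d d0 BC]|].
    have [_ [w [Ww w1] <-] lw] := sup_adherent d0 (conj A_ne A_ub).
    by exists w; apply: BC; split.
  split.
  - by exists 1.
  - move=> C C' [d d0 dC] [d' d'0 dC']; exists (Num.min d d').
      by rewrite lt_min d0.
    move=> w [Ww w1 lw]; split; [apply: dC|apply: dC']; split=> //;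
      by rewrite (le_lt_trans _ lw)// lerD2l lerN2 ge_min lexx ?orbT.
  - by move=> C C' CC' [d d0 dC]; exists d => //; exact: subset_trans CC'.
have [G [GU F0G]] := ultraFilterLemma F0P.
have GB d : 0 < d -> G (B d) by move=> d0; apply: F0G; exists d.
have SG e : 0 < e -> exists y, G [set w | rnorm (S w - y) < e].
  move=> e0; have [s sS] := Stb e0.
  have [y _ Gy] : exists2 y, y \in s & G [set w | rnorm (S w - y) < e].
    apply: ultra_seq_ex; apply: filterS (GB 1 ltr01) => w [_ w1 _].
    by apply: sS; exists w => //=; rewrite w1.
  by exists y.
have Gcauchy : cauchy_ex G.
  move=> _ /RposE[e e0 ->].
  (* The bound [2 - 2 * t] on the norm of [w1 + w] leaves at most [8 * t] for the squared distance
     in the parallelogram identity, which is below [e ^+ 2]; [t <= 1/2] keeps [2 - 2 * t]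
     nonnegative before squaring. *)
  pose t := Num.min (1/2) (e ^+ 2 / 16).
  have t0 : 0 < t by rewrite lt_min !divr_gt0// exprn_gt0.
  have t2 : t <= 1/2 by rewrite ge_min lexx.
  have te : t <= e ^+ 2 / 16 by rewrite ge_min lexx orbT.
  have tl0 : 0 < t * l / 2 by rewrite divr_gt0// mulr_gt0.
  have [y Gy] := SG _ tl0.
  have [w1 [Bw1 w1y]] := filter_ex (filterI (GB _ tl0) Gy).
  exists w1; apply: filterS (filterI (GB _ tl0) Gy) => w [[Ww wn lw] wy].
  rewrite -ball_normE /= -rnorm_lt -(@ltr_pXn2r _ 2) ?nnegrE ?rnorm_ge0 ?ltW//.
  have [Ww1 w1n lw1] := Bw1.
  have Sww1 : rnorm (S w - S w1) < t * l.
    rewrite (_ : S w - S w1 = (S w - y) - (S w1 - y)); last first.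
      by rewrite opprB addrA subrK.
    rewrite (le_lt_trans (ler_rnormD _ _))// rnormN.
    by rewrite (splitr (t * l)) ltrD.
  have le1 : 2 * (l - t * l / 2) - t * l <= l * rnorm (w1 + w).
    have /SlW : W (w1 + w) by rewrite -[w1]scale1r; exact: Wlin.
    apply: le_trans; rewrite (linear_funD _ _ Slin).
    have : rnorm (S w1 *+ 2) <= rnorm (S w1 + S w) + rnorm (S w - S w1).
      rewrite (_ : S w1 *+ 2 = (S w1 + S w) - (S w - S w1)).
        by rewrite -(rnormN (S w - S w1)) ler_rnormD.
      by rewrite opprB addrACA subrr addr0 mulr2n.
    have -> : rnorm (S w1 *+ 2) = 2 * rnorm (S w1).
      rewrite -[S w1 *+ 2](scaler_nat 2) (_ : 2%:R = 2%:C).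
        by rewrite rnormZr ger0_norm.
      by rewrite rmorph_nat.
    lra.
  have le2 : 2 - 2 * t <= rnorm (w1 + w).
    rewrite -(ler_pM2l lgt0); apply: le_trans le1; lra.
  have := parallelogram w1 w; rewrite w1n wn.
  have : (2 - 2 * t) ^+ 2 <= rnorm (w1 + w) ^+ 2.
    by rewrite ler_pXn2r ?nnegrE ?rnorm_ge0//; lra.
  rewrite !expr2 in te *; nra.
have /cvg_ex[v Gv] : cvg G by apply/cauchy_cvgP/cauchy_exP.
have near_v e : 0 < e -> exists2 w, B e w & rnorm (v - w) < e.
  move=> e0; have /Gv Gve : nbhs v [set w | rnorm (v - w) < e].
    by apply/nbhs_rnormP; exists e.
  by have [w [Bw vw]] := filter_ex (filterI (GB _ e0) Gve); exists w.
have v1 : rnorm v = 1.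
  apply/eqP; rewrite eq_le; apply/andP; split; apply/ler_addgt0Pr => e e0;
    have [w [_ w1 _] vw] := near_v e e0.
    by rewrite -w1 -lerBlDl (le_trans _ (ltW vw))// lerBlDr -{1}[v](subrK w)
      ler_rnormD.
  rewrite -w1 addrC -lerBlDr (le_trans _ (ltW vw))// lerBlDr rnorm_distC.
  by rewrite -{1}[w](subrK v) ler_rnormD.
have Wv : W v.
  by apply: Wclosed => e /near_v[w [Ww _ _] vw]; exists w.
exists v; split=> // w Ww; rewrite (le_trans (SlW w Ww))//.
rewrite ler_wpM2r ?rnorm_ge0//.
have c0 : 0 <= c by rewrite (le_trans (rnorm_ge0 (S v)))// (le_trans (Sc v))//
  v1 mulr1.
apply/ler_addgt0Pr => e e0.
have e'0 : 0 < e / (1 + c) by rewrite divr_gt0// ltr_pwDl.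
have [w' [Ww' w'1 lw'] vw'] := near_v _ e'0.
have Swv : rnorm (S w') <= rnorm (S v) + c * (e / (1 + c)).
  rewrite -[S w'](subrK (S v)) addrC (le_trans (ler_rnormD _ _))// lerD2l.
  rewrite -linear_funB// (le_trans (Sc _))// ler_wpM2l// rnorm_distC ltW//.
have -> : e = e / (1 + c) + c * (e / (1 + c)).
  by field; rewrite gt_eqF// ltr_pwDl.
lra.
Qed.

(** First variation at the maximum. Moving [v] by [t *: w] with [t = s * b] gains at least
    [2 s |b|^2] in the squared norm of the image, while the bound grows by [s^2 |b|^2 q]. As
    [s q <= 1] by the choice of [s], this forces [b = 0]. *)
Lemma max_vector_orthogonal v w : W v -> rnorm v = 1 ->
  (forall w, W w -> rnorm (S w) <= rnorm (S v) * rnorm w) ->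
  W w -> inner v w = 0 -> inner (S v) (S w) = 0.
Proof.
move=> Wv v1 vmax Ww vw0; set b := inner _ _.
pose q := rnorm (S v) ^+ 2 * rnorm w ^+ 2.
have q0 : 0 <= q by rewrite mulr_ge0 ?sqr_ge0.
pose s : R := (q + 1)^-1; have s0 : 0 < s by rewrite invr_gt0 ltr_wpDl.
pose t := s%:C * b.
have : rnorm (S (t *: w + v)) ^+ 2 <= rnorm (S v) ^+ 2 * rnorm (t *: w + v) ^+
  2.
  by rewrite -exprMn ler_pXn2r ?nnegrE ?mulr_ge0 ?rnorm_ge0//; apply/vmax/Wlin.
rewrite linear_funD// linear_funZ// (addrC (t *: _)) (addrC (t *: w)).
rewrite !rnormDX !innerZr vw0 mulr0/= mulr0 addr0 v1 !rnormZX -/b.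
have tb : complex.Re (Num.conj t * b) = s * cabs b ^+ 2.
  have -> : Num.conj t * b = (s * cabs b ^+ 2)%:C.
    rewrite /t rmorphM rmorphM/= cabsX -mulrA; congr (_ * _);
      last by rewrite mulrC.
    by apply/eqP; rewrite eq_complex /= oppr0 !eqxx.
  by [].
have ct : cabs t ^+ 2 = s ^+ 2 * cabs b ^+ 2.
  by rewrite /t cabsM cabsR exprMn ger0_norm ?ltW.
rewrite tb ct => le.
have : cabs b ^+ 2 <= 0.
  have : 2 * (s * cabs b ^+ 2) <= s ^+ 2 * cabs b ^+ 2 * q.
    have := mulr_ge0 (mulr_ge0 (sqr_ge0 s) (sqr_ge0 (cabs b))) (sqr_ge0 (rnorm
      (S w))).
    by rewrite /q; lra.
  have sq : s * q <= 1 by rewrite /s ler_pdivrMl ?ltr_wpDl// mulr1 lerDl.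
  have -> : s ^+ 2 * cabs b ^+ 2 * q = (s * cabs b ^+ 2) * (s * q) by ring.
  have := mulr_ge0 (ltW s0) (sqr_ge0 (cabs b)) => sb0 le1.
  have : 2 * (s * cabs b ^+ 2) <= s * cabs b ^+ 2.
    by rewrite (le_trans le1)// ler_piMr.
  rewrite -(pmulr_rle0 _ s0); lra.
move=> h; apply: cabs0_eq0; apply/eqP.
by rewrite -sqrf_eq0 eq_le h sqr_ge0.
Qed.

End max_vector.

Definition orthogonal_to n (v : nat -> H) : set H :=
  [set x | forall i, (i < n)%N -> inner x (v i) = 0].

Lemma orthogonal_to_linear n (v : nat -> H) (a : R[i]) x y :
  orthogonal_to n v x -> orthogonal_to n v y -> orthogonal_to n v (a *: x + y).
Proof.
by move=> xv yv i lin; rewrite innerDl innerZl xv// yv// mulr0 addr0.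
Qed.

Lemma orthogonal_to_closed n (v : nat -> H) x :
  (forall e : R, 0 < e -> exists2 y, orthogonal_to n v y & rnorm (x - y) < e) ->
  orthogonal_to n v x.
Proof.
move=> xv i lin; apply: cabs0_eq0; apply/eqP; rewrite eq_le cabs_ge0 andbT.
apply/ler_addgt0Pr => e e0; rewrite add0r.
have e'0 : 0 < e / (1 + rnorm (v i)) by rewrite divr_gt0// ltr_pwDl// rnorm_ge0.
have [y yv xy] := xv _ e'0.
have -> : inner x (v i) = inner (x - y) (v i).
  by rewrite linearBl/= yv// subr0.
rewrite (le_trans (cauchy_schwarz _ _))//.
rewrite (@le_trans _ _ (e / (1 + rnorm (v i)) * rnorm (v i)))//.
  by rewrite ler_wpM2r ?rnorm_ge0// ltW.
rewrite mulrAC ler_pdivrMr ?ltr_pwDl ?rnorm_ge0//.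
by rewrite ler_pM2l// lerDr.
Qed.

Hypothesis infH : infinite_dimensional H.

(** Among [n + 1] independent vectors one lies outside the span of [n] vectors; its component
    orthogonal to [e] is then normalized. *)
Lemma orthogonal_unit n (e : nat -> H) :
  (forall i j, (i < n)%N -> (j < n)%N -> inner (e i) (e j) = (i == j)%:R) ->
  exists2 x, orthogonal_to n e x & rnorm x = 1.
Proof.
move=> e_on; have [f fi] := infH n.+1.
have [x xe] : exists x, ~ lspan (fun i : 'I_n => e i) x.
  apply: contrapT => /forallNP /(_ _)/contrapT all.
  by have := lin_indep_le fi (fun i => all (f i)); rewrite ltnn.
pose w := x - \sum_(i < n) inner x (e i) *: e i.
have wo : orthogonal_to n e w.
  move=> i lin; rewrite /w linearBl/=.
  by rewrite (inner_sum_orthonormal e_on (fun i => inner x (e i)))// subrr.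
have w0 : w != 0.
  rewrite subr_eq0; apply: contra_notN xe => /eqP xE.
  by exists (fun i => inner x (e i)).
have [c [cw1 _]] := normalize w0.
by exists (c *: w) => // i lin; rewrite innerZl wo// mulr0.
Qed.

Lemma orthonormal_prefix n (u : nat -> H) :
  (forall i, (i < n)%N -> rnorm (u i) = 1 /\ orthogonal_to i u (u i)) ->
  forall i j, (i < n)%N -> (j < n)%N -> inner (u i) (u j) = (i == j)%:R.
Proof.
move=> u_on i j lin ljn; have [ij|ij|ij] := ltngtP i j.
- by apply: inner0C; apply: (u_on j ljn).2.
- exact: (u_on i lin).2.
- by rewrite -ij rnorm1_inner// (u_on i lin).1.
Qed.

Section compact_svd.
Variables (S : H -> H) (c : R).
Hypotheses (Slin : linear S) (Sc : bounded_by S c).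
Hypothesis Stb : totally_bounded (S @` [set v | rnorm v <= 1]).

(** Greedy choice: each vector maximizes the norm of its image on the unit sphere orthogonal to its
    predecessors. This replaces the diagonalization of the adjoint of [S] composed with [S]. *)
Lemma right_singular_vectors : exists v : nat -> H, forall n,
  [/\ orthogonal_to n v (v n), rnorm (v n) = 1 &
    forall w, orthogonal_to n v w -> rnorm (S w) <= rnorm (S (v n)) * rnorm w].
Proof.
have [||v vP] := (prefix_choice (0 : H) (P := fun (v : nat -> H) n x =>
  [/\ orthogonal_to n v x,
  rnorm x = 1 &
  forall w, orthogonal_to n v w -> rnorm (S w) <= rnorm (S x) * rnorm w])).
  move=> v v' n x vv' [xo x1 xmax].
  have oE y : orthogonal_to n v y <-> orthogonal_to n v' y.
    by split=> yo i lin; have := yo i lin; rewrite vv'.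
  by split=> // [|w /oE]; [apply/oE|exact: xmax].
move=> v n vP.
have [|w0 w0o w01] := @orthogonal_unit n v.
    by apply: orthonormal_prefix => i /vP[].
  apply: (max_vector Slin Sc Stb _ _ w0o w01).
    by move=> a x y; exact: orthogonal_to_linear.
  exact: orthogonal_to_closed.
by exists v.
Qed.

Lemma svd_exists : exists (lam : nat -> R) (u v : nat -> H), is_svd S lam u v.
Proof.
have [v vP] := right_singular_vectors.
have v1 n : rnorm (v n) = 1 by have [] := vP n.
have von : orthonormal_seq v.
  by apply: orthonormal_seqP => // n i lin; have [vo _ _] := vP n; exact: vo.
pose lam n := rnorm (S (v n)).
have lam_mono i j : (i <= j)%N -> lam j <= lam i.
  move=> ij; have [_ _ vmax] := vP i; rewrite /lam -[leRHS]mulr1 -(v1 j).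
  apply: vmax => k ki; have [vo _ _] := vP j; apply: vo.
  exact: leq_trans ki ij.
have Sv_orth i j : (i < j)%N -> inner (S (v i)) (S (v j)) = 0.
  move=> ij; have [vo _ vmax] := vP i; have [voj _ _] := vP j.
  apply: (max_vector_orthogonal Slin _ vo (v1 i) vmax).
  - by move=> a x y; exact: orthogonal_to_linear.
  - by move=> k ki; apply: voj; exact: ltn_trans ki ij.
  - by rewrite von ltn_eqF.
(* Otherwise the images of the [v n] are mutually orthogonal of norm at least [e]. Two of them are
   close to the same centre of a finite net of radius [e / 2], against Pythagoras. *)
have lam_cvg0 : lam i @[i --> \oo] --> 0.
  apply/cvgrPdist_lt => e e0.
  suff [n lne] : exists n, lam n < e.
    exists n => // i /= ni; rewrite sub0r normrN ger0_norm ?rnorm_ge0//.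
    by rewrite (le_lt_trans (lam_mono _ _ ni)).
  apply: contrapT => /forallNP eln.
  have elam n : e <= lam n by rewrite leNgt; apply/negP.
  have e20 : 0 < e / 2 by rewrite divr_gt0.
  have [s sS] := Stb e20.
  have /(_ _)/cid2-/all_sig2[k ks vk] n : exists2 y, y \in s & rnorm (S (v n) -
    y) < e / 2.
    by apply: sS; exists (v n) => //=; rewrite v1.
  have ksz n : (index (k n) s < size s)%N by rewrite index_mem.
  have /injectivePn[i [j ij]] : ~~ injectiveb
      (fun i : 'I_(size s).+1 => Ordinal (ksz i)).
    by apply/negP => /injectiveP/leq_card; rewrite !card_ord ltnn.
  move=> /(congr1 val)/= /(congr1 (nth 0 s)); rewrite !nth_index// => kij.
  have : rnorm (S (v i) - S (v j)) < e.
    rewrite (_ : S (v i) - S (v j) = (S (v i) - k i) - (S (v j) - k j)).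
      by rewrite (le_lt_trans (ler_rnormD _ _))// rnormN (splitr e) ltrD.
    by rewrite kij opprB addrA subrK.
  rewrite -(@ltr_pXn2r _ 2) ?nnegrE ?rnorm_ge0 ?ltW// pythagoras ?rnormN.
    have := elam i; have := elam j; rewrite /lam !expr2; nra.
  rewrite linearNr; apply/eqP; rewrite oppr_eq0; apply/eqP.
  have [ij'|ji|ij'] := ltngtP i j; first exact: Sv_orth.
    by apply: inner0C; exact: Sv_orth.
  by move: ij; rewrite (val_inj ij') eqxx.
(* Where [lam n] is nonzero, [u n] is the normalized image of [v n]; by monotonicity the earlier
   values are then nonzero too, and orthogonality comes from the images. Where it vanishes, any unit
   vector orthogonal to the earlier ones will do. *)
have [||u uP] := (prefix_choice (0 : H) (P := fun (u : nat -> H) n x =>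
  [/\ rnorm x = 1,
    orthogonal_to n u x & S (v n) = (lam n)%:C *: x])).
    move=> u u' n x uu' [x1 xo Sx]; split=> // i lin.
    by have := xo i lin; rewrite uu'.
  move=> u n uP; have [l0|l0] := eqVneq (lam n) 0.
    have [|x xo x1] := @orthogonal_unit n u.
      by apply: orthonormal_prefix => i /uP[].
    exists x; split=> //; rewrite l0 scale0r; exact: rnorm0_eq0.
  have lC0 m : lam m != 0 -> (lam m)%:C != 0 :> R[i].
    by apply: contra => /eqP/(congr1 (@complex.Re R))/= ->.
  exists ((lam n)^-1%:C *: S (v n)); split.
  - by rewrite rnormZr ger0_norm ?invr_ge0 ?rnorm_ge0// mulVf.
  - move=> i lin; have [_ _ Si] := uP i lin.
    have li0 : lam i != 0.
      rewrite gt_eqF// (lt_le_trans _ (lam_mono _ _ (ltnW lin)))//.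
      by rewrite lt_neqAle eq_sym l0 rnorm_ge0.
    have -> : u i = ((lam i)%:C)^-1 *: S (v i) by rewrite Si scalerK// lC0.
    by rewrite innerZl innerZr (inner0C (Sv_orth _ _ lin)) !mulr0.
  - by rewrite scalerA -rmorphM mulfV// scale1r.
have u1 n : rnorm (u n) = 1 by have [] := uP n.
exists lam, u, v; split=> //.
- by move=> i; exact: rnorm_ge0.
- by apply: orthonormal_seqP => // n i lin; have [_ uo _] := uP n; exact: uo.
move=> x; apply/cvg_rnormP => e e0.
have x10 : 0 < rnorm x + 1 by rewrite ltr_wpDl ?rnorm_ge0.
have /cvgrPdist_lt/(_ _ (divr_gt0 e0 x10)) := lam_cvg0; apply: filterS => n.
rewrite sub0r normrN ger0_norm ?rnorm_ge0// => lne.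
(* The partial sum is the image of the projection [y] of [x], and [x - y] competes in the maximum
   defining [v n], so the error is at most [lam n] times the norm of [x]. *)
pose y := \sum_(i < n) inner x (v i) *: v i.
have -> : \sum_(i < n) (lam i)%:C *: rank_one (u i) (v i) x = S y.
  rewrite /y linear_sum_fun//; apply: eq_bigr => i _.
  by rewrite (linear_funZ _ _ Slin); have [_ _ ->] := uP i;
    rewrite /rank_one !scalerA mulrC.
rewrite -linear_funB//; have [_ _ vmax] := vP n.
have von' i j : (i < n)%N -> (j < n)%N -> inner (v i) (v j) = (i == j)%:R by [].
rewrite (le_lt_trans (vmax _ _))//.
  move=> i lin; rewrite linearBl/=.
  by rewrite (inner_sum_orthonormal von' (fun i => inner x (v i)))// subrr.
rewrite (@le_lt_trans _ _ (lam n * (rnorm x + 1)))//;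
  last by rewrite -ltr_pdivlMr.
rewrite ler_wpM2l ?rnorm_ge0// (@le_trans _ _ (rnorm x)) ?lerDl//.
rewrite -(@ler_pXn2r _ 2) ?nnegrE ?rnorm_ge0//.
by rewrite [leRHS](bessel_eq von' x) lerDl sqr_ge0.
Qed.

End compact_svd.
End svd.

(** * Truncations and their ranks *)

Section truncation.
Local Open Scope complex_scope.
Context {R : realType} {H : hilbertType R}.

(** Pairing the series with [u i] gives [inner (S x) (u i) = lam i * inner x (v i)]. The truncation
    is thus [S] followed by the orthogonal projection onto finitely many [u i], a form free of [lam]
    and [v]; the discarded singular values are below [eps]. *)
Lemma is_truncationP (eps : R) (S S' : H -> H) : 0 < eps -> linear S ->
  is_truncation eps S S' -> exists (n : nat) (lam : nat -> R) (u v : nat -> H),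
  [/\ forall i j, inner (v i) (v j) = (i == j)%:R,
      forall i j, inner (u i) (u j) = (i == j)%:R,
      forall i, (i < n)%N -> eps <= lam i /\ S (v i) = (lam i)%:C *: u i,
      S' = (fun x => \sum_(i < n) inner (S x) (u i) *: u i) &
      bounded_by (fun x => S x - S' x) eps].
Proof.
move=> eps0 Slin [lam [u [v [[l0 lmono lcvg uon von Ssum] ->]]]].
(* Since [lam] decreases to 0, the retained indices form an initial segment. *)
have [n nE] : exists n, [set i | eps <= lam i] = `I_n.
  have /cvgrPdist_lt/(_ _ eps0)[m _ mP] := lcvg.
  have exP : exists i, lam i < eps.
    by exists m; have := mP m (leqnn m); rewrite sub0r normrN ger0_norm.
  case: (ex_minnP exP) => n ln nmin; exists n; apply/seteqP; split=> i /=.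
    move=> ei; rewrite ltnNge; apply/negP => ni.
    by have := le_lt_trans (le_trans ei (lmono _ _ ni)) ln; rewrite ltxx.
  by move=> lin; rewrite leNgt; apply/negP => /nmin; rewrite leqNgt lin.
have approx x e m : 0 < e -> exists k, (m <= k)%N /\
    rnorm (S x - \sum_(i < k) (lam i)%:C *: rank_one (u i) (v i) x) < e.
  move=> e0; have /cvg_rnormP/(_ _ e0)[k _ kP] := Ssum x.
  by exists (maxn m k); split; [exact: leq_maxl|apply: kP; exact: leq_maxr].
have Su x i : inner (S x) (u i) = (lam i)%:C * inner x (v i).
  apply/eqP; rewrite -subr_eq0; apply/eqP/cabs0_eq0/eqP.
  rewrite eq_le cabs_ge0 andbT; apply/ler_addgt0Pr => e e0; rewrite add0r.
  have [k [ik Sk]] := approx x e i.+1 e0.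
  have -> : (lam i)%:C * inner x (v i) =
      inner (\sum_(i < k) (lam i)%:C *: rank_one (u i) (v i) x) (u i).
    under eq_bigr do rewrite /rank_one scalerA.
    have uon' a b : (a < k)%N -> (b < k)%N -> inner (u a) (u b) = (a == b)%:R.
      by [].
    by rewrite (inner_sum_orthonormal uon' (fun i =>
      (lam i)%:C * inner x (v i))).
  rewrite -linearBl (le_trans (cauchy_schwarz _ _))//.
  have -> : rnorm (u i) = 1.
    apply/eqP; rewrite -(@eqrXn2 _ 2) ?rnorm_ge0// expr1n.
    by apply/eqP/complexI; rewrite rnormX uon eqxx.
  by rewrite mulr1 ltW.
have S'E x : \sum_(i \in [set i | eps <= lam i]) (lam i)%:C *: rank_one (u i)
  (v i) x =
    \sum_(i < n) inner (S x) (u i) *: u i.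
  rewrite nE -fsbig_ord; apply: eq_bigr => i _; by rewrite /rank_one scalerA Su.
exists n, lam, u, v; split=> //.
- move=> i lin; split; first by have : `I_n i by []; rewrite -nE.
  apply/eqP; rewrite -subr_eq0; apply/eqP/rnorm0_eq0/eqP.
  rewrite eq_le rnorm_ge0 andbT; apply/ler_addgt0Pr => e e0; rewrite add0r.
  have [k [ik /ltW]] := approx (v i) e i.+1 e0.
  have vr j : rank_one (u j) (v j) (v i) = (i == j)%:R *: u j.
    by rewrite /rank_one von.
  rewrite (bigD1 (Ordinal ik))//= vr eqxx scale1r big1 ?addr0// => j /negP ji.
  rewrite vr; case: eqP => [ij|]; last by rewrite scale0r scaler0.
  by case: ji; apply/eqP/val_inj.
- by apply/funext => x; exact: S'E.
move=> x; rewrite S'E; apply/ler_addgt0Pr => e e0.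
have [k [nk Sk]] := approx x e n e0.
pose F i := ((lam i)%:C * inner x (v i)) *: u i.
have -> : \sum_(i < n) inner (S x) (u i) *: u i = \sum_(i < k | (i < n)%N) F i.
  rewrite -(big_ord_widen k F nk); apply: eq_bigr => i _; by rewrite Su.
have kE : \sum_(i < k) (lam i)%:C *: rank_one (u i) (v i) x = \sum_(i < k) F i.
  by apply: eq_bigr => i _; rewrite /F /rank_one scalerA.
rewrite kE in Sk; pose s := \sum_(i < k | ~~ (i < n)%N) F i.
have -> : S x - \sum_(i < k | (i < n)%N) F i = s + (S x - \sum_(i < k) F i).
  have Fk : \sum_(i < k) F i = \sum_(i < k | (i < n)%N) F i + s.
    exact: (bigID (fun i : 'I_k => (i < n)%N)).
  by rewrite Fk opprD [RHS]addrC addrA subrK.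
rewrite (le_trans (ler_rnormD _ _))// lerD ?(ltW Sk)//.
rewrite -(@ler_pXn2r _ 2) ?nnegrE ?mulr_ge0 ?rnorm_ge0 ?(ltW eps0)//.
pose d i : R[i] := if (i < n)%N then 0 else (lam i)%:C * inner x (v i).
have -> : s = \sum_(i < k) d i *: u i.
  rewrite /s big_mkcond; apply: eq_bigr => i _; rewrite /d.
  by case: (i < n)%N; rewrite ?scale0r.
rewrite (@rnorm_sum_orthonormal _ _ k u d)//.
rewrite (@le_trans _ _ (eps ^+ 2 * \sum_(i < k) cabs (inner x (v i)) ^+ 2))//.
  rewrite mulr_sumr; apply: ler_sum => i _; rewrite /d;
    case: ifP => [_|/negbT ni].
    by rewrite cabs0 expr0n mulr_ge0 ?sqr_ge0.
  rewrite cabsM cabsR ger0_norm// exprMn ler_wpM2r ?sqr_ge0//.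
  rewrite ler_pXn2r ?nnegrE ?(ltW eps0)// leNgt; apply: contra ni => /ltW ei.
  by have : [set i | eps <= lam i] i by []; rewrite nE.
by rewrite exprMn ler_wpM2l ?sqr_ge0// bessel.
Qed.

Lemma truncation_finite_rank (eps : R) (S S' : H -> H) : 0 < eps -> linear S ->
  is_truncation eps S S' -> finite_rank S'.
Proof.
move=> eps0 Slin /is_truncationP[]// n [lam [u [v [_ _ _ -> _]]]].
have [//||] := @rank_le _ _ n (fun i : 'I_n => u i)
  (fun x => \sum_(i < n) inner (S x) (u i) *: u i).
  move=> a x y; rewrite scaler_sumr -big_split/=; apply: eq_bigr => i _.
  by rewrite Slin innerDl innerZl scalerDl scalerA.
  by move=> _ [x _ <-]; exists (fun i : 'I_n => inner (S x) (u i)).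
by [].
Qed.

(* [T] is injective on the span of the right singular vectors of [S] with
   singular values at least [eps]. *)
Lemma rank_truncation_le (eps c : R) (S T : H -> H) : linear S -> linear T ->
  0 < eps -> c < eps -> bounded_by (fun x => S x - T x) c -> finite_rank T ->
  (rank (truncation eps S) <= rank T)%N.
Proof.
move=> Slin Tlin eps0 ceps STc Tfin; rewrite /truncation.
(* Without a singular value decomposition the truncation is the default map 0, of rank 0. *)
case: xgetP => [S' _ /is_truncationP|_]; last by rewrite rank0.
move=> /(_ eps0 Slin)[n [lam [u [v [von uon Sv -> _]]]]].
have [||_ /leq_trans->//] := @rank_le _ _ n (fun i : 'I_n => u i)
  (fun x => \sum_(i < n) inner (S x) (u i) *: u i).
- move=> a x y; rewrite scaler_sumr -big_split/=; apply: eq_bigr => i _.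
  by rewrite Slin innerDl innerZl scalerDl scalerA.
- by move=> _ [x _ <-]; exists (fun i : 'I_n => inner (S x) (u i)).
apply: (@rank_ge _ _ n (fun i => T (v i))) => // d dT.
pose d' i := oapp d 0 (insub i).
have dd' i : d' (val i) = d i by rewrite /d' valK.
pose x := \sum_(i < n) d' i *: v i.
have Tx : T x = 0.
  rewrite /x linear_sum_fun// -[RHS]dT; apply: eq_bigr => i _.
  by rewrite linear_funZ// dd'.
have xn : rnorm x ^+ 2 = \sum_(i < n) cabs (d' i) ^+ 2 by exact:
  rnorm_sum_orthonormal.
have Sx : eps * rnorm x <= rnorm (S x).
  rewrite -(@ler_pXn2r _ 2) ?nnegrE ?mulr_ge0 ?rnorm_ge0 ?(ltW eps0)// exprMn
    xn.
  have -> : S x = \sum_(i < n) (d' i * (lam i)%:C) *: u i.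
    rewrite /x linear_sum_fun//; apply: eq_bigr => i _.
    by rewrite linear_funZ// (Sv i _).2// scalerA.
  rewrite (@rnorm_sum_orthonormal _ _ n u (fun i =>
    d' i * (lam i)%:C))// mulr_sumr.
  apply: ler_sum => i _; rewrite cabsM exprMn mulrC ler_wpM2l ?sqr_ge0//.
  rewrite cabsR real_normK ?num_real// ler_pXn2r ?nnegrE ?(ltW eps0)//.
  - by have [] := Sv i (ltn_ord i).
  - by rewrite (le_trans (ltW eps0))//; have [] := Sv i (ltn_ord i).
have x0 : rnorm x = 0.
  have := STc x; rewrite Tx subr0 => /(le_trans Sx).
  rewrite -subr_ge0 -mulrBl => h; apply/eqP.
  have := rnorm_ge0 x; rewrite le_eqVlt => /orP[/eqP<-//|x0].
  by move: h; rewrite pmulr_lge0// subr_ge0 leNgt ceps.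
move=> i; rewrite -dd'; apply: cabs0_eq0; apply/eqP; rewrite -sqrf_eq0.
move/eqP: xn; rewrite x0 expr0n /= eq_sym psumr_eq0; last by move=> j _;
  exact: sqr_ge0.
by move=> /allP/(_ i)/(_ (mem_index_enum _)).
Qed.

Hypothesis infH : infinite_dimensional H.

Lemma truncationP (eps c : R) (S : H -> H) : linear S -> bounded_by S c ->
  totally_bounded (S @` [set v | rnorm v <= 1]) ->
  is_truncation eps S (truncation eps S).
Proof.
move=> Slin Sc Stb; have [lam [u [v svdS]]] := svd_exists infH Slin Sc Stb.
rewrite /truncation; case: xgetP => [S' _ //|]; move=> /(_ (fun x =>
  \sum_(i \in [set i | eps <= lam i]) (lam i)%:C *: rank_one (u i) (v i) x)).
by case; exists lam, u, v.
Qed.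

End truncation.

(** * Operators on l^2 *)

Lemma sum_cauchy_schwarz (R : rcfType) I (s : seq I) (a b : I -> R) :
  (\sum_(i <- s) a i * b i) ^+ 2 <=
  (\sum_(i <- s) a i ^+ 2) * (\sum_(i <- s) b i ^+ 2).
Proof.
elim: s => [|i s IH]; first by rewrite !big_nil mul0r expr0n.
rewrite !big_cons; move: IH.
have A0 : 0 <= \sum_(j <- s) a j ^+ 2 by apply: sumr_ge0 => j _; exact: sqr_ge0.
have B0 : 0 <= \sum_(j <- s) b j ^+ 2 by apply: sumr_ge0 => j _; exact: sqr_ge0.
move: A0 B0; set A := \sum_(j <- s) a j ^+ 2; set B := \sum_(j <- s) b j ^+ 2.
set S := \sum_(j <- s) _ => A0 B0 SAB.
rewrite -(sqr_sqrtr A0) -(sqr_sqrtr B0) in SAB *.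
have := sqrtr_ge0 A; have := sqrtr_ge0 B; move: SAB.
move: (Num.sqrt A) (Num.sqrt B) => p q SAB q0 p0.
have Spq : `|S| <= p * q.
  by rewrite -(@ler_pXn2r _ 2) ?nnegrE ?mulr_ge0// exprMn real_normK ?num_real.
have : S * (a i * b i) <= p * q * (`|a i| * `|b i|).
  by rewrite (le_trans (ler_norm _))// !normrM ler_wpM2r ?mulr_ge0.
have := sqr_ge0 (p * `|b i| - q * `|a i|).
rewrite -(real_normK (num_real (a i))) -(real_normK (num_real (b i))).
have : (a i * b i) ^+ 2 = `|a i| ^+ 2 * `|b i| ^+ 2.
  by rewrite exprMn !real_normK ?num_real.
rewrite !expr2 in SAB *; nra.
Qed.

Lemma sum_uniq_sub (V : nmodType) (I : eqType) (s t : seq I) (F : I -> V) :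
  uniq s -> uniq t -> {subset s <= t} ->
  (forall i, i \in t -> i \notin s -> F i = 0) ->
  \sum_(i <- t) F i = \sum_(i <- s) F i.
Proof.
move=> us ut st F0; rewrite (bigID (fun i => i \in s))/= [X in _ + X]big1_seq;
  last first.
  by move=> i /andP[is_ it]; exact: F0.
rewrite addr0 -big_filter; apply: perm_big; apply: uniq_perm => // [|i].
  exact: filter_uniq.
by rewrite mem_filter andb_idr// => /st.
Qed.

Lemma sum_uniq_le (R : numDomainType) (I : eqType) (s t : seq I) (F : I -> R) :
  uniq s -> uniq t -> {subset s <= t} -> (forall i, 0 <= F i) ->
  \sum_(i <- s) F i <= \sum_(i <- t) F i.
Proof.
move=> us ut st F0; rewrite [leRHS](bigID (fun i => i \in s))/=.
rewrite -[leLHS]addr0 lerD ?sumr_ge0//.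
suff pe : perm_eq s [seq i <- t | i \in s] by rewrite (perm_big _ pe)
  big_filter.
apply: uniq_perm => // [|i]; first exact: filter_uniq.
by rewrite mem_filter andb_idr// => /st.
Qed.

Section l2.
Local Open Scope complex_scope.
Context {R : realType} {X : choiceType} {H : normedModType R[i]}.
Implicit Types (f g : l2 X H) (s : seq X).

(** Replaces extended real sums by real sums over duplicate-free sequences, the form used for all
    later estimates in l^2. *)
Lemma sqsum_seqP (f : X -> H) (C : R) :
  (forall s, uniq s -> \sum_(x <- s) rnorm (f x) ^+ 2 <= C) <->
  (sqsum f <= C%:E)%E.
Proof.
split=> [fC|fC s us].
  apply: ge_ereal_sup => _ [A [Afin _] <-].
  rewrite fsbig_finite//= sumEFin lee_fin fC//.
rewrite -lee_fin -sumEFin fsbig_seq//.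
by apply: le_trans fC; apply: esum_ge; exists [set` s] => //; split.
Qed.

Lemma sqsummable_seq (f : X -> H) (C : R) :
  (forall s, uniq s -> \sum_(x <- s) rnorm (f x) ^+ 2 <= C) ->
  f \in (@sqsummable R X H).
Proof. by move/(sqsum_seqP f C) => fC; rewrite inE/= (le_lt_trans fC)// ltry.
  Qed.

Lemma l2_rnormX f : ((rnorm f ^+ 2)%:E = sqsum f)%E.
Proof.
by rewrite /rnorm /= sqr_sqrtr ?fine_ge0 ?sqsum_ge0// fineK ?sqsum_fin.
Qed.

Lemma l2_sum_le f s : uniq s -> \sum_(x <- s) rnorm (f x) ^+ 2 <= rnorm f ^+ 2.
Proof. by move: s; apply/(sqsum_seqP f); rewrite l2_rnormX. Qed.

Lemma l2_rnorm_le f (c : R) : 0 <= c ->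
  (forall s, uniq s -> \sum_(x <- s) rnorm (f x) ^+ 2 <= c ^+ 2) -> rnorm f <=
    c.
Proof.
move=> c0 /sqsum_seqP; rewrite -l2_rnormX lee_fin.
by rewrite ler_pXn2r ?nnegrE ?rnorm_ge0.
Qed.

Lemma l2_coord_le f x : rnorm (f x) <= rnorm f.
Proof.
rewrite -(@ler_pXn2r _ 2) ?nnegrE ?rnorm_ge0//.
by have := @l2_sum_le f [:: x] erefl; rewrite big_seq1.
Qed.

Lemma l2_rnorm_mono f g : (forall x, rnorm (f x) <= rnorm (g x)) ->
  rnorm f <= rnorm g.
Proof.
move=> fg; apply: l2_rnorm_le => [|s us]; first exact: rnorm_ge0.
apply: le_trans (l2_sum_le g us); apply: ler_sum => x _.
by rewrite ler_pXn2r ?nnegrE ?rnorm_ge0.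
Qed.

Lemma l2_sumE I (r : seq I) (P : pred I) (F : I -> l2 X H) x :
  (\sum_(i <- r | P i) F i : l2 X H) x = \sum_(i <- r | P i) F i x.
Proof.
elim: r => [|i r IH]; rewrite ?big_nil ?big_cons//; case: ifP => // _.
by rewrite -IH.
Qed.

Lemma l2_delta_linear y : linear (l2_delta y : H -> l2 X H).
Proof.
move=> a u v; apply/val_inj/funext => x /=; rewrite /l2_delta_fun.
change ((if x == y then a *: u + v else 0) =
  a *: (if x == y then u else 0) + (if x == y then v else 0)).
by case: eqP => // _; rewrite scaler0 addr0.
Qed.

Lemma l2_sum_delta s (F : X -> H) : uniq s -> forall x,
  (\sum_(y <- s) l2_delta y (F y) : l2 X H) x = if x \in s then F x else 0.
Proof.
move=> us x; rewrite l2_sumE; case: ifPn => xs.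
  rewrite (bigD1_seq x)//= /l2_delta_fun eqxx big1 ?addr0// => y.
  by rewrite eq_sym => /negbTE ->.
rewrite big1_seq// => y /= ys; rewrite /l2_delta_fun; case: eqP => // xy.
by move: xs; rewrite xy ys.
Qed.

Lemma l2_approx f (e : R) : 0 < e -> exists2 s, uniq s &
  rnorm (f - \sum_(y <- s) l2_delta y (f y)) < e.
Proof.
move=> e0; have e2 : 0 < (e / 2) ^+ 2 by rewrite exprn_gt0// divr_gt0.
have [s us sf] : exists2 s, uniq s &
    rnorm f ^+ 2 - (e / 2) ^+ 2 <= \sum_(x <- s) rnorm (f x) ^+ 2.
  apply: contrapT => nos.
  have : (sqsum f <= (rnorm f ^+ 2 - (e / 2) ^+ 2)%:E)%E.
    apply/sqsum_seqP => s us; rewrite leNgt; apply/negP => /ltW h.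
    by apply: nos; exists s.
  rewrite -l2_rnormX lee_fin; lra.
exists s => //; rewrite (@le_lt_trans _ _ (e / 2))//;
  last by rewrite ltr_pdivrMr//; lra.
apply: l2_rnorm_le => [|t ut]; first by rewrite divr_ge0// ltW.
have -> : \sum_(x <- t) rnorm ((f - \sum_(y <- s) l2_delta y (f y) : l2 X H) x)
  ^+ 2 =
    \sum_(x <- t | x \notin s) rnorm (f x) ^+ 2.
  rewrite [RHS]big_mkcond; apply: eq_bigr => x _.
  have -> : (f - \sum_(y <- s) l2_delta y (f y) : l2 X H) x =
    f x - (\sum_(y <- s) l2_delta y (f y) : l2 X H) x by [].
  rewrite (l2_sum_delta f us).
  by case: (x \in s); rewrite ?subrr ?rnorm0 ?expr0n// subr0.
have : \sum_(x <- s ++ [seq x <- t | x \notin s]) rnorm (f x) ^+ 2 <= rnorm f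
  ^+ 2.
  apply: l2_sum_le; rewrite cat_uniq us filter_uniq// andbT.
  by apply/hasPn => x; rewrite mem_filter => /andP[].
rewrite big_cat big_filter/=; lra.
Qed.

(** Density of the finitely supported functions. This is what reduces identities between bounded
    maps to identities between matrix entries. *)
Lemma l2_functional_eq0 (W : normedModType R[i]) (F : l2 X H -> W) (c : R) :
  linear F -> bounded_by F c ->
  (forall y v, F (l2_delta y v) = 0) -> forall f, F f = 0.
Proof.
move=> Flin Fc F0 f; apply/rnorm0_eq0/eqP; rewrite eq_le rnorm_ge0 andbT.
apply/ler_addgt0Pr => e e0; rewrite add0r.
have c0 : 0 < `|c| + 1 by rewrite ltr_wpDl.
have [s us sf] := l2_approx f (divr_gt0 e0 c0).
have -> : F f = F (f - \sum_(y <- s) l2_delta y (f y)).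
  by rewrite linear_funB// linear_sum_fun// [X in _ - X]big1 ?subr0.
rewrite (le_trans (Fc _))//.
rewrite (@le_trans _ _ ((`|c| + 1) * rnorm (f - \sum_(y <- s) l2_delta y (f
  y))))//.
  by rewrite ler_wpM2r ?rnorm_ge0// (le_trans (ler_norm _))// lerDl.
by rewrite mulrC -ler_pdivlMr// ltW.
Qed.

End l2.

Section entries.
Local Open Scope complex_scope.
Context {R : realType} {X : choiceType} {H : normedModType R[i]}.
Local Notation operator := {linear l2 X H -> l2 X H}.
Implicit Types (T S : operator) (f : l2 X H) (c : R).

Lemma rnorm_l2_delta y (v : H) : rnorm (l2_delta y v : l2 X H) <= rnorm v.
Proof.
apply: l2_rnorm_le => [|s us]; first exact: rnorm_ge0.
have [ys|ys] := boolP (y \in s).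
  rewrite (bigD1_seq y)//= /l2_delta_fun eqxx big1 ?addr0// => x /negbTE ->.
  by rewrite rnorm0 expr0n.
rewrite big1_seq ?sqr_ge0// => x /= xs; rewrite /l2_delta_fun.
case: eqP => [xy|_]; last by rewrite rnorm0 expr0n.
by move: ys; rewrite -xy xs.
Qed.

Lemma entry_linear T x y : linear (entry T x y).
Proof. by move=> a u v; rewrite /entry l2_delta_linear linearP. Qed.

Lemma coord_bounded_by (F : l2 X H -> l2 X H) c x :
  bounded_by F c -> bounded_by (fun f => F f x) c.
Proof. by move=> Fc f; exact: le_trans (l2_coord_le _ _) (Fc f). Qed.

Lemma entry_bounded_by T c x y : 0 <= c -> bounded_by T c ->
  bounded_by (entry T x y) c.
Proof.
move=> c0 Tc v; apply: le_trans (coord_bounded_by x Tc _) _.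
by rewrite ler_wpM2l// rnorm_l2_delta.
Qed.

Lemma row_sum T c x s : bounded_by T c -> uniq s ->
  (forall y, y \notin s -> entry T x y = fun=> 0) ->
  forall f, T f x = \sum_(y <- s) entry T x y (f y).
Proof.
move=> Tc us T0 f; apply/eqP; rewrite -subr_eq0; apply/eqP.
have c0 : 0 <= `|c| by [].
have Tc' : bounded_by T `|c| := bounded_byW (ler_norm c) Tc.
apply: (@l2_functional_eq0 _ _ _ _ (fun f => T f x - \sum_(y <- s) entry T x y
  (f y))
  (`|c| + \sum_(y <- s) `|c|)).
- move=> a g h; rewrite linearP/= scalerBr scaler_sumr addrACA -opprD
  -big_split/=.
  by congr (_ - _); apply: eq_bigr => y _; rewrite -entry_linear.
- move=> g; rewrite (le_trans (ler_rnormD _ _))// mulrDl lerD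
  ?coord_bounded_by//.
  rewrite rnormN (le_trans (ler_rnorm_sum _ _ _))// mulr_suml.
  apply: ler_sum => y _; rewrite (le_trans (entry_bounded_by _ _ c0 Tc' _))//.
  by rewrite ler_wpM2l// l2_coord_le.
move=> y v; have [ys|ys] := boolP (y \in s).
  rewrite (bigD1_seq y)//= /l2_delta_fun eqxx big1 ?addr0 ?subrr// =>
    z /negbTE ->.
  exact/linear_fun0/entry_linear.
rewrite big1_seq ?subr0 => [|z /= zs]; first by rewrite -[LHS]/(entry T x y v)
  T0.
rewrite /l2_delta_fun; case: eqP => [zy|_]; last exact/linear_fun0/entry_linear.
by move: ys; rewrite -zy zs.
Qed.

(** Comparison of single rows, as the approximating operator is defined differently on different
    rows. [L] will be a projection or the identity. *)
Lemma row_ext T S c d x (L : {linear H -> H}) (b : R) :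
  bounded_by T c -> bounded_by S d -> bounded_by L b ->
  (forall y v, entry T x y v = L (entry S x y v)) ->
  forall f, T f x = L (S f x).
Proof.
move=> Tc Sd Lb TS f; apply/eqP; rewrite -subr_eq0; apply/eqP.
apply: (@l2_functional_eq0 _ _ _ _ (fun f => T f x - L (S f x)) (c + `|b| * d)).
- move=> a g h; have UE (U : operator) : U (a *: g + h) x = a *: U g x + U h x.
    by rewrite linearP.
  by rewrite !UE linearP/= scalerBr opprD addrACA.
- move=> g; rewrite (le_trans (ler_rnormD _ _))// mulrDl lerD
  ?coord_bounded_by//.
  rewrite rnormN (le_trans (bounded_byW (ler_norm b) Lb _))// -mulrA
    ler_wpM2l//.
  exact: coord_bounded_by.
by move=> y v; rewrite -[T _ x]/(entry T x y v) TS subrr.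
Qed.

End entries.

(** * Banded matrices and Schur multiplication *)

Section ball_seq.
Local Open Scope complex_scope.
Context {R : realType} {X : metricType R}.
Hypothesis boundedX : bounded_geometry X.

Definition ball_seq (r : R) (x : X) : seq X :=
  finmap.enum_fset (fset_set [set y | mdist x y <= r]).

(** Bounded geometry speaks of positive radii only, hence the passage to [|r| + 1]. *)
Lemma ball_bound r : exists N, forall x : X,
  ([set y | mdist x y <= r] #<= `I_N)%card.
Proof.
have [N NP] := boundedX (lt_le_trans ltr01 (ler_wpDl (normr_ge0 r) (lexx 1))).
exists N => x; apply: card_le_trans (NP x); apply: subset_card_le => y /= xyr.
by rewrite (le_trans xyr)// (le_trans (ler_norm r))// lerDl.
Qed.

Lemma finite_ball r (x : X) : finite_set [set y | mdist x y <= r].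
Proof. by have [N NP] := ball_bound r; apply/finite_set_leP; exists N. Qed.

Lemma mem_ball_seq r x y : (y \in ball_seq r x) = (mdist x y <= r).
Proof.
rewrite /ball_seq in_fset_set; last exact: finite_ball.
by apply/idP/idP; rewrite inE.
Qed.

Lemma ball_seq_uniq r x : uniq (ball_seq r x).
Proof. exact: finmap.fset_uniq. Qed.

Lemma size_ball_seq r : exists N, forall x, (size (ball_seq r x) <= N)%N.
Proof.
by have [N NP] := ball_bound r; exists N => x; apply: geq_card_fset_set.
Qed.

(** Half of the Schur test: after exchanging the sums over the finite set [L] of all columns met by
    the rows in [s], each column has total weight at most [K]. *)
Lemma sum_ball_weighted (w : X -> X -> R) (g : X -> R) (r K C : R) (s : seq X) :
  0 <= K -> (forall x y, 0 <= w x y) -> (forall x, 0 <= g x) ->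
  (forall y t, uniq t -> \sum_(x <- t | mdist x y <= r) w x y <= K) ->
  (forall t, uniq t -> \sum_(y <- t) g y <= C) -> uniq s ->
  \sum_(x <- s) \sum_(y <- ball_seq r x) w x y * g y <= K * C.
Proof.
move=> K0 w0 g0 wK gC us.
pose L := undup (flatten [seq ball_seq r x | x <- s]).
have -> : \sum_(x <- s) \sum_(y <- ball_seq r x) w x y * g y =
    \sum_(x <- s) \sum_(y <- L) (if mdist x y <= r then w x y * g y else 0).
  apply: eq_big_seq => x xs.
  rewrite (@sum_uniq_sub _ _ (ball_seq r x) L) ?undup_uniq ?ball_seq_uniq//.
  - by apply: eq_big_seq => y; rewrite mem_ball_seq => ->.
  - move=> y yx; rewrite mem_undup; apply/flattenP; exists (ball_seq r x) => //.
    exact: map_f.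
  - by move=> y _; rewrite mem_ball_seq => /negbTE ->.
rewrite exchange_big/= (@le_trans _ _ (\sum_(y <- L) K * g y))//.
  apply: ler_sum => y _; rewrite -big_mkcond/= -mulr_suml.
  by rewrite ler_wpM2r// wK.
by rewrite -mulr_sumr ler_wpM2l// gC// undup_uniq.
Qed.

End ball_seq.

Section operators.
Local Open Scope complex_scope.
Context {R : realType} {X : metricType R} {H : hilbertType R}.
Hypothesis boundedX : bounded_geometry X.
Local Notation operator := {linear l2 X H -> l2 X H}.

Lemma l2_rnormX_le (f : l2 X H) (C : R) :
  (forall s, uniq s -> \sum_(x <- s) rnorm (f x) ^+ 2 <= C) -> rnorm f ^+ 2 <=
    C.
Proof. by rewrite -lee_fin l2_rnormX => fC; apply/(sqsum_seqP f). Qed.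

Lemma rnorm_sum_l2_delta (s : seq X) (F : X -> H) : uniq s ->
  rnorm (\sum_(y <- s) l2_delta y (F y) : l2 X H) ^+ 2 <=
  \sum_(y <- s) rnorm (F y) ^+ 2.
Proof.
move=> us; apply: l2_rnormX_le => t ut.
rewrite (@le_trans _ _ (\sum_(x <- t | x \in s) rnorm (F x) ^+ 2))//.
  rewrite [leRHS]big_mkcond ler_sum// => x _.
  by rewrite (l2_sum_delta F us); case: ifP; rewrite // rnorm0 expr0n.
rewrite -big_filter; apply: sum_uniq_le => //; first exact: filter_uniq.
- by move=> x; rewrite mem_filter => /andP[].
- by move=> x; exact: sqr_ge0.
Qed.

(** One factor [N] in the squared norm comes from Cauchy-Schwarz along a row, the other from the
    number of rows meeting a column. *)
Lemma matrix_operator (m : X -> X -> H -> H) (c r : R) (N : nat) : 0 <= c ->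
  (forall x : X, (size (ball_seq r x) <= N)%N) ->
  (forall x y, linear (m x y)) -> (forall x y, bounded_by (m x y) c) ->
  (forall x y, ~~ (mdist x y <= r) -> m x y = fun=> 0) ->
  exists T : operator,
    bounded_by T (c * N%:R) /\ forall x y, entry T x y = m x y.
Proof.
move=> c0 NP mlin mc m0.
pose F (f : l2 X H) x := \sum_(y <- ball_seq r x) m x y (f y).
have FX (f : l2 X H) s : uniq s ->
    \sum_(x <- s) rnorm (F f x) ^+ 2 <= (c * N%:R * rnorm f) ^+ 2.
  move=> us.
  have F1 x : rnorm (F f x) ^+ 2 <=
      \sum_(y <- ball_seq r x) (c ^+ 2 * N%:R) * rnorm (f y) ^+ 2.
    rewrite (@le_trans _ _ ((\sum_(y <- ball_seq r x) c * rnorm (f y)) ^+ 2))//.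
      rewrite ler_pXn2r ?nnegrE ?rnorm_ge0//.
        by rewrite (le_trans (ler_rnorm_sum _ _ _))// ler_sum// => y _;
          exact: mc.
      by apply: sumr_ge0 => y _; rewrite mulr_ge0 ?rnorm_ge0.
    rewrite (le_trans (sum_cauchy_schwarz _ _ _))// -mulr_sumr.
    rewrite ler_wpM2r//; first by apply: sumr_ge0 => y _; exact: sqr_ge0.
    rewrite big_const_seq count_predT iter_addr addr0 -[leLHS]mulr_natr.
    by rewrite ler_wpM2l ?sqr_ge0// ler_nat.
  rewrite (le_trans (ler_sum _ (fun x _ => F1 x)))//.
  have -> : (c * N%:R * rnorm f) ^+ 2 = (c ^+ 2 * N%:R * N%:R) * rnorm f ^+ 2.
    by rewrite !expr2; ring.
  apply: (@sum_ball_weighted R X boundedX (fun _ _ => c ^+ 2 * N%:R)) => //.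
  - by rewrite !mulr_ge0 ?sqr_ge0.
  - by move=> _ _; rewrite mulr_ge0 ?sqr_ge0.
  - by move=> x; exact: sqr_ge0.
  - move=> y t ut; rewrite -big_filter big_const_seq count_predT iter_addr
    addr0.
    rewrite -[leLHS]mulr_natr ler_wpM2l ?mulr_ge0 ?sqr_ge0// ler_nat.
    rewrite (leq_trans _ (NP y))//.
    apply: uniq_leq_size; first exact: filter_uniq.
    by move=> x; rewrite mem_filter mem_ball_seq// metric_sym => /andP[].
  - by move=> t ut; exact: l2_sum_le.
have Fl2 f : F f \in (@sqsummable R X H).
  by apply: sqsummable_seq => s us; exact: FX.
pose G f : l2 X H := L2 (Fl2 f).
have Glin : linear G.
  move=> a f g; apply/val_inj/funext => x.
  change (F (a *: f + g) x = a *: F f x + F g x).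
  rewrite /F scaler_sumr -big_split/=; apply: eq_bigr => y _.
  by rewrite -mlin.
have [T TG] := linear_funE Glin.
exists T; split=> [f|x y].
  rewrite TG; apply: l2_rnorm_le; last by move=> s us; exact: FX.
  by rewrite !mulr_ge0 ?rnorm_ge0.
apply/funext => v; rewrite /entry TG /= /F.
have [xy|xy] := boolP (mdist x y <= r).
  rewrite (bigD1_seq y) ?mem_ball_seq ?ball_seq_uniq//= /l2_delta_fun eqxx.
  rewrite big1 ?addr0// => z /negbTE ->; exact: linear_fun0.
rewrite m0// big1_seq// => z /andP[_]; rewrite mem_ball_seq// => xz.
rewrite /= /l2_delta_fun; case: eqP => [zy|_]; last exact: linear_fun0.
by move: xy; rewrite -zy xz.
Qed.

(* Schur multiplication by the positive definite kernel [<h x, h y>] is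
   [T |-> \sum_z V_z^* T V_z] with [V_z] the multiplication by [h ^~ z]. *)
Lemma schur_bounded_by (T M : operator) (h : X -> X -> R) (c d t : R) :
  0 <= c -> bounded_by T c -> bounded_by M d ->
  (forall x s, uniq s -> \sum_(z <- s) h x z ^+ 2 <= 1) ->
  (forall x z, h x z != 0 -> mdist x z <= t) ->
  (forall x y v, entry M x y v =
    (\sum_(z <- ball_seq t x) h x z * h y z)%:C *: entry T x y v) ->
  bounded_by M c.
Proof.
move=> c0 Tc Md h1 ht Mh f.
have h0 x z : ~~ (mdist x z <= t) -> h x z = 0.
  by move=> xz; apply/eqP; apply: contraNT xz; exact: ht.
pose V z : l2 X H := \sum_(y <- ball_seq t z) l2_delta y ((h y z)%:C *: f y).
have VX z : rnorm (V z) ^+ 2 <= \sum_(y <- ball_seq t z) h y z ^+ 2 * rnorm (f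
  y) ^+ 2.
  rewrite (le_trans (rnorm_sum_l2_delta _ _)) ?ball_seq_uniq// ler_sum// => y _.
  by rewrite rnormZX cabsR real_normK ?num_real.
have TV x z : T (V z) x = \sum_(y <- ball_seq t z) (h y z)%:C *: entry T x y (f
  y).
  rewrite linear_sum l2_sumE; apply: eq_bigr => y _.
  by rewrite -[LHS]/(entry T x y _) linear_funZ//; exact: entry_linear.
have MV x : M f x = \sum_(z <- ball_seq t x) (h x z)%:C *: T (V z) x.
  rewrite (row_sum Md (ball_seq_uniq (t + t) x)); last first.
    move=> y; rewrite mem_ball_seq// => xy; apply/funext => v; rewrite Mh.
    rewrite big1_seq ?scale0r// => z /andP[_]; rewrite mem_ball_seq// => xz.
    rewrite (h0 y) ?mulr0//; apply: contra xy => yz.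
    by rewrite (le_trans (metric_triangle _ z _))// lerD// metric_sym.
  under eq_bigr => y _ do rewrite Mh rmorph_sum scaler_suml.
  rewrite exchange_big; apply: eq_big_seq => z; rewrite mem_ball_seq// => xz.
  under eq_bigr => y _ do rewrite rmorphM -scalerA.
  rewrite -scaler_sumr TV; congr (_ *: _).
  apply: sum_uniq_sub; rewrite ?ball_seq_uniq//.
    move=> y; rewrite !mem_ball_seq// => zy.
    by rewrite (le_trans (metric_triangle _ z _))// lerD.
  move=> y _; rewrite mem_ball_seq// metric_sym => yz.
  by rewrite h0// scale0r.
(* The normalization of [h] is used twice: here, through Cauchy-Schwarz in row [x], and at the end,
   to bound the sum of the squared norms of the [V z] by that of [f]. *)
have M1 x : rnorm (M f x) ^+ 2 <= \sum_(z <- ball_seq t x) rnorm (T (V z) x) ^+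
  2.
  rewrite (@le_trans _ _ ((\sum_(z <- ball_seq t x) `|h x z| * rnorm (T (V z)
    x)) ^+ 2))//.
    rewrite ler_pXn2r ?nnegrE ?rnorm_ge0//.
      rewrite MV (le_trans (ler_rnorm_sum _ _ _))// ler_sum// => z _.
      by rewrite rnormZr.
    by apply: sumr_ge0 => z _; rewrite mulr_ge0 ?rnorm_ge0.
  rewrite (le_trans (sum_cauchy_schwarz _ _ _))// ler_piMl//.
    by apply: sumr_ge0 => z _; exact: sqr_ge0.
  under eq_bigr => z _ do rewrite real_normK ?num_real//.
  by rewrite h1// ball_seq_uniq.
apply: l2_rnorm_le => [|s us]; first by rewrite mulr_ge0 ?rnorm_ge0.
rewrite (le_trans (ler_sum _ (fun x _ => M1 x)))//.
pose L := undup (flatten [seq ball_seq t x | x <- s]).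
have uL : uniq L by exact: undup_uniq.
rewrite (@le_trans _ _ (\sum_(x <- s) \sum_(z <- L) rnorm (T (V z) x) ^+ 2))//.
  rewrite big_seq [leRHS]big_seq; apply: ler_sum => x xs;
    apply: sum_uniq_le => //.
  - exact: ball_seq_uniq.
  - move=> y yx; rewrite mem_undup; apply/flattenP; exists (ball_seq t x) => //.
    exact: map_f.
  - by move=> z; exact: sqr_ge0.
rewrite exchange_big/= (@le_trans _ _ (\sum_(z <- L) c ^+ 2 * rnorm (V z) ^+
  2))//.
  apply: ler_sum => z _; rewrite (le_trans (l2_sum_le _ us))// -exprMn.
  by rewrite ler_pXn2r ?nnegrE ?mulr_ge0 ?rnorm_ge0.
rewrite -mulr_sumr exprMn ler_wpM2l ?sqr_ge0//.
rewrite (le_trans (ler_sum _ (fun z _ => VX z)))// -[leRHS]mul1r.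
apply: (@sum_ball_weighted R X boundedX (fun z y => h y z ^+ 2)) => //.
- by move=> z y; exact: sqr_ge0.
- by move=> y; exact: sqr_ge0.
- move=> y u uu; rewrite -big_filter h1//; exact: filter_uniq.
- by move=> u uu; exact: l2_sum_le.
Qed.

End operators.

(** * The coarse groupoid *)

Lemma ultra_ext (T : Type) (F G : set_system T) : UltraFilter F ->
  UltraFilter G -> F `<=` G -> F = G.
Proof. by move=> FU GU FG; apply/esym/max_filter. Qed.

#[local] Existing Instance stone_cechP.

Section stone_cech_topology.
Context {T : Type}.
Implicit Types (p q : stone_cech T) (A : set T).

Lemma stone_cech_ext p q : (forall A, ultra_sets p A -> ultra_sets q A) -> p =
  q.
Proof.
case: p q => F FU [G GU] /= FG.
have FGE : F = G by apply: ultra_ext.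
by case: G / FGE GU FG => GU _; congr StoneCech; exact: Prop_irrelevance.
Qed.

Lemma ultra_setC p A : ~ ultra_sets p A <-> ultra_sets p (~` A).
Proof.
split=> [pA|pnA pA]; first by case: (in_ultra_setVsetC A (stone_cechP p)).
by have /filter_ex[x []] : ultra_sets p (A `&` ~` A) by exact: filterI.
Qed.

Lemma ultra_ex p A : ultra_sets p A -> exists x, A x.
Proof. exact: filter_ex. Qed.

Lemma beta_base_open A : open (beta_base A).
Proof.
exists [set A] => //; apply/seteqP; split=> [q [_ -> //]|q qA]; by exists A.
Qed.

Lemma nbhs_beta_base p A : ultra_sets p A -> nbhs p (beta_base A).
Proof. by move=> pA; apply: open_nbhs_nbhs; split=> //;
  exact: beta_base_open. Qed.

Lemma nbhs_betaP p (B : set (stone_cech T)) : nbhs p B ->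
  exists2 A, ultra_sets p A & beta_base A `<=` B.
Proof.
rewrite nbhsE => -[_ [[I _ <-] [A IA pA]] IB]; exists A => //.
by apply: subset_trans IB => q qA; exists A.
Qed.

Lemma beta_inP t A : ultra_sets (beta_in t) A <-> A t.
Proof. by split=> [/(_ t erefl)|At _ ->]. Qed.

(** Basic sets are clopen. Closures thereby become membership in ultrafilters, the form in which the
    topology is used below. *)
Lemma beta_closureP A p : beta_closure A p <-> ultra_sets p A.
Proof.
split=> [pA|pA B /nbhs_betaP[C pC CB]]; last first.
  have [t [At Ct]] := ultra_ex (filterI pA pC).
  by exists (beta_in t); split; [exists t|apply/CB/beta_inP].
apply: contrapT => /ultra_setC/nbhs_beta_base/pA[_ [[t At <-]]].
by move=> /beta_inP/(_ At).
Qed.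

End stone_cech_topology.

(** The limit of the points [v s] along [F]; it supplies limit points in the compactness proof for
    the reduction. *)
Lemma bind_ultra (S T : Type) (F : set_system S) (v : S -> stone_cech T) :
  UltraFilter F -> UltraFilter [set A | F [set s | ultra_sets (v s) A]].
Proof.
move=> FU; split.
  apply: Build_ProperFilter_ex; first by move=> A /= FA;
    have [s sA] := filter_ex FA; exact: ultra_ex sA.
  split=> [|A B /= FA FB|A B AB]; rewrite /=.
  - by apply: filterS filterT => s _; exact: filterT.
  - by apply: filterS (filterI FA FB) => s [sA sB]; exact: filterI.
  - by apply: filterS => s; exact: filterS.
move=> G GF FG; apply/seteqP; split=> // A GA; apply: contrapT => nFA.
have [//|FnA] := in_ultra_setVsetC [set s | ultra_sets (v s) A] FU.
have /FG GnA : F [set s | ultra_sets (v s) (~` A)].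
  by apply: filterS FnA => s /ultra_setC.
by have /filter_ex[x []] : G (A `&` ~` A) by exact: filterI.
Qed.

(** * Colourings of spaces of bounded geometry *)

Section coloring.
Context {R : realType} {X : metricType R}.

Lemma maximal_separated (r : R) (W : set X) : 0 <= r -> exists A, [/\ A `<=` W,
  forall x y, A x -> A y -> mdist x y <= r -> x = y &
  forall x, W x -> exists2 a, A a & mdist x a <= r].
Proof.
move=> r0; pose P (A : set X) := A `<=` W /\
  forall x y, A x -> A y -> mdist x y <= r -> x = y.
have [|A [[AW Asep] Amax]] := @Zorn_bigcup X P.
  move=> F FP Ftot; split=> [x [A /FP[AW _] /AW//]|x y [A FA Ax] [B FB By]].
  have [AB|BA] := Ftot _ _ FA FB.
    by have [_] := FP _ FB; apply=> //; exact: AB.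
  by have [_] := FP _ FA; apply=> //; exact: BA.
exists A; split=> // x Wx; apply: contrapT => far.
have xx y : A y -> mdist x y <= r -> x = y by move=> Ay xy; case: far; exists y.
apply: (Amax (A `|` [set x])); first split=> [|/(_ x)]; first exact: subsetUl.
  move=> Ax; apply: far; exists x; rewrite ?mdistxx//; apply: Ax; right; by [].
split=> [y [/AW//|->//]|y z [Ay|->] [Az|->]] yz; [exact: Asep| | |by []].
  by apply/esym/xx => //; rewrite metric_sym.
exact: xx.
Qed.

(** Greedy colouring in rounds. After [n] rounds the uncoloured points have values at least [n]; the
    next round gives colour [n] to a maximal separated set of them, so a point passed over has a
    neighbour of that colour. *)
Lemma partial_coloring (r : R) n : 0 <= r -> exists c : X -> nat,
  (forall x y, (c x < n)%N -> c x = c y -> mdist x y <= r -> x = y) /\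
  (forall x, (n <= c x)%N -> forall i, (i < n)%N ->
    exists y, mdist x y <= r /\ c y = i).
Proof.
move=> r0; elim: n => [|n [c [cinj cmax]]]; first by exists (fun=> 0%N).
have [A [AW Asep Amax]] := maximal_separated [set x | (n <= c x)%N] r0.
pose c' x := if (c x < n)%N then c x else if `[< A x >] then n else n.+1.
have c'A x : A x -> c' x = n.
  by move=> Ax; rewrite /c' ltnNge (AW x Ax)/=; case: asboolP.
exists c'; split=> [x y|x].
  rewrite /c'; case: (ltnP (c x) n) => [xn _|nx].
    case: (ltnP (c y) n) => [yn|ny]; first exact: cinj.
    case: ifP => _ cxE; first by move: xn; rewrite cxE ltnn.
    by move: xn; rewrite cxE ltnNge leqnSn.
  case: (asboolP (A x)) => [Ax _|_]; last by rewrite ltnn.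
  case: (ltnP (c y) n) => [yn nE|ny]; first by move: yn; rewrite -nE ltnn.
  case: (asboolP (A y)) => [Ay _|_ /eqP]; first exact: Asep.
  by rewrite -[n]addn0 -addnS eqn_add2l.
rewrite {1}/c'; case: (ltnP (c x) n) => [xn /(ltn_trans xn)|nx];
  first by rewrite ltnn.
case: (asboolP (A x)) => [_|nAx _ i]; first by rewrite ltnn.
rewrite ltnS leq_eqVlt => /orP[/eqP ->|lin].
  by have [a Aa xa] := Amax x nx; exists a; split=> //; exact: c'A.
have [y [xy yi]] := cmax x nx i lin.
by exists y; split=> //; rewrite /c' yi lin.
Qed.

Hypothesis boundedX : bounded_geometry X.

(** A point left uncoloured after [N] rounds would see all [N] colours in its ball, which would then
    have [N + 1] points, itself included. *)
Lemma coloring (r : R) : 0 <= r -> exists (N : nat) (c : X -> nat),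
  (forall x, (c x < N)%N) /\ forall x y, c x = c y -> mdist x y <= r -> x = y.
Proof.
move=> r0; have [N NP] := size_ball_seq boundedX r.
have [c [cinj cmax]] := partial_coloring N r0.
have cN x : (c x < N)%N.
  rewrite ltnNge; apply/negP => Nc.
  have /(_ _)/cid-/all_sig[y yP] : forall i : 'I_N, exists y, mdist x y <= r /\
    c y = i.
    by move=> i; exact: cmax.
  have : uniq (map c (x :: [seq y i | i <- enum 'I_N])).
    rewrite /= -map_comp (eq_map (g := val)); last by move=> i /=;
      have [] := yP i.
    rewrite val_enum_ord iota_uniq andbT mem_iota/= add0n -leqNgt//.
  have sub : {subset x :: [seq y i | i <- enum 'I_N] <= ball_seq r x}.
    move=> z; rewrite in_cons => /orP[/eqP ->|/mapP[i _ ->]];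
      rewrite mem_ball_seq//.
      by rewrite mdistxx.
    by have [] := yP i.
  move=> /map_uniq/uniq_leq_size/(_ sub)/leq_trans/(_ (NP x)).
  by rewrite /= size_map size_enum_ord ltnn.
by exists N, c; split=> // x y; exact: cinj.
Qed.

End coloring.

Section groupoid.
Context {R : realType} {X : metricType R}.
Hypothesis boundedX : bounded_geometry X.
Implicit Types g : stone_cech (X * X).

Lemma E_le (r r' : R) : r <= r' -> (E_ r : set (X * X)) `<=` E_ r'.
Proof. by move=> rr' [x y] /= xy; exact: le_trans rr'. Qed.

Lemma coarse_groupoidP g : coarse_groupoid g <->
  exists r : R, ultra_sets g (E_ r).
Proof.
split=> [[r _ /beta_closureP gr]|[r gr]]; first by exists r.
exists `|r| => /=; first exact: normr_ge0.
by apply/beta_closureP; apply: filterS gr; exact/E_le/ler_norm.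
Qed.

(** Two points of colour [j] within [r] of the same point are at distance at most [r + r], hence
    equal. So the first coordinate is a function of the second here, and [g] can be recovered from
    its source. *)
Lemma graph_inj (c : X -> nat) (r : R) j g g' :
  (forall x y, c x = c y -> mdist x y <= r + r -> x = y) ->
  ultra_sets g [set z | E_ r z /\ c z.1 = j] ->
  ultra_sets g' [set z | E_ r z /\ c z.1 = j] ->
  gs g = gs g' -> g = g'.
Proof.
move=> cinj gj g'j gsE; apply: stone_cech_ext => A gA.
pose G : set (X * X) := [set z | E_ r z /\ c z.1 = j].
have : ultra_sets (gs g) (snd @` (A `&` G)).
  by apply: filterS (filterI gA gj) => z AGz; exists z.
rewrite gsE => g'S; apply: filterS (filterI g'j g'S) => -[x y] [[/= xy cx]].
move=> [[x' y'] [Az [/= xy' cx']] /= yy']; rewrite -yy'.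
suff -> : x = x' by [].
apply: cinj; first by rewrite cx.
by rewrite (le_trans (metric_triangle _ y _))// lerD// metric_sym -yy'.
Qed.

Lemma ultra_color (c : X -> nat) N (p : stone_cech X) :
  (forall x, (c x < N)%N) -> exists2 j, (j < N)%N & ultra_sets p [set x | c x =
    j].
Proof.
move=> cN; have [|j] := @ultra_seq_ex _ nat (ultra_sets p) (iota 0 N)
    (fun j => [set x | c x = j]) _.
  by apply: filterS filterT => x _; exists (c x); rewrite ?mem_iota ?cN.
by rewrite mem_iota => /andP[_ jN] pj; exists j.
Qed.

Lemma groupoid_inj g g' : coarse_groupoid g -> coarse_groupoid g' ->
  gr g = gr g' -> gs g = gs g' -> g = g'.
Proof.
move=> /coarse_groupoidP[r gr_] /coarse_groupoidP[r' gr_'] grE gsE.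
pose t := Num.max `|r| `|r'|.
have t0 : 0 <= t by rewrite le_max normr_ge0.
have gt : ultra_sets g (E_ t).
  by apply: filterS gr_; apply: E_le; rewrite le_max ler_norm.
have g't : ultra_sets g' (E_ t).
  by apply: filterS gr_'; apply: E_le; rewrite le_max ler_norm orbT.
have [N [c [cN cinj]]] := coloring boundedX (addr_ge0 t0 t0).
have [j _ gj] := ultra_color (gr g) cN.
apply: (graph_inj (c := c) (r := t) (j := j) cinj _ _ gsE);
  apply: filterI => //.
by rewrite grE in gj; exact: gj.
Qed.


(** * The open set of a rank distribution and the reduction to its complement *)

Section rank_distribution.
Variable D : set (X -> X -> nat).
Hypothesis rdD : rank_distribution D.

Lemma finite_entourage_row (E : set (X * X)) x : coarse_entourage E ->
  finite_set [set z | E (x, z)].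
Proof.
move=> [r Er]; apply: sub_finite_set (finite_ball boundedX r x) => z /= xz.
exact: Er.
Qed.

Lemma finite_entourage_col (E : set (X * X)) x : coarse_entourage E ->
  finite_set [set z | E (z, x)].
Proof.
move=> [r Er]; apply: sub_finite_set (finite_ball boundedX r x) => z /= zx.
by rewrite metric_sym; exact: Er.
Qed.

Lemma leq_fsum (A : set X) (F : X -> nat) z : finite_set A -> A z ->
  (F z <= \sum_(y \in A) F y)%N.
Proof.
move=> Afin Az; rewrite fsbig_finite//= (bigD1_seq z) ?finmap.fset_uniq//=.
  exact: leq_addr.
by rewrite in_fset_set// inE.
Qed.

Lemma E_entourage (r : R) : coarse_entourage (E_ r : set (X * X)).
Proof. by exists r => x y. Qed.

Definition row_supp (alpha : X -> X -> nat) : set X := fst @` rank_supp alpha.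

Lemma U_ofP p : U_of D p <-> exists2 alpha, D alpha & ultra_sets p (row_supp
  alpha).
Proof.
by split=> [[alpha Da /beta_closureP pa]|[alpha Da pa]]; exists alpha => //;
  apply/beta_closureP.
Qed.

Lemma row_supp_translate alpha (r : R) x y : mdist x y <= r ->
  row_supp alpha y -> row_supp (ent_mull (E_ r) alpha) x.
Proof.
move=> xy [[y' w] /= yw yE]; rewrite /= in yE; subst y'.
exists (x, w) => //; rewrite /rank_supp /= -lt0n.
have := @leq_fsum [set z | E_ r (x, z)] (fun z => alpha z w) y
  (finite_entourage_row x (E_entourage r)) xy.
by apply: leq_trans; rewrite lt0n.
Qed.

(** Invariance of the open set reflects the stability of [D] under left multiplication by
    entourages. *)
Lemma U_of_invariant g (r : R) : ultra_sets g (E_ r) ->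
  U_of D (gs g) -> U_of D (gr g).
Proof.
move=> gEr /U_ofP[alpha Da ga]; apply/U_ofP.
exists (ent_mull (E_ r) alpha); first exact: (rd_mull rdD (E_entourage r)).
apply: filterS (filterI gEr ga) => -[x y] [/= xy ay].
exact: row_supp_translate xy ay.
Qed.

Lemma rd_zero : D (fun _ _ => 0%N).
Proof.
have s0 : rank_supp (fun _ _ : X => 0%N) = set0.
  by apply/seteqP; split=> z.
apply: (rd_finite rdD); last by rewrite s0.
by exists 0 => x y; rewrite s0.
Qed.

Lemma row_suppD alpha beta :
  row_supp alpha `|` row_supp beta = row_supp (fun x y =>
    (alpha x y + beta x y)%N).
Proof.
apply/seteqP; split=> [x [] [[x' y] /= xy <-]|x [[x' y] /= xy <-]].
- by exists (x', y) => //=; rewrite /rank_supp /= addn_eq0 negb_and xy.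
- by exists (x', y) => //=; rewrite /rank_supp /= addn_eq0 negb_and xy orbT.
- move: xy; rewrite /rank_supp /= addn_eq0 negb_and => /orP[xy|xy].
    by left; exists (x', y).
  by right; exists (x', y).
Qed.

(* Otherwise the sets [~` row_supp alpha] generate, inside [Y], an ultrafilter
   outside [U_of D]. *)
Lemma sub_U_of (Y : set X) : beta_closure Y `<=` U_of D ->
  exists2 alpha, D alpha & Y `<=` row_supp alpha.
Proof.
move=> YU; apply: contrapT => nocover.
pose F := [set A | exists2 alpha, D alpha & Y `\` A `<=` row_supp alpha].
have FF : ProperFilter F.
  apply: Build_ProperFilter_ex => [A [alpha Da YA]|].
    apply: contrapT => A0; apply: nocover; exists alpha => // y Yy; apply: YA.
    by split=> // Ay; apply: A0; exists y.
  split=> [|A B [alpha Da YA] [beta Db YB]|A B AB [alpha Da YA]].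
  - by exists (fun _ _ => 0%N); [exact: rd_zero|move=> y [_ /(_ I)]].
  - exists (fun x y => (alpha x y + beta x y)%N); first exact: rd_add.
    rewrite -row_suppD => y [Yy /not_andP[nA|nB]]; [left; exact: YA|right;
      exact: YB].
  - by exists alpha => // y [Yy nBy]; apply: YA; split=> // /AB.
have [G [GU FG]] := ultraFilterLemma FF.
have /YU/U_ofP[alpha Da Galpha] : beta_closure Y (StoneCech GU).
  apply/beta_closureP; apply: FG; exists (fun _ _ => 0%N); first exact: rd_zero.
  by move=> y [].
have : ultra_sets (StoneCech GU) (~` row_supp alpha).
  by apply: FG; exists alpha => // y [_ /contrapT].
by move/ultra_setC.
Qed.

Lemma sub_U_ofI (Y : set X) alpha : D alpha -> Y `<=` row_supp alpha ->
  beta_closure Y `<=` U_of D.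
Proof.
move=> Da Ya p /beta_closureP pY; apply/U_ofP; exists alpha => //.
exact: filterS pY.
Qed.

Lemma neighbourhood_U_of (Y : set X) (r : R) : beta_closure Y `<=` U_of D ->
  beta_closure [set x | exists2 y, Y y & mdist x y <= r] `<=` U_of D.
Proof.
move=> /sub_U_of[alpha Da Ya]; apply: (sub_U_ofI (alpha := ent_mull (E_ r)
  alpha)).
  exact: (rd_mull rdD (E_entourage r)).
by move=> x [y /Ya ay xy]; exact: row_supp_translate xy ay.
Qed.

Local Notation F := (~` U_of D).
Local Notation G := (reduction F).

Lemma reductionP g : reduction F g <-> (exists r : R, ultra_sets g (E_ r)) /\
  ~ U_of D (gs g).
Proof. by split=> -[/coarse_groupoidP]. Qed.

Lemma reduction_ex g (r : R) : ultra_sets g (E_ r) -> ~ U_of D (gs g) ->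
  exists a : G, val a = g.
Proof.
move=> gr_ gU; have Gg : reduction F g by apply/reductionP; split=> //;
  exists r.
by exists (SigSub (mem_set Gg)).
Qed.

Lemma val_reduction (a : G) : reduction F (val a).
Proof. exact/set_mem/(valP a). Qed.

Lemma nbhs_reduction (a : G) (A : set (X * X)) : ultra_sets (val a) A ->
  nbhs a [set b : G | ultra_sets (val b) A].
Proof.
move=> aA; apply: open_nbhs_nbhs; split=> //.
by exists (beta_base A) => //; exact: beta_base_open.
Qed.

Lemma nbhs_reductionP (a : G) (B : set G) : nbhs a B ->
  exists2 A, ultra_sets (val a) A & forall b : G, ultra_sets (val b) A -> B b.
Proof.
move=> [_ [[C Co <-] Ca CB]].
have /nbhs_betaP[A aA AC] : nbhs (val a) C by exact: open_nbhs_nbhs.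
by exists A => // b bA; apply: CB; exact: AC.
Qed.

(** The limit of an ultrafilter of arrows still contains [E_ r]. Its source stays outside [U_of D],
    a union of basic open sets that the sources of the arrows avoid. *)
Lemma compact_E (r : R) : compact [set a : G | ultra_sets (val a) (E_ r)].
Proof.
rewrite compact_ultra => V VU VK.
pose g := StoneCech (bind_ultra (fun a : G => val a) VU).
have gU : ~ U_of D (gs g).
  move=> /U_ofP[alpha Da galpha]; have [a aalpha] : exists a : G,
      ultra_sets (gs (val a)) (row_supp alpha).
    by apply: (@filter_ex _ V); exact: galpha.
  by have /reductionP[_] := val_reduction a; apply; apply/U_ofP; exists alpha.
have [a ag] := reduction_ex (VK : ultra_sets g (E_ r)) gU.
exists a; split; first by rewrite /= ag.
move=> B /nbhs_reductionP[A aA AB]; rewrite ag in aA.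
have VA : V [set b : G | ultra_sets (val b) A] := aA.
suff : V B by [].
by apply: filterS VA => b /AB.
Qed.

(** Here the injectivity of the pair (range, source) makes the arbitrary choice in [red_mul] a
    determined one. *)
Lemma red_mulP (a b c : G) : red_r c = red_r a -> red_s c = red_s b ->
  red_mul a b = c.
Proof.
move=> cr cs; rewrite /red_mul; case: xgetP => [d _ [dr ds]|/(_ c)[]//].
apply/val_inj/groupoid_inj.
- by have [] := val_reduction d.
- by have [] := val_reduction c.
- by rewrite -[LHS]/(red_r d) dr -cr.
- by rewrite -[LHS]/(red_s d) ds -cs.
Qed.

(** * Compactly supported functions on the reduction *)

Section compact_support.
Variable f : G -> R.
Hypotheses (fcont : continuous f) (f0 : forall a, 0 <= f a).
Hypothesis fsupp : compact (closure [set a | f a != 0]).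

Lemma compact_support_scale : exists2 t : R, 0 <= t &
  forall a : G, f a != 0 -> ultra_sets (val a) (E_ t).
Proof.
have [t [t0 tP]] : exists t : R, 0 <= t /\
    forall a : G, closure [set a | f a != 0] a -> ultra_sets (val a) (E_ t).
  apply: (compact_ind (Q := fun A => exists t : R, 0 <= t /\
    forall a : G, A a -> ultra_sets (val a) (E_ t)) fsupp).
  - by exists 0.
  - move=> A B [t [t0 tA]] [t' [t'0 tB]]; exists (Num.max t t').
    split=> [|a [/tA|/tB]]; first by rewrite le_max t0.
      by apply: filterS; apply: E_le; rewrite le_max lexx.
    by apply: filterS; apply: E_le; rewrite le_max lexx orbT.
  - by move=> A B AB [t [t0 tB]]; exists t; split=> // a /AB/tB.
  move=> a _; have /reductionP[[r ar] _] := val_reduction a.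
  exists [set b : G | ultra_sets (val b) (E_ r)]; first exact: nbhs_reduction.
  exists `|r|; split=> // b; apply: filterS; exact/E_le/ler_norm.
by exists t => // a fa; apply: tP; exact: subset_closure.
Qed.

(* A discrete substitute for the extension of [f] to a compactly supported
   function on the whole coarse groupoid. *)
Lemma discrete_approximation (t eta : R) :
  (forall a : G, f a != 0 -> ultra_sets (val a) (E_ t)) -> 0 < eta ->
  exists k : X * X -> R, [/\ forall z, 0 <= k z,
    forall z, k z != 0 -> mdist z.1 z.2 <= t &
    forall a : G, ultra_sets (val a) [set z | `|k z - f a| < eta]].
Proof.
move=> ft eta0.
(* [k] vanishes off [B] and approximates [f] at every arrow containing [B]. Because of this second
   clause two local solutions glue: the first one is used on its own [B], the second one
   elsewhere. *)
pose Q (A : set G) := exists (k : X * X -> R) (B : set (X * X)),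
  [/\ forall z, 0 <= k z, forall z, k z != 0 -> B z,
      forall a : G, ultra_sets (val a) B ->
        ultra_sets (val a) [set z | `|k z - f a| < eta] &
      forall a, A a -> ultra_sets (val a) B].
have [k [B [k0 kB kapprox supB]]] : Q (closure [set a | f a != 0]).
  apply: (compact_ind fsupp).
  - exists (fun=> 0), set0; split=> //; first by move=> z; rewrite eqxx.
    by move=> a /ultra_ex[].
  - move=> A A' [k [B [k0 kB kapprox AB]]] [k' [B' [k'0 kB' kapprox' AB']]].
    exists (fun z => if `[< B z >] then k z else k' z), (B `|` B'); split.
    + by move=> z; case: ifP.
    + by move=> z; case: ifP => [/asboolP Bz _|_ /kB']; [left|right].
    + move=> a aBB'; have [aB|/ultra_setC aB] := EM (ultra_sets (val a) B).
        apply: filterS (filterI aB (kapprox a aB)) => z [Bz] /=.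
        by case: asboolP.
      have aB' : ultra_sets (val a) B'.
        by apply: filterS (filterI aBB' aB) => z [[]].
      apply: filterS (filterI aB (kapprox' a aB')) => z [Bz] /=.
      by case: asboolP.
    + by move=> a [/AB|/AB']; apply: filterS => z; [left|right].
  - by move=> A A' AA' [k [B [k0 kB kapprox AB]]]; exists k, B;
    split=> // a /AA'/AB.
  move=> a _.
  have fa : nbhs a [set b | `|f a - f b| < eta].
    by move: (@fcont a) => /cvgrPdist_lt/(_ _ eta0).
  have [A aA Af] := nbhs_reductionP fa.
  exists [set b : G | ultra_sets (val b) A]; first exact: nbhs_reduction.
  exists (fun z => if `[< A z >] then f a else 0), A; split=> //.
  - by move=> z; case: ifP.
  - by move=> z; case: asboolP => //; rewrite eqxx.
  - move=> b bA; have fb := Af b bA.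
    by apply: filterS bA => z Az /=; rewrite asboolT.
(* The cut is harmless: arrows where [f] is nonzero contain [E_ t], and at the others replacing a
   value by 0 only improves the approximation. *)
exists (fun z => if mdist z.1 z.2 <= t then k z else 0); split.
- by move=> z; case: ifP.
- by move=> z; case: ifP => //; rewrite eqxx.
move=> a; have [aB|/ultra_setC aB] := EM (ultra_sets (val a) B).
  have [fa0|/ft at_] := eqVneq (f a) 0.
    apply: filterS (kapprox a aB) => z /=; case: ifP => // _ _.
    by rewrite fa0 subrr normr0.
  by apply: filterS (filterI at_ (kapprox a aB)) => z [/= ->].
have fa0 : f a = 0.
  apply: contrapT => /eqP fa; have : ultra_sets (val a) B.
    by apply: supB; exact: subset_closure.
  exact: (proj2 (ultra_setC _ _)).
apply: filterS aB => z Bz /=.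
have -> : k z = 0 by apply: contrapT => /eqP/kB.
by rewrite if_same fa0 subrr normr0.
Qed.

End compact_support.
End rank_distribution.
End groupoid.

(** * Partial property A as a positive definite kernel *)

Lemma ultra_all (T : Type) (I : eqType) (F : set_system T) (s : seq I)
    (P : I -> set T) : Filter F -> (forall i, i \in s -> F (P i)) ->
  F [set x | forall i, i \in s -> P i x].
Proof.
move=> FF; elim: s => [|i s IH] Fs; first by apply: filterS filterT.
have Fi : F (P i) by apply: Fs; rewrite mem_head.
have Fs' : F [set x | forall i, i \in s -> P i x].
  by apply: IH => j js; apply: Fs; rewrite in_cons js orbT.
apply: filterS (filterI Fi Fs') => x [Pix Psx] j; rewrite in_cons.
by move=> /orP[/eqP ->//|/Psx].
Qed.

Lemma sum_le_esum (R : realType) (T : choiceType) (I : set T) (F : T -> R)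
    (s : seq T) : uniq s -> (forall i, i \in s -> I i) ->
  ((\sum_(i <- s) F i)%:E <= \esum_(i in I) (F i)%:E)%E.
Proof.
move=> us sI; apply: esum_ge; exists [set` s]; first by split.
by rewrite -fsbig_seq// sumEFin.
Qed.

Lemma esum_gt_sum (R : realType) (T : choiceType) (I : set T) (F : T -> R)
    (x : R) : (x%:E < \esum_(i in I) (F i)%:E)%E ->
  exists s, [/\ uniq s, forall i, i \in s -> I i /\ F i != 0 & x < \sum_(i <-
    s) F i].
Proof.
move=> /ereal_sup_gt[_ [A [Afin AI] <-]].
rewrite fsbig_finite//= sumEFin lte_fin => xA.
exists [seq i <- finmap.enum_fset (fset_set A) | F i != 0]; split.
- by rewrite filter_uniq// finmap.fset_uniq.
- move=> i; rewrite mem_filter => /andP[Fi]; rewrite in_fset_set// inE => Ai.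
  by split=> //; exact: AI.
- rewrite big_filter big_mkcond/= (eq_bigr F)// => i _.
  by case: eqVneq.
Qed.

Lemma sum_const_seq (R : pzRingType) (I : Type) (s : seq I) (x : R) :
  \sum_(i <- s) x = x * (size s)%:R.
Proof. by rewrite big_const_seq count_predT iter_addr addr0 mulr_natr. Qed.

Section kernel.
Context {R : realType} {X : metricType R}.
Hypothesis boundedX : bounded_geometry X.
Variable D : set (X -> X -> nat).
Hypothesis rdD : rank_distribution D.
Local Notation G := (reduction (~` U_of D)).

(** * From fibre sums on the groupoid to sums over balls *)

Section approximation.
Variables (f : G -> R) (t r eta : R) (N : nat) (c : X -> nat) (k : X * X -> R).
Hypotheses (r0 : 0 <= r) (eta0 : 0 < eta).
Hypothesis ft : forall a : G, f a != 0 -> ultra_sets (val a) (E_ t).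
Hypothesis cN : forall x, (c x < N)%N.
Hypothesis cinj : forall x y, c x = c y ->
  mdist x y <= (t + r) + (t + r) -> x = y.
Hypothesis k0 : forall z, 0 <= k z.
Hypothesis kf : forall a : G, ultra_sets (val a) [set z | `|k z - f a| < eta].

(** Discrete counterpart of the sum of [f] over the fibre at [x]. The radius is [t + r] and not [t],
    so that one ball serves for all points within [r] of its centre. *)
Let mass x := \sum_(z <- ball_seq (t + r) x) k (z, x).

Let size_color (I : eqType) (s : seq I) (j : I -> nat) : uniq s ->
  {in s &, injective j} -> (forall i, i \in s -> (j i < N)%N) -> (size s <=
    N)%N.
Proof.
move=> us jinj jN; rewrite -(size_iota 0 N) -(size_map j).
apply: uniq_leq_size; first by rewrite map_inj_in_uniq.
by move=> _ /mapP[i is_ ->]; rewrite mem_iota/= add0n jN.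
Qed.

(** Arrows of one fibre in the support of [f] have ranges of distinct colours, so there are at most
    [N] of them. At some [y] they are all represented by distinct points [z a], with [k (z a, y)]
    within [eta] of [f a]. *)
Lemma fiber_mass (p : stone_cech X) (x : R) :
  (x%:E < \esum_(a in [set a : G | red_s a = p]) (f a)%:E)%E ->
  ultra_sets p [set y | x - N%:R * eta < mass y].
Proof.
move=> /esum_gt_sum[s [us sP xs]]; apply: contrapT => /ultra_setC pB.
have /(_ _)/cid-/all_sig[j jP] (a : G) : exists j, a \in s ->
    (j < N)%N /\ ultra_sets (val a) [set z | E_ t z /\ c z.1 = j].
  have [as_|] := boolP (a \in s); last by exists 0%N.
  have [j jN aj] := ultra_color (gr (val a)) cN.
  exists j => _; split=> //; have [_ fa] := sP a as_.
  by apply: filterS (filterI (ft fa) aj) => -[].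
have jinj : {in s &, injective j}.
  move=> a b as_ bs jab; apply: val_inj.
  have [[sa _] [sb _]] := (sP a as_, sP b bs).
  apply: (graph_inj (c := c) (r := t) (j := j a)).
  - move=> y z cyz yz; apply: cinj => //; rewrite (le_trans yz)//.
    by rewrite lerD// lerDl.
  - by have [] := jP a as_.
  - by rewrite jab; have [] := jP b bs.
  - by rewrite -[LHS]/(red_s a) -[RHS]/(red_s b) sa sb.
have ps : ultra_sets p [set y | forall a, a \in s -> exists z,
    [/\ mdist z y <= t, c z = j a & `|k (z, y) - f a| < eta]].
  apply: ultra_all => a as_; have [<- fa] := sP a as_; have [_ aj] := jP a as_.
  have : ultra_sets (val a) [set z | (E_ t z /\ c z.1 = j a) /\ `|k z - f a| <
    eta].
    exact: filterI aj (kf a).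
  by apply: filterS => -[z y] [[/= zy cz] kz]; exists z.
have [y [By ys]] := ultra_ex (filterI pB ps).
have /(_ _)/cid-/all_sig[z zP] (a : G) : exists z, a \in s ->
    [/\ mdist z y <= t, c z = j a & `|k (z, y) - f a| < eta].
  have [/ys[z zP]|] := boolP (a \in s); first by exists z.
  by exists y.
apply: By; rewrite /= ltrBlDr (lt_le_trans xs)//.
rewrite (@le_trans _ _ (\sum_(a <- s) (k (z a, y) + eta)))//.
  rewrite big_seq [leRHS]big_seq; apply: ler_sum => a as_.
  have [_ _] := zP a as_; rewrite ltr_norml => /andP[+ _].
  by rewrite ltrNl opprB ltrBlDr => /ltW; rewrite addrC.
rewrite big_split/= lerD//.
  rewrite -(big_map z xpredT (fun z => k (z, y))); apply: sum_uniq_le => //.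
  - rewrite map_inj_in_uniq// => a b as_ bs zab; apply: jinj => //.
    by have [_ <- _] := zP a as_; have [_ <- _] := zP b bs; rewrite zab.
  - exact: ball_seq_uniq.
  - move=> _ /mapP[a as_ ->]; rewrite mem_ball_seq//.
    have [zy _ _] := zP a as_; rewrite metric_sym (le_trans zy)//.
    by rewrite lerDl.
rewrite sum_const_seq mulrC ler_wpM2r ?(ltW eta0)// ler_nat.
by apply: (size_color us jinj) => a /jP[].
Qed.

(** In the ball of radius [t + r] at [x] a colour [j] determines a point [z j x]. The images of [p]
    under [x |-> (z j x, x)] and [x |-> (z j x, y x)] are an arrow [a j] and its product with [g],
    so each colour costs [2 * eta] besides the variation of [f]. *)
Lemma fiber_variation (p : stone_cech X) (y : X -> X) (g : G) (d : R) :
  (forall x, mdist x (y x) <= r) -> val g = beta_map (fun x => (x, y x)) p ->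
  (\esum_(a in [set a : G | red_s a = red_r g])
     `|f a - f (red_mul a g)|%:E < d%:E)%E ->
  ultra_sets p [set x | \sum_(z <- ball_seq (t + r) x) `|k (z, x) - k (z, y x)|
                          <= d + 2 * (N%:R * eta)].
Proof.
move=> yr gE fd; apply: contrapT => /ultra_setC pB.
have gp : red_r g = p.
  by rewrite /red_r gE; apply: stone_cech_ext.
have gU : ~ U_of D (gs (val g)).
  by have /reductionP[] := val_reduction g.
have pU : ~ U_of D p.
  move=> pU; apply: gU.
  (* The inverse arrow of [g]; by invariance, [p] lies outside [U_of D] together with the source of
     [g]. *)
  pose g' := beta_map (fun x => (y x, x)) p.
  have g'r : ultra_sets g' (E_ r).
    suff : ultra_sets p [set x | E_ r (y x, x)] by [].
    by apply: filterS filterT => x _; rewrite /E_ /= metric_sym; exact: yr.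
  have := U_of_invariant boundedX rdD g'r.
  have -> : gs g' = p by apply: stone_cech_ext.
  have -> : gr g' = gs (val g) by rewrite gE; apply: stone_cech_ext.
  exact.
pose S j : set X := [set x | exists z, mdist z x <= t + r /\ c z = j].
pose J := [seq j <- iota 0 N | `[< ultra_sets p (S j) >]].
pose z j x : X := xget x [set z | mdist z x <= t + r /\ c z = j].
have zP j x : S j x -> mdist (z j x) x <= t + r /\ c (z j x) = j.
  by move=> [w wP]; rewrite /z; case: xgetP => [_ _ //|/(_ w)].
have zE x w : mdist w x <= t + r -> z (c w) x = w.
  move=> wx; have [zx cz] : mdist (z (c w) x) x <= t + r /\ c (z (c w) x) = c w.
    by apply: zP; exists w.
  apply: cinj => //; rewrite (le_trans (metric_triangle _ x _))// lerD//.
  by rewrite metric_sym.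
have /(_ _)/cid-/all_sig[a aP] j : exists a : G, j \in J ->
    [/\ red_s a = p, ultra_sets (val a) [set w | c w.1 = j] &
      ultra_sets p [set x | `|k (z j x, x) - k (z j x, y x)| <=
                            `|f a - f (red_mul a g)| + 2 * eta]].
  have [jJ|] := boolP (j \in J); last by exists g.
  have pS : ultra_sets p (S j) by move: jJ; rewrite mem_filter =>
    /andP[/asboolP].
  pose b1 := beta_map (fun x => (z j x, x)) p.
  pose b2 := beta_map (fun x => (z j x, y x)) p.
  have b1E : ultra_sets b1 (E_ (t + r)) by apply: filterS pS => x /zP[].
  have b2E : ultra_sets b2 (E_ (t + r + r)).
    apply: filterS pS => x /zP[zx _]; rewrite /E_ /=.
    by rewrite (le_trans (metric_triangle _ x _))// lerD.
  have b1s : gs b1 = p by apply: stone_cech_ext.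
  have b2s : gs b2 = gs (val g) by rewrite gE; apply: stone_cech_ext.
  have b2r : gr b2 = gr b1 by apply: stone_cech_ext.
  have [a ab1] : exists a : G, val a = b1.
    by apply: (reduction_ex b1E); rewrite b1s.
  have [b bb2] : exists b : G, val b = b2.
    by apply: (reduction_ex b2E); rewrite b2s.
  have abg : red_mul a g = b.
    by apply: (red_mulP boundedX); rewrite /red_r /red_s bb2 ?ab1.
  exists a => _; split.
  - by rewrite /red_s ab1.
  - by rewrite ab1; apply: filterS pS => x /zP[].
  have k1 : ultra_sets p [set x | `|k (z j x, x) - f a| < eta].
    by have := kf a; rewrite ab1.
  have k2 : ultra_sets p [set x | `|k (z j x, y x) - f b| < eta].
    by have := kf b; rewrite bb2.
  rewrite abg; apply: filterS (filterI k1 k2) => x [/= h1 h2].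
  have -> : k (z j x, x) - k (z j x, y x) =
    (f a - f b) + (k (z j x, x) - f a) - (k (z j x, y x) - f b) by ring.
  rewrite (le_trans (ler_normB _ _))// (le_trans (lerD (ler_normD _ _) (lexx
    _)))//.
  lra.
have uJ : uniq J by rewrite filter_uniq// iota_uniq.
have pJ : ultra_sets p [set x | forall j, j \in J ->
    S j x /\ `|k (z j x, x) - k (z j x, y x)| <=
             `|f (a j) - f (red_mul (a j) g)| + 2 * eta].
  apply: ultra_all => j jJ; apply: filterI; last by have [] := aP j jJ.
  by move: jJ; rewrite mem_filter => /andP[/asboolP].
(* By maximality of ultrafilters, a colour outside [J] is missing from the balls at [p]-almost all
   points. *)
have pnJ : ultra_sets p [set x | forall j, j \in iota 0 N -> S j x -> j \in J].
  apply: ultra_all => j jN; have [pS|/ultra_setC pS] := EM (ultra_sets p (S j)).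
    by apply: (filterS _ pS) => x _ _; rewrite mem_filter jN andbT asboolT.
  by apply: filterS pS => x nS Sx.
have [x [[Bx xJ] xnJ]] := ultra_ex (filterI (filterI pB pJ) pnJ).
apply: Bx => /=.
have cJ w : mdist w x <= t + r -> c w \in J.
  by move=> wx; apply: xnJ; [rewrite mem_iota/= add0n cN|exists w].
rewrite (@le_trans _ _ (\sum_(j <- J) `|k (z j x, x) - k (z j x, y x)|))//.
  have -> : \sum_(w <- ball_seq (t + r) x) `|k (w, x) - k (w, y x)| =
      \sum_(j <- [seq c w | w <- ball_seq (t + r) x])
         `|k (z j x, x) - k (z j x, y x)|.
    rewrite big_map; apply: eq_big_seq => w; rewrite mem_ball_seq// metric_sym
      => wx.
    by rewrite zE.
  apply: sum_uniq_le => //.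
    rewrite map_inj_in_uniq ?ball_seq_uniq// => u v.
    rewrite !mem_ball_seq// => xu xv cuv.
    by rewrite -(@zE x u) 1?metric_sym// cuv zE// metric_sym.
  by move=> _ /mapP[w + ->]; rewrite mem_ball_seq// metric_sym; exact: cJ.
rewrite (@le_trans _ _ (\sum_(j <- J) (`|f (a j) - f (red_mul (a j) g)| + 2 *
  eta)))//.
  rewrite big_seq [leRHS]big_seq; apply: ler_sum => j /xJ[_]; exact.
rewrite big_split/= sum_const_seq lerD//.
  rewrite -lee_fin (le_trans _ (ltW fd))//.
  rewrite -(big_map a xpredT (fun b => `|f b - f (red_mul b g)|)).
  apply: sum_le_esum => [|_ /mapP[j jJ ->]]; last by rewrite /= gp;
    have [] := aP j jJ.
  rewrite map_inj_in_uniq// => i j iJ jJ aij.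
  have [_ ai _] := aP i iJ; have [_ aj _] := aP j jJ; rewrite -aij in aj.
  by have [w [<- <-]] := ultra_ex (filterI ai aj).
rewrite -mulrA ler_wpM2l// mulrC ler_wpM2r ?(ltW eta0)// ler_nat.
by apply: (size_color (j := id) uJ) => // j; rewrite mem_filter mem_iota =>
  /andP[_].
Qed.

End approximation.

(** [Z] is the set of points where the discrete function has mass more than one half and varies
    little within distance [r]. Every ultrafilter outside [U_of D] contains [Z], so the ultrafilters
    containing its complement lie in [U_of D]. *)
Lemma property_A_kernel (r eps : R) :
  partial_property_A_towards (~` U_of D) -> 0 <= r -> 0 < eps ->
  exists (t : R) (h : X -> X -> R) (Z : set X),
    [/\ 0 <= t, beta_closure (~` Z) `<=` U_of D,
      forall x s, uniq s -> \sum_(z <- s) h x z ^+ 2 <= 1,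
      forall x z, h x z != 0 -> mdist x z <= t &
      forall x y, Z x -> Z y -> mdist x y <= r ->
        `|1 - \sum_(z <- ball_seq t x) h x z * h y z| <= eps].
Proof.
move=> propA r0 eps0.
(* With [N * eta <= e] the mass exceeds [1 - 2 * e >= 1/2] and the variation is at most [3 * e]. The
   difference of two normalized rows has squared norm at most [12 * e], twice the defect of their
   inner product, so that [6 * e <= eps] suffices. *)
pose e := Num.min (eps / 6) (1 / 4).
have e0 : 0 < e by rewrite lt_min !divr_gt0.
have e4 : e <= 1 / 4 by rewrite ge_min lexx orbT.
have e6 : e <= eps / 6 by rewrite ge_min lexx.
have [f [fcont fsupp f0 fP]] := propA e _ e0 (compact_E (D := D) (r := r)).
have [t t0 ft] := compact_support_scale fsupp.
have tr0 : 0 <= t + r by rewrite addr_ge0.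
have [N [c [cN cinj]]] := coloring boundedX (addr_ge0 tr0 tr0).
have N10 : 0 < N%:R + 1 :> R by rewrite ltr_wpDl.
pose eta := e / (N%:R + 1).
have eta0 : 0 < eta by rewrite divr_gt0.
have Neta : N%:R * eta <= e.
  by rewrite /eta mulrCA -[leRHS]mulr1 ler_pM2l// ler_pdivrMr// mul1r lerDl.
have [k [k0 kt kf]] := discrete_approximation fcont f0 fsupp ft eta0.
pose T := t + r.
pose n x := \sum_(z <- ball_seq T x) k (z, x).
(* The square root turns normalization in l^1 into normalization in l^2. Where the mass is 0,
   division by zero gives a zero row, whose norm is still at most one. *)
pose h x z := Num.sqrt (k (z, x) / n x).
pose Z := [set x | 1/2 < n x /\ forall y, mdist x y <= r ->
  \sum_(z <- ball_seq T x) `|k (z, x) - k (z, y)| <= 3 * e].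
have n0 x : 0 <= n x by apply: sumr_ge0.
have hX x z : h x z ^+ 2 = k (z, x) / n x by rewrite sqr_sqrtr// divr_ge0.
have kT z x : ~~ (mdist z x <= t) -> k (z, x) = 0.
  by apply: contraNeq => /kt.
exists T, h, Z; split=> //.
- move=> p /beta_closureP pZ; apply: contrapT => pU.
  suff : ultra_sets p Z by exact: (proj2 (ultra_setC _ _) pZ).
  have diag_r : ultra_sets (beta_map (fun x => (x, x)) p) (E_ r).
    suff : ultra_sets p [set x | E_ r (x, x)] by [].
    by apply: filterS filterT => x _; rewrite /E_ /= mdistxx.
  have pZ1 : ultra_sets p [set x | 1/2 < n x].
    have [g gE] : exists g : G, val g = beta_map (fun x => (x, x)) p.
      apply: (reduction_ex diag_r).
      suff -> : gs (beta_map (fun x => (x, x)) p) = p by [].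
      exact: stone_cech_ext.
    have [|+ _] := fP g; first by rewrite /= gE.
    have -> : red_r g = p by rewrite /red_r gE; apply: stone_cech_ext.
    move=> h1; have : ((1 - e)%:E < \esum_(a in [set a : G | red_s a = p]) (f
      a)%:E)%E.
      move: h1; case: (\esum_(a in _) _) => [s| |] //=.
      by rewrite !lte_fin ltr_norml => /andP[+ _]; rewrite ltrBrDr addrC.
    move/(fiber_mass r0 eta0 ft cN cinj k0 kf).
    by apply: filterS => x /=; apply: le_lt_trans; lra.
  have pZ2 : ultra_sets p [set x | forall y, mdist x y <= r ->
      \sum_(z <- ball_seq T x) `|k (z, x) - k (z, y)| <= 3 * e].
    (* [y x] is a neighbour violating the estimate whenever there is one. The estimate for all
       neighbours then follows from the one arrow defined by this map. *)
    have /(_ _)/cid-/all_sig[y yP] (x : X) : exists y, mdist x y <= r /\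
        (\sum_(z <- ball_seq T x) `|k (z, x) - k (z, y)| <= 3 * e ->
         forall y, mdist x y <= r ->
           \sum_(z <- ball_seq T x) `|k (z, x) - k (z, y)| <= 3 * e).
      have [[y [xy bad]]|good] := EM (exists y, mdist x y <= r /\
          ~ \sum_(z <- ball_seq T x) `|k (z, x) - k (z, y)| <= 3 * e).
        by exists y.
      exists x; split=> [|_ y xy]; first by rewrite mdistxx.
      by apply: contrapT => bad; apply: good; exists y.
    have yr x : mdist x (y x) <= r by have [] := yP x.
    have gr_ : ultra_sets (beta_map (fun x => (x, y x)) p) (E_ r).
      suff : ultra_sets p [set x | E_ r (x, y x)] by [].
      by apply: filterS filterT => x _; exact: yr.
    have [g gE] : exists g : G, val g = beta_map (fun x => (x, y x)) p.
      apply: (reduction_ex gr_) => gsU; apply: pU.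
      have := U_of_invariant boundedX rdD gr_ gsU.
      suff -> : gr (beta_map (fun x => (x, y x)) p) = p by [].
      exact: stone_cech_ext.
    have [|_ fg] := fP g; first by rewrite /= gE.
    have := fiber_variation eta0 cN cinj kf yr gE fg.
    apply: filterS => x /= xy; have [_] := yP x; apply.
    by rewrite (le_trans xy)//; lra.
  exact: filterI.
- move=> x s us; under eq_bigr => z _ do rewrite hX.
  rewrite -mulr_suml.
  have sn : \sum_(z <- s) k (z, x) <= n x.
    rewrite (@le_trans _ _ (\sum_(z <- s | z \in ball_seq T x) k (z, x)))//.
      rewrite [leRHS]big_mkcond; apply: ler_sum => z _.
      rewrite mem_ball_seq//; case: ifPn => // xz; rewrite kT//.
      by apply: contra xz => zx; rewrite metric_sym (le_trans zx)// lerDl.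
    rewrite -big_filter; apply: sum_uniq_le => //; first exact: filter_uniq.
      exact: ball_seq_uniq.
    by move=> z; rewrite mem_filter => /andP[].
  have [->|nx] := eqVneq (n x) 0; first by rewrite invr0 mulr0.
  by rewrite ler_pdivrMr ?mul1r// lt_neqAle eq_sym nx n0.
- move=> x z; apply: contraNT => xz; rewrite /h kT ?mul0r ?sqrtr0//.
  by apply: contra xz => zx; rewrite metric_sym (le_trans zx)// lerDl.
move=> x y [nx xvar] [ny _] xy.
have nx0 : 0 < n x by rewrite (lt_trans _ nx).
have ny0 : 0 < n y by rewrite (lt_trans _ ny).
(* The ball of radius [t + r] at [x] contains all [z] with [k (z, w)] nonzero when [w] is within [r]
   of [x], so both masses can be computed over the same index set. *)
have nE w : mdist x w <= r -> n w = \sum_(z <- ball_seq T x) k (z, w).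
  move=> xw; rewrite /n.
  have kt' v : k (v, w) != 0 -> mdist w v <= t.
    by move=> /kt; rewrite metric_sym.
  pose s := [seq v <- ball_seq T w | k (v, w) != 0].
  rewrite (@sum_uniq_sub _ _ s) ?ball_seq_uniq ?filter_uniq ?ball_seq_uniq//.
  - rewrite [RHS](@sum_uniq_sub _ _ s) ?ball_seq_uniq ?filter_uniq
    ?ball_seq_uniq//.
      move=> v; rewrite mem_filter !mem_ball_seq// => /andP[/kt' wv _].
      by rewrite (le_trans (metric_triangle _ w _))// addrC lerD.
    move=> v _; rewrite mem_filter mem_ball_seq//; apply: contraNeq => kv.
    by rewrite kv /= (le_trans (kt' _ kv))// lerDl.
  - by move=> v; rewrite mem_filter => /andP[].
  - by move=> v vw; rewrite mem_filter vw andbT; apply: contraNeq.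
have sumh w : mdist x w <= r -> 0 < n w -> \sum_(z <- ball_seq T x) h w z ^+ 2
  = 1.
  move=> xw nw; under eq_bigr => z _ do rewrite hX.
  by rewrite -mulr_suml -nE// divff// gt_eqF.
have hx1 : \sum_(z <- ball_seq T x) h x z ^+ 2 = 1 by rewrite sumh// mdistxx.
have hy1 := sumh y xy ny0.
have e1 : 2 * (1 - \sum_(z <- ball_seq T x) h x z * h y z) =
    \sum_(z <- ball_seq T x) (h x z - h y z) ^+ 2.
  under [RHS]eq_bigr => z _ do rewrite sqrrB.
  rewrite big_split/= sumrB hx1 hy1 sumrMnl -mulr_natl; ring.
have var := xvar y xy.
have nvar : `|n x - n y| <= 3 * e.
  rewrite nE ?mdistxx// (nE y)// -sumrB (le_trans (ler_norm_sum _ _ _))//.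
have e2 : \sum_(z <- ball_seq T x) (h x z - h y z) ^+ 2 <= 12 * e.
  have sqd (a b : R) : 0 <= a -> 0 <= b -> (a - b) ^+ 2 <= `|a ^+ 2 - b ^+ 2|.
    move=> a0 b0; rewrite subr_sqr normrM -real_normK ?num_real// expr2.
    rewrite ler_wpM2l// [leRHS]ger0_norm ?addr_ge0// (le_trans (ler_normB _
      _))//.
    by rewrite !ger0_norm.
  have p1 z : (h x z - h y z) ^+ 2 <= (`|k (z, x) - k (z, y)| +
      k (z, y) / n y * `|n x - n y|) / n x.
    rewrite (le_trans (sqd _ _ (sqrtr_ge0 _) (sqrtr_ge0 _)))// !hX.
    have -> : k (z, x) / n x - k (z, y) / n y =
        (k (z, x) - k (z, y) - k (z, y) / n y * (n x - n y)) / n x.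
      by field; rewrite !gt_eqF.
    rewrite normrM [X in _ * X]ger0_norm ?invr_ge0// ler_wpM2r ?invr_ge0//.
    rewrite (le_trans (ler_normB _ _))// normrM.
    by rewrite [X in _ + X * _]ger0_norm// divr_ge0.
  rewrite (le_trans (ler_sum _ (fun z _ => p1 z)))// -mulr_suml big_split/=.
  rewrite -!mulr_suml -(nE y)// divff ?gt_eqF// mul1r ler_pdivrMr//.
  have : 12 * e * (1 / 2) <= 12 * e * n x by rewrite ler_wpM2l ?(ltW nx)//; lra.
  lra.
rewrite ger0_norm; last first.
  by rewrite -(pmulr_rge0 _ (ltr0n R 2)) e1; apply: sumr_ge0 => z _;
    exact: sqr_ge0.
lra.
Qed.

End kernel.

(** * The two ideals *)

Section hilbert_operators.
Local Open Scope complex_scope.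
Context {R : realType} {H : hilbertType R}.
Implicit Types (S : H -> H).

Lemma fproj_rnorm_le (P : fproj H) v : rnorm (P v) <= rnorm v.
Proof. by rewrite -lecR !rnormE fproj_contraction. Qed.

Lemma fproj_compl_rnorm_le (P : fproj H) v : rnorm (P v - v) <= rnorm v.
Proof.
rewrite -(@ler_pXn2r _ 2) ?nnegrE ?rnorm_ge0//.
have -> : rnorm v ^+ 2 = rnorm (v - P v) ^+ 2 + rnorm (P v) ^+ 2.
  rewrite -pythagoras ?subrK// linearBl/= -(fproj_idem P v) -fproj_adj.
  by rewrite !fproj_idem -fproj_adj fproj_idem subrr.
by rewrite rnorm_distC lerDl sqr_ge0.
Qed.

Lemma fproj_family (I : eqType) (s : seq I) (S : I -> H -> H) :
  (forall i, finite_rank (S i)) -> exists P : fproj H,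
    (forall i v, i \in s -> P (S i v) = S i v) /\
    (rank P <= \sum_(i <- s) rank (S i))%N.
Proof.
move=> Sfin; elim: s => [|i s [P [PS rP]]].
  have [P P0] := @fproj0_subproof R H; exists P; split=> //.
  by rewrite big_nil (_ : (P : H -> H) = fun=> 0) ?rank0//; apply/funext.
have [e _ eS] := rankP (Sfin i).
have [Q [Qe PQ rQ]] := fproj_add P e.
exists Q; split=> [j v|]; last by rewrite big_cons addnC (leq_trans rQ)//
  leq_add2r.
rewrite in_cons => /orP[/eqP ->|js]; last by
  apply/range_fproj/PQ/range_fproj/PS.
have : range (S i) (S i v) by exists v.
rewrite eS => -[c _ <-]; rewrite linear_sum; apply: eq_bigr => k _.
by rewrite linearZ/= Qe.
Qed.

Lemma totally_bounded_image (L : H -> H) (b : R) (A : set H) : linear L ->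
  bounded_by L b -> totally_bounded A -> totally_bounded (L @` A).
Proof.
move=> Llin Lb Atb e e0.
have b0 : 0 < `|b| + 1 by rewrite ltr_wpDl.
have [s sA] := Atb _ (divr_gt0 e0 b0); exists [seq L c | c <- s].
move=> _ [v /sA[c cs vc] <-]; exists (L c); first exact: map_f.
rewrite -linear_funB// (le_lt_trans (bounded_byW (_ : b <= `|b| + 1) Lb _))//.
  by rewrite (le_trans (ler_norm b))// lerDl.
by rewrite mulrC -ltr_pdivlMr.
Qed.

Lemma totally_bounded_approx S :
  (forall e : R, 0 < e -> exists2 S',
    totally_bounded (S' @` [set v | rnorm v <= 1]) &
    bounded_by (fun v => S v - S' v) e) ->
  totally_bounded (S @` [set v | rnorm v <= 1]).
Proof.
move=> appr e e0; have e20 : 0 < e / 2 by rewrite divr_gt0.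
have [S' S'tb SS'] := appr _ e20; have [s sS'] := S'tb _ e20.
exists s => _ [v /= v1 <-]; have [|c cs vc] := sS' (S' v); first by exists v.
exists c => //; rewrite (_ : S v - c = (S v - S' v) + (S' v - c)).
  rewrite (le_lt_trans (ler_rnormD _ _))// (splitr e) ler_ltD//.
  by rewrite (le_trans (SS' v))// ler_piMr// ltW.
by rewrite addrA subrK.
Qed.

Hypothesis infH : infinite_dimensional H.

(** The factorization through [S] gives linearity of the truncation and total boundedness of its
    image of the unit ball; the crude bound on [L] is enough for that. *)
Lemma truncation_spec (d c : R) S : 0 < d -> linear S -> bounded_by S c ->
  totally_bounded (S @` [set v | rnorm v <= 1]) ->
  [/\ finite_rank (truncation d S), bounded_by (fun v =>
    S v - truncation d S v) d &
    exists (L : H -> H) (b : R), [/\ linear L, bounded_by L b &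
      truncation d S = L \o S]].
Proof.
move=> d0 Slin Sc Stb; have trS := truncationP infH d Slin Sc Stb.
split; first exact: truncation_finite_rank trS.
  by have [n [lam [u [v []]]]] := is_truncationP d0 Slin trS.
have [n [lam [u [v [_ uon _ -> _]]]]] := is_truncationP d0 Slin trS.
exists (fun w => \sum_(i < n) inner w (u i) *: u i), n%:R; split=> //.
  move=> a x y; rewrite scaler_sumr -big_split/=; apply: eq_bigr => i _.
  by rewrite innerDl innerZl scalerDl scalerA.
move=> w; rewrite (le_trans (ler_rnorm_sum _ _ _))//.
have u1 i : rnorm (u i) = 1.
  apply/eqP; rewrite -(@eqrXn2 _ 2) ?rnorm_ge0// expr1n.
  by apply/eqP/complexI; rewrite rnormX uon eqxx.
rewrite (@le_trans _ _ (\sum_(i < n) rnorm w))//.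
  apply: ler_sum => i _; rewrite rnormZ -/(cabs _) u1 mulr1.
  by rewrite (le_trans (cauchy_schwarz _ _))// u1 mulr1.
by rewrite sumr_const card_ord mulr_natl.
Qed.

Lemma unit_vector_ex : exists v : H, v != 0.
Proof.
have [|v _ v1] := @orthogonal_unit _ _ infH 0 (fun=> 0); first by [].
by exists v; exact: rnorm1_neq0.
Qed.

End hilbert_operators.

(** * Row maxima and diagonal rank functions *)

Section diagonal.
Local Open Scope complex_scope.
Context {R : realType} {X : metricType R}.
Hypothesis boundedX : bounded_geometry X.
Variable D : set (X -> X -> nat).
Hypothesis rdD : rank_distribution D.

Definition diagonal_rank (n : X -> nat) (x y : X) : nat := if x == y then n x
  else 0%N.

Lemma diagonal_rank_function n : rank_function (diagonal_rank n).
Proof.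
exists 0 => x y /=; rewrite /rank_supp /= /diagonal_rank.
by case: (eqVneq x y) => [-> _|_]; rewrite ?mdistxx.
Qed.

Lemma leq_ent_mulr (alpha : X -> X -> nat) (r : R) (x y w : X) : mdist w y <= r
  ->
  (alpha x w <= ent_mulr alpha (E_ r) x y)%N.
Proof.
move=> wy; apply: (leq_fsum (A := [set z | E_ r (z, y)]) (alpha x)) => //.
exact: (finite_entourage_col boundedX y (E_entourage r)).
Qed.

Lemma diagonal_row_bound alpha n (r : R) : D alpha ->
  (forall x, (n x <= ent_mulr alpha (E_ r) x x)%N) -> D (diagonal_rank n).
Proof.
move=> Da nle.
apply: (rd_le rdD (diagonal_rank_function n) (rd_mulr rdD (E_entourage r) Da)).
by move=> x y; rewrite /diagonal_rank; case: (eqVneq x y) => // <-.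
Qed.

Lemma row_maxE alpha x (s : seq X) : uniq s ->
  (forall y, alpha x y != 0%N -> y \in s) ->
  row_max alpha x = \max_(y <- s) alpha x y.
Proof.
move=> us as_; rewrite /row_max -(@fsbig_widen _ _ _ _ [set` s])//.
  by rewrite -fsbig_seq.
by move=> y [_ /= ys]; apply/eqP; apply: contra_notT ys => /as_.
Qed.

(** Trades row maxima for diagonal rank functions, on which the sum and order axioms act directly. A
    maximum over a row is at most the sum over that row, which is a diagonal value of
    [ent_mulr alpha (E_ r)]. *)
Lemma row_maximaP n : row_maxima D n <-> D (diagonal_rank n).
Proof.
split=> [[alpha Da <-]|Dn].
  have [r ra] := rd_rank_function rdD Da.
  have ar x y : alpha x y != 0%N -> mdist y x <= r.
    by move=> xy; rewrite metric_sym; exact: ra.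
  apply: (diagonal_row_bound (r := r) Da) => x.
  rewrite (@row_maxE _ _ (ball_seq r x)) ?ball_seq_uniq//; last first.
    by move=> y ay; rewrite mem_ball_seq// metric_sym ar.
  rewrite big_seq; elim/big_ind: _ => // [a b ha hb|y];
    first by rewrite geq_max ha.
  by rewrite mem_ball_seq// metric_sym; exact: leq_ent_mulr.
exists (diagonal_rank n) => //; apply/funext => x.
rewrite (@row_maxE _ _ [:: x])//.
  by rewrite big_seq1 /diagonal_rank eqxx.
by move=> y; rewrite /diagonal_rank inE eq_sym; case: (eqVneq y x).
Qed.

End diagonal.

(** * Inclusions between the ideals and approximation by projections *)

Section ideals.
Local Open Scope complex_scope.
Context {R : realType} {X : metricType R} {H : hilbertType R}.
Hypothesis boundedX : bounded_geometry X.
Variable D : set (X -> X -> nat).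
Hypothesis rdD : rank_distribution D.
Local Notation operator := {linear l2 X H -> l2 X H}.

Definition finite_rank_roe : set operator :=
  [set T : operator | [/\ algebraic_roe T,
    forall x y, finite_rank (entry T x y) &
    D (fun x y => rank (entry T x y))]].

Lemma finite_rank_roe_continuous (S : operator) : finite_rank_roe S ->
  continuous S.
Proof. by move=> [[]]. Qed.

Lemma entry_sub_bounded_by (T S : operator) c x y : 0 <= c ->
  bounded_by (fun f => T f - S f) c ->
  bounded_by (fun v => entry T x y v - entry S x y v) c.
Proof.
move=> c0 TS v; apply: le_trans (l2_coord_le (T _ - S _) x) _.
by rewrite (le_trans (TS _))// ler_wpM2l// rnorm_l2_delta.
Qed.

Lemma I_ideal_sub_tilde : I_ideal H D `<=` I_tilde H D.
Proof.
move=> T TI; have [Tc AT] := TI; split.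
  split=> // e e0; have [S [Sroe _ _] TS] := AT e e0; by exists S.
(* Half of [e], because the rank comparison needs a distance strictly below the truncation
   threshold. *)
move=> e e0; have e20 : 0 < e / 2 by rewrite divr_gt0.
have [S [[_ _ [r Sr]] Sfin DS] TS] :=
  norm_closure_approx finite_rank_roe_continuous TI e20.
have rle x y : (rank (truncation e (entry T x y)) <= rank (entry S x y))%N.
  apply: (@rank_truncation_le _ _ _ (e / 2)) => //; try exact: entry_linear.
    by rewrite ltr_pdivrMr//; lra.
  exact: entry_sub_bounded_by (ltW e20) TS.
apply: (rd_le rdD _ DS rle); exists r => x y /= rxy; apply: Sr => /= Sxy.
move: rxy; rewrite /rank_supp /= -lt0n => /leq_trans/(_ (rle x y)).
by rewrite Sxy rank0.
Qed.

Lemma Lambda_approximation_of_eq :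
  I_ideal H D = I_tilde H D -> Lambda_approximation H D.
Proof.
move=> IE T e Y TI e0 _; rewrite -IE in TI.
have e20 : 0 < e / 2 by rewrite divr_gt0.
have [S [[Sc _ [r Sr]] Sfin DS] TS] :=
  norm_closure_approx finite_rank_roe_continuous TI e20.
have [c c0 Sb] := continuous_bounded_by Sc.
pose s x : seq X := finmap.enum_fset (fset_set [set z | E_ r (z, x)]).
have /(_ _)/cid-/all_sig[phi0 phi0P] x := fproj_family (s x) (Sfin x).
exists phi0.
  apply/(row_maximaP boundedX rdD).
  (* The rank of [phi0 x] is at most the sum of the ranks in row [x] of [S], a diagonal value of the
     rank function of [S] multiplied on the right by [E_ r]. *)
  apply: (diagonal_row_bound rdD (r := r) DS) => x.
  rewrite /ent_mulr fsbig_finite//=; first by have [] := phi0P x.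
  exact: (finite_entourage_col boundedX x (E_entourage r)).
move=> phi Gphi phi0phi.
have phiS x f : phi x (S f x) = S f x.
  have phi1 : bounded_by (phi x) 1.
    by move=> v; rewrite mul1r fproj_rnorm_le.
  apply/esym/(row_ext Sb Sb phi1) => y v; apply/esym/range_fproj/phi0phi.
  apply/range_fproj.
  have [yx|yx] := boolP (y \in s x); first by have [-> //] := phi0P x.
  suff -> : entry S x y = fun=> 0 by rewrite linear0.
  apply: contrapT => Sxy; move/negP: yx; apply.
  rewrite in_fset_set; last exact: (finite_entourage_col boundedX x
    (E_entourage r)).
  by rewrite inE /E_ /= metric_sym; exact: Sr.
rewrite (@le_lt_trans _ _ (e / 2))//; last by rewrite ltr_pdivrMr//; lra.
apply: opnorm_le => [|f]; first exact: ltW.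
rewrite (le_trans _ (TS f))//; apply: l2_rnorm_mono => x.
set w := T f x; set u := S f x.
have -> : (T f - S f : l2 X H) x = w - u by [].
have -> : (Lambda phi (chi Y (T f)) - chi (fproj_supp phi `&` Y) (T f) : l2 X
  H) x =
  phi x (if x \in Y then w else 0) - (if x \in fproj_supp phi `&` Y then w else
    0).
  by [].
rewrite in_setI; case: (x \in Y); rewrite ?andbF ?andbT; last first.
  by rewrite linear0 subr0 rnorm0 rnorm_ge0.
case: ifPn => [_|/negP supp].
  (* As [phi x] fixes [u], the complementary projection, a contraction, sees only [w - u]. *)
  rewrite (_ : phi x w - w = phi x (w - u) - (w - u));
    first exact: fproj_compl_rnorm_le.
  have phiu : phi x u = u by exact: phiS.
  by rewrite linearB/= phiu opprB addrA subrK.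
have -> : phi x w = 0.
  have -> // : (phi x : H -> H) = fun=> 0.
  by apply: contrapT => h; apply: supp; rewrite inE.
by rewrite subr0 rnorm0 rnorm_ge0.
Qed.

(** Each error term is bounded globally but matters only in some rows. Pointwise domination by all
    of them treats both kinds of rows in one norm estimate; Cauchy-Schwarz over [gs] gives the
    factor. *)
Lemma l2_dominated (f : l2 X H) (gs : seq (l2 X H)) (b : R) : 0 <= b ->
  (forall g, g \in gs -> rnorm g <= b) ->
  (forall x, rnorm (f x) <= \sum_(g <- gs) rnorm (g x)) ->
  rnorm f <= (size gs)%:R * b.
Proof.
move=> b0 gb fg; apply: l2_rnorm_le => [|s us]; first by rewrite mulr_ge0.
have f1 x : rnorm (f x) ^+ 2 <= (size gs)%:R * \sum_(g <- gs) rnorm (g x) ^+ 2.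
  rewrite (@le_trans _ _ ((\sum_(g <- gs) 1 * rnorm (g x)) ^+ 2))//.
    under eq_bigr => g _ do rewrite mul1r.
    by rewrite ler_pXn2r ?nnegrE ?rnorm_ge0// sumr_ge0// => g _;
      exact: rnorm_ge0.
  rewrite (le_trans (sum_cauchy_schwarz _ _ _))//.
  by under eq_bigr => g _ do rewrite expr1n; rewrite sum_const_seq mul1r.
rewrite (le_trans (ler_sum _ (fun x _ => f1 x)))// -mulr_sumr exchange_big/=.
rewrite exprMn [X in _ <= X * _]expr2 -mulrA ler_wpM2l// mulrC -(sum_const_seq
  gs).
rewrite big_seq [leRHS]big_seq; apply: ler_sum => g ggs.
by rewrite (le_trans (l2_sum_le g us))// ler_pXn2r ?nnegrE ?rnorm_ge0// gb.
Qed.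

Hypothesis infH : infinite_dimensional H.

Lemma entry_totally_bounded (T : operator) x y : roe T ->
  totally_bounded (entry T x y @` [set v | rnorm v <= 1]).
Proof.
move=> Troe; apply: totally_bounded_approx => e e0.
have Rcont (S : operator) : algebraic_roe S -> continuous S by case.
have [S [_ Slc _] TS] := norm_closure_approx Rcont Troe e0.
exists (entry S x y); first by apply/compact_operatorP; exact: Slc.
exact: entry_sub_bounded_by (ltW e0) TS.
Qed.

(** A fixed nonzero vector is added to the ranges over [Y]. The rank grows by at most one, and only
    on the row support of some [alpha] in [D] covering [Y]. *)
Lemma supported_Gamma (phi0 : X -> fproj H) (Y : set X) :
  Gamma D phi0 -> beta_closure Y `<=` U_of D ->
  exists phi, [/\ Gamma D phi, Gamma_le phi0 phi & Y `<=` fproj_supp phi].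
Proof.
move=> /(row_maximaP boundedX rdD) Dphi0 /(sub_U_of rdD)[alpha Da Ya].
have [v v0] := unit_vector_ex infH.
have /(_ _)/cid-/all_sig[phi phiP] x : exists P : fproj H,
    [/\ range (phi0 x) `<=` range P, Y x -> P v = v &
        (rank P <= rank (phi0 x) + (x \in row_supp alpha))%N].
  have [Yx|nYx] := EM (Y x); last by exists (phi0 x); split=> //;
    exact: leq_addr.
  have [P [Pv P0 rP]] := fproj_add1 (phi0 x) v.
  by exists P; split=> //; rewrite (mem_set (Ya x Yx)) addn1.
exists phi; split; last 2 first.
- by move=> x; have [] := phiP x.
- move=> x Yx; have [_ /(_ Yx) Pv _] := phiP x.
  rewrite /fproj_supp /= => phix0; move/eqP: v0; apply.
  by rewrite -Pv phix0.
apply/(row_maximaP boundedX rdD).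
have [r ar] := rd_rank_function rdD Da.
have Dalpha : D (diagonal_rank (fun x => nat_of_bool (x \in row_supp alpha))).
  apply: (diagonal_row_bound rdD (r := r) Da) => x.
  case: (boolP (x \in _)) => //; rewrite inE => -[[x' w] /= xw xE].
  rewrite /= in xE; subst x'.
  apply: leq_trans (leq_ent_mulr boundedX alpha x (_ : mdist w x <= r)).
    by rewrite lt0n.
  by rewrite metric_sym; exact: ar.
apply: (rd_le rdD _ (rd_add rdD Dphi0 Dalpha));
  first exact: diagonal_rank_function.
move=> x y; rewrite /diagonal_rank; case: (eqVneq x y) => // _.
by have [] := phiP x.
Qed.

Lemma kernel_le1 (h : X -> X -> R) (s : seq X) x y : uniq s ->
  (forall x s, uniq s -> \sum_(z <- s) h x z ^+ 2 <= 1) ->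
  `|\sum_(z <- s) h x z * h y z| <= 1.
Proof.
move=> us h1; rewrite -(@ler_pXn2r _ 2) ?nnegrE// expr1n real_normK ?num_real//.
rewrite (le_trans (sum_cauchy_schwarz _ _ _))// -[leRHS]mulr1.
by rewrite ler_pM ?h1//; apply: sumr_ge0 => z _; exact: sqr_ge0.
Qed.

Lemma I_tilde_sub_ideal : partial_property_A_towards (~` U_of D) ->
  Lambda_approximation H D -> I_tilde H D `<=` I_ideal H D.
Proof.
move=> propA LA T TI; have [Troe Trank] := TI; have [Tcont _] := Troe.
apply: norm_closureI => // e e0.
(* One fifth for each of the terms [F], [T - T0], [D0], [B] and [C] below. *)
pose e1 := e / 5; have e10 : 0 < e1 by rewrite divr_gt0.
have Rcont (S : operator) : algebraic_roe S -> continuous S by case.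
have [T0 [T0cont T0lc [r' T0r']] TT0] := norm_closure_approx Rcont Troe e10.
have [c c0 Tc] := continuous_bounded_by Tcont.
have [d d0 T0d] := continuous_bounded_by T0cont.
pose r : R := `|r'|; have r0 : 0 <= r by exact: normr_ge0.
have T0r x y : ~~ (mdist x y <= r) -> entry T0 x y = fun=> 0.
  move=> xy; apply: contrapT => T0xy; move/negP: xy; apply.
  exact: le_trans (T0r' x y T0xy) (ler_norm _).
have [N1 N1P] := size_ball_seq boundedX r.
have dN0 : 0 < d * N1%:R + 1 by rewrite ltr_wpDl// mulr_ge0.
(* Accuracy of the kernel: the entries of [(1 - a) T0] are at most [k * d], and a row or column of
   [T0] has at most [N1] of them. *)
pose k := e1 / (d * N1%:R + 1); have k0 : 0 < k by rewrite divr_gt0.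
have kdN : k * d * N1%:R <= e1.
  by rewrite -mulrA /k mulrAC ler_pdivrMr// ler_pM2l// lerDl.
have [t [h [Z [t0 ZU h1 ht hZ]]]] := property_A_kernel boundedX rdD propA r0 k0.
pose a x y : R := \sum_(z <- ball_seq t x) h x z * h y z.
have a1 x y : `|a x y| <= 1 by rewrite kernel_le1// ball_seq_uniq.
have at_ x y : ~~ (mdist x y <= t + t) -> a x y = 0.
  move=> xy; rewrite /a big1_seq// => z /andP[_]; rewrite mem_ball_seq// => xz.
  suff -> : h y z = 0 by rewrite mulr0.
  apply/eqP; apply: contraNT xy => /ht yz.
  by rewrite (le_trans (metric_triangle _ z _))// lerD// metric_sym.
have [N2 N2P] := size_ball_seq boundedX (t + t).
have N20 : 0 < N2%:R + 1 :> R by rewrite ltr_wpDl.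
(* Truncation threshold, small against the number [N2] of entries in a row of the kernel's band. *)
pose del := e1 / (N2%:R + 1); have del0 : 0 < del by rewrite divr_gt0.
have delN : del * N2%:R <= e1.
  by rewrite /del mulrAC ler_pdivrMr// ler_pM2l// lerDl.
(* Outside [Y], every nonzero entry of a row of [T0] joins two points of [Z], where [a] is close to
   one. *)
pose Y := [set x | exists2 y, (~` Z) y & mdist x y <= r].
have YU : beta_closure Y `<=` U_of D := neighbourhood_U_of boundedX rdD ZU.
have nYZ x y : ~ Y x -> mdist x y <= r -> Z y.
  by move=> nYx xy; apply: contrapT => nZy; apply: nYx; exists y.
have [phi0 Gphi0 phi0P] := LA T e1 Y TI e10 YU.
have [phi [Gphi phi0phi Yphi]] := supported_Gamma Gphi0 YU.
have phi1 x : bounded_by (phi x) 1 by move=> v; rewrite mul1r fproj_rnorm_le.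
pose tr x y := truncation del (entry T x y).
have Tlin x y : linear (entry T x y) by exact: entry_linear.
have T0lin x y : linear (entry T0 x y) by exact: entry_linear.
have Tb x y : bounded_by (entry T x y) c by exact: entry_bounded_by.
have trP x y := truncation_spec infH del0 (Tlin x y) (Tb x y)
  (entry_totally_bounded x y Troe).
have trlin x y : linear (tr x y).
  rewrite /tr; have [_ _ [L [b [Llin _ ->]]]] := trP x y.
  by move=> b' u v; rewrite /= Tlin Llin.
pose m x y v := if x \in Y then phi x (entry T0 x y v) else (a x y)%:C *: tr x
  y v.
have T0b x y : bounded_by (entry T0 x y) d by exact: entry_bounded_by.
have aZ x y v : rnorm ((a x y)%:C *: v : H) <= rnorm v.
  by rewrite rnormZr ler_piMl// rnorm_ge0.
have [S [Sb SE]] : exists S : operator,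
    (exists b, bounded_by S b) /\ forall x y, entry S x y = m x y.
  have [N NP] := size_ball_seq boundedX (r + (t + t)).
  have [||||S [Sb SE]] := @matrix_operator R X H boundedX m (d + (c + del))
    (r + (t + t)) N _ NP.
  - by rewrite !addr_ge0// ltW.
  - move=> x y b u v; rewrite /m; case: (x \in Y).
      by rewrite T0lin linearP.
    by rewrite trlin scalerDr !scalerA mulrC.
  - move=> x y v; rewrite /m; case: (x \in Y).
      rewrite (le_trans (fproj_rnorm_le _ _))// (le_trans (T0b x y v))//.
      by rewrite ler_wpM2r ?rnorm_ge0// lerDl addr_ge0// ltW.
    rewrite (le_trans (aZ _ _ _))//.
    have [_ /(_ v) tr1 _] := trP x y.
    rewrite (_ : tr x y v = entry T x y v - (entry T x y v - tr x y v)).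
      rewrite (le_trans (ler_rnormD _ _))// rnormN mulrDl ler_wpDl//.
        by rewrite mulr_ge0 ?rnorm_ge0.
      by rewrite mulrDl lerD// Tb.
    by rewrite opprB addrC subrK.
  - move=> x y xy; apply/funext => v; rewrite /m; case: (x \in Y).
      rewrite T0r ?linear0//; apply: contra xy => xy.
      by rewrite (le_trans xy)// lerDl addr_ge0.
    rewrite at_ ?scale0r//; apply: contra xy => xy.
    by rewrite (le_trans xy)// lerDr.
  by exists S; split=> //; exists ((d + (c + del)) * N%:R).
have [b Sb'] := Sb.
have Sprop x y : entry S x y <> (fun=> 0) -> mdist x y <= r + (t + t).
  move=> Sxy; apply: contrapT => /negP xy; apply: Sxy; rewrite SE.
  apply/funext => v; rewrite /m; case: (x \in Y).
    rewrite T0r ?linear0//; apply: contra xy => xy.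
    by rewrite (le_trans xy)// lerDl addr_ge0.
  rewrite at_ ?scale0r//; apply: contra xy => xy.
  by rewrite (le_trans xy)// lerDr.
have Srank x y : finite_rank (entry S x y) /\
    (rank (entry S x y) <= if x \in Y then rank (phi x) else rank (tr x y))%N.
  have Slin : linear (entry S x y) by exact: entry_linear.
  rewrite SE in Slin *; case: ifPn => xY.
    apply: (rank_leS Slin (fproj_finite _)) => _ [v _ <-].
    by rewrite /m xY; exists (entry T0 x y v).
  have [trfin _ _] := trP x y; apply: (rank_leS Slin trfin) => _ [v _ <-].
  rewrite /m (negbTE xY); exists ((a x y)%:C *: v) => //.
  exact: (linear_funZ _ _ (trlin x y)).
exists S.
  split; last 2 first.
  - by move=> x y; have [] := Srank x y.
  - have Dphi := (row_maximaP boundedX rdD _).1 Gphi.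
    have Dphi' := rd_mulr rdD (E_entourage (r + (t + t))) Dphi.
    apply: (rd_le rdD _ (rd_add rdD Dphi' (Trank del del0))).
      exists (r + (t + t)) => x y; rewrite /rank_supp /= => rxy.
      by apply: Sprop => Sxy; move: rxy; rewrite Sxy rank0.
    move=> x y; have [Sxy|Sxy] := EM (entry S x y = fun=> 0).
      by rewrite Sxy rank0.
    have [_] := Srank x y; case: (x \in Y) => /leq_trans; apply.
      apply: leq_trans (leq_addr _ _).
      have := leq_ent_mulr boundedX (diagonal_rank (fun x => rank (phi x))) x
        (Sprop x y Sxy).
      by rewrite /diagonal_rank eqxx.
    exact: leq_addl.
  split.
  - exact: bounded_by_continuous Sb'.
  - move=> x y; apply/compact_operatorP; rewrite SE.
    have [xY|xY] := boolP (x \in Y).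
      have -> : m x y @` [set v | rnorm v <= 1] =
          phi x @` (entry T0 x y @` [set v | rnorm v <= 1]).
        by rewrite image_comp; apply: eq_imagel => v _; rewrite /m xY.
      apply: (totally_bounded_image _ (phi1 x)); first by move=> ? ? ?;
        rewrite linearP.
      by apply/compact_operatorP; exact: T0lc.
    have [_ _ [L [b' [Llin Lb trE]]]] := trP x y.
    have -> : m x y @` [set v | rnorm v <= 1] =
        (fun v => (a x y)%:C *: L v) @` (entry T x y @` [set v | rnorm v <= 1]).
      by rewrite image_comp; apply: eq_imagel => v _;
        rewrite /m (negbTE xY) /tr trE.
    apply: (totally_bounded_image (b := b')); last exact: entry_totally_bounded.
      by move=> u v w; rewrite Llin scalerDr !scalerA mulrC.
    by move=> v; rewrite (le_trans (aZ _ _ _)).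
  - by exists (r + (t + t)) => x y /=; exact: Sprop.
have [D0 [D0b D0E]] : exists D0 : operator, bounded_by D0 e1 /\
    forall x y, entry D0 x y = fun v =>
      if x \in Y then 0 else (1 - a x y)%:C *: entry T0 x y v.
  have kd0 : 0 <= k * d by rewrite mulr_ge0// ltW.
  have [|||D0 [D0b D0E]] := @matrix_operator R X H boundedX (fun x y v =>
      if x \in Y then 0 else (1 - a x y)%:C *: entry T0 x y v) (k * d) r N1 kd0
        N1P.
  - move=> x y u v w; case: (x \in Y); first by rewrite scaler0 addr0.
    by rewrite T0lin scalerDr !scalerA mulrC.
  - move=> x y v; case: ifPn => xY.
      by rewrite rnorm0 mulr_ge0 ?rnorm_ge0.
    have [xy|xy] := boolP (mdist x y <= r); last first.
      by rewrite T0r// scaler0 rnorm0 mulr_ge0 ?rnorm_ge0.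
    have nYx : ~ Y x by move=> Yx; move/negP: xY; apply; rewrite inE.
    rewrite rnormZr -mulrA ler_pM ?rnorm_ge0//.
      apply: hZ => //; last exact: nYZ xy.
      by apply: (nYZ _ _ nYx); rewrite mdistxx.
    exact: T0b.
  - by move=> x y xy; apply/funext => v; rewrite T0r// scaler0 if_same.
  by exists D0; split=> //; exact: bounded_byW D0b.
have Tdiff : bounded_by (T0 \- T : operator) e1.
  by move=> f; rewrite /= rnorm_distC.
(* The matrix bound would be [e1 * N2], too large; it only provides the existence of [B], and the
   Schur estimate then gives [e1]. *)
have [B [Bb BE]] : exists B : operator, bounded_by B e1 /\
    forall x y, entry B x y = fun v =>
      (a x y)%:C *: (entry T0 x y v - entry T x y v).
  have [|||B [Bb BE]] := @matrix_operator R X H boundedX (fun x y v =>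
      (a x y)%:C *: (entry T0 x y v - entry T x y v)) e1 (t + t) N2 (ltW e10)
        N2P.
  - move=> x y u v w; rewrite T0lin Tlin opprD addrACA -scalerBr scalerDr
    !scalerA.
    by rewrite [u * _]mulrC.
  - move=> x y v; rewrite (le_trans (aZ _ _ _))//.
    by rewrite rnorm_distC; apply: entry_sub_bounded_by (ltW e10) TT0 _.
  - by move=> x y xy; apply/funext => v; rewrite at_// scale0r.
  exists B; split=> //.
  apply: (schur_bounded_by boundedX (ltW e10) Tdiff Bb h1 ht) => x y v.
  by rewrite BE.
have [C [Cb CE]] : exists C : operator, bounded_by C e1 /\
    forall x y, entry C x y = fun v => (a x y)%:C *: (entry T x y v - tr x y v).
  have [|||C [Cb CE]] := @matrix_operator R X H boundedX (fun x y v =>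
      (a x y)%:C *: (entry T x y v - tr x y v)) del (t + t) N2 (ltW del0) N2P.
  - move=> x y u v w; rewrite Tlin trlin opprD addrACA -scalerBr scalerDr
    !scalerA.
    by rewrite [u * _]mulrC.
  - move=> x y v; rewrite (le_trans (aZ _ _ _))//.
    by have [_ + _] := trP x y; exact.
  - by move=> x y xy; apply/funext => v; rewrite at_// scale0r.
  by exists C; split=> //; exact: bounded_byW Cb.
(* The support of [phi] contains [Y], so this is [phi T - T] on the rows of [Y] and 0 elsewhere. *)
pose F f : l2 X H := Lambda phi (chi Y (T f)) - chi (fproj_supp phi `&` Y) (T
  f).
have FE f x : F f x = if x \in Y then phi x (T f x) - T f x else 0.
  have -> : F f x = phi x (if x \in Y then T f x else 0) -
    (if x \in fproj_supp phi `&` Y then T f x else 0) by [].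
  rewrite in_setI; case: (boolP (x \in Y)) => [|_]; last first.
    by rewrite andbF linear0 subr0.
  by rewrite inE => /Yphi xphi; rewrite (mem_set xphi).
have Fb : bounded_by F e1.
  apply: (bounded_byW (ltW (phi0P phi Gphi phi0phi))).
  apply: (@opnorm_bounded_by _ _ F c) => [u f|f].
    apply/val_inj/funext => x; have -> : val (u *: F f) x = u *: F f x by [].
    rewrite [val _ x]FE FE; case: (x \in Y); last by rewrite scaler0.
    by rewrite linearZ/= [X in phi x X]/(u *: T f x) linearZ/= -scalerBr.
  apply: le_trans (l2_rnorm_mono _) (Tc f) => x; rewrite FE.
  by case: (x \in Y); rewrite ?rnorm0 ?rnorm_ge0// fproj_compl_rnorm_le.
move=> f; pose gs : seq (l2 X H) := [:: F f; T f - T0 f; D0 f; B f; C f].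
have -> : e * rnorm f = (size gs)%:R * (e1 * rnorm f).
  by rewrite /= /e1 mulrA mulrCA divff ?mulr1.
apply: l2_dominated => [|g|x].
- by rewrite mulr_ge0 ?rnorm_ge0// ltW.
- rewrite /gs !inE => /orP[/eqP ->|/orP[/eqP ->|/orP[/eqP ->|/orP[/eqP ->|/eqP
  ->]]]];
    [exact: Fb|exact: TT0|exact: D0b|exact: Bb|exact: Cb].
rewrite /gs !big_cons big_nil addr0.
have -> : (T f - S f : l2 X H) x = T f x - S f x by [].
have -> : (T f - T0 f : l2 X H) x = T f x - T0 f x by [].
have n0 (g : l2 X H) : 0 <= rnorm (g x) by exact: rnorm_ge0.
case: (boolP (x \in Y)) => xY.
  have -> : S f x = phi x (T0 f x).
    by apply: (row_ext Sb' T0d (phi1 x)) => y v; rewrite SE /m xY.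
  (* On these rows [T - phi T0] splits into [T - phi T] and [phi (T - T0)]. *)
  rewrite (_ : T f x - _ = - F f x + phi x (T f x - T0 f x)).
    rewrite (le_trans (ler_rnormD _ _))// rnormN lerD2l.
    rewrite (le_trans (fproj_rnorm_le _ _))// lerDl.
    by rewrite !addr_ge0.
  by rewrite FE xY opprB linearB/= addrA subrK.
(* Telescoping on the other rows: subtracting [(1 - a) T0], [a (T0 - T)] and [a (T - tr)] from [T0]
   leaves [a tr]. *)
pose S' : operator := T0 \- D0 \- B \- C.
have id1 : bounded_by (idfun : {linear H -> H}) 1 by move=> v; rewrite mul1r.
have S'b : bounded_by S' (d + e1 + e1 + e1).
  move=> g; rewrite /S' /= !mulrDl.
  by do 3!(rewrite (le_trans (ler_rnormD _ _))// rnormN lerD//).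
have -> : S f x = S' f x.
  apply: (row_ext Sb' S'b id1) => y v; rewrite SE /m (negbTE xY) /=.
  have -> : entry S' x y v = entry T0 x y v - entry D0 x y v - entry B x y v -
    entry C x y v.
    by [].
  rewrite D0E BE CE (negbTE xY) rmorphB rmorph1 scalerBl scale1r !scalerBr.
  by rewrite !subKr.
have -> : T f x - S' f x = T f x - T0 f x + D0 f x + B f x + C f x.
  have -> : S' f x = T0 f x - D0 f x - B f x - C f x by [].
  by rewrite !opprD !opprK !addrA.
have le3 (u v w z : H) : rnorm (u + v + w + z) <= rnorm u + rnorm v + rnorm w +
  rnorm z.
  by do 2!(rewrite (le_trans (ler_rnormD _ _))// lerD2r); exact: ler_rnormD.
apply: le_trans (le3 _ _ _ _) _; have := n0 (F f); lra.
Qed.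

End ideals.

Theorem theorem5p10 (R : realType) (X : metricType R) (H : hilbertType R)
    (discreteX : forall x : X, open [set x])
    (boundedX : bounded_geometry X)
    (separableH : separable H) (infdimH : infinite_dimensional H)
    (D : set (X -> X -> nat)) (rdD : rank_distribution D) :
  (partial_property_A_towards (~` U_of D) -> Lambda_approximation H D ->
    I_ideal H D = I_tilde H D) /\
  (I_ideal H D = I_tilde H D -> Lambda_approximation H D).
Proof.
split=> [propA LA|]; last exact: Lambda_approximation_of_eq.
apply/seteqP; split; first exact: I_ideal_sub_tilde.
exact: I_tilde_sub_ideal.
Qed.
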